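(* Let $n\ge 1$ and $1\le k\le n$ be integers. Let $\mathcal F_{n,k}$ be the set of non-crossing forests on $n$ vertices with $k$ components, and let the cyclic group $\langle\rho\rangle$ of order $n$ act on $\mathcal F_{n,k}$ by rotation (the generator $\rho$ rotating by $2\pi/n$). Let $$f_{n,k}(q)=\frac{1}{[2n-k]_q}\begin{bmatrix} n\\ k-1\end{bmatrix}_q\begin{bmatrix} 3n-2k-1\\ n-k\end{bmatrix}_q.$$ Then the triple $(\mathcal F_{n,k},\langle\rho\rangle,f_{n,k}(q))$ exhibits the cyclic sieving phenomenon; that is, $f_{n,k}(q)$ is a polynomial in $q$ with nonnegative integer coefficients, and for every $c\in\langle\rho\rangle$ we have $f_{n,k}(\omega_{o(c)})=|\{\Phi\in\mathcal F_{n,k}: c(\Phi)=\Phi\}|$, where $o(c)$ is the order of $c$ and $\omega_{o(c)}$ is a primitive $o(c)$-th root of unity.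
   Context: A non-crossing graph on $n$ vertices is a graph whose vertices are $n$ fixed points arranged on a circle (labelled $1,\dots,n$ clockwise) and whose edges are straight line segments that do not cross; a non-crossing forest is an acyclic non-crossing graph. The $q$-analogues are $[m]_q=1+q+\dots+q^{m-1}=\frac{1-q^m}{1-q}$, $[m]_q!=[m]_q[m-1]_q\cdots[1]_q$, and $\begin{bmatrix} m\\ j\end{bmatrix}_q=\frac{[m]_q!}{[j]_q![m-j]_q!}$ (zero if $j<0$ or $j>m$). A triple $(X,C,X(q))$ with $X$ a finite set, $C$ a finite cyclic group acting on $X$, and $X(q)$ a polynomial with nonnegative integer coefficients exhibits the cyclic sieving phenomenon if $X(\omega_{o(c)})$ equals the number of fixed points of $c$ on $X$ for all $c\in C$. *)

(* Defs.v *)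
From HB Require Import structures.
From mathcomp Require Import all_boot all_order all_algebra all_fingroup all_field.
Set Implicit Arguments. Unset Strict Implicit. Unset Printing Implicit Defensive.
Import Order.TTheory GRing.Theory Num.Theory.

(* A graph on the n points 0,...,n-1 of the circle (labelled clockwise) is a
   set of edges; each edge is a 2-element set of vertices (a straight chord). *)
Definition graph n := {set {set 'I_n}}.

Definition simple_edges n (G : graph n) : bool := [forall e in G, #|e| == 2].

Definition adj n (G : graph n) : rel 'I_n := fun x y => [set x; y] \in G.

Definition crossing n (a b c d : 'I_n) : bool := (a < c < b) && (b < d).

Definition non_crossing n (G : graph n) : bool :=
  [forall a : 'I_n, forall b : 'I_n, forall c : 'I_n, forall d : 'I_n,
    ([set a; b] \in G) && ([set c; d] \in G) ==> ~~ crossing a b c d].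

(* acyclic: there is no cycle, i.e. no duplicate-free closed walk
   v_0 v_1 ... v_{m-1} v_0 with m >= 3 distinct vertices.  A duplicate-free
   sequence of vertices has length m <= n, so it is given as the codomain
   (in order) of a finite function f : 'I_m -> 'I_n with m < n.+1. *)
Definition acyclic n (G : graph n) : bool :=
  ~~ [exists m : 'I_n.+1, exists f : {ffun 'I_m -> 'I_n},
        [&& uniq (codom f), 3 <= m & path.cycle (adj G) (codom f)]].

Definition n_components n (G : graph n) : nat :=
  #|[set [set y | connect (adj G) x y] | x : 'I_n]|.


Definition NCF n k : {set graph n} :=
  [set G : graph n | simple_edges G && non_crossing G
     && acyclic G && (n_components G == k)].

Definition rho n : {perm 'I_n} := perm (@ordS_inj n).

Definition act_graph n (c : {perm 'I_n}) (G : graph n) : graph n :=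
  [set c @: (e : {set 'I_n}) | e in G].

Definition n_fixed n k (c : {perm 'I_n}) : nat :=
  #|[set G in NCF n k | act_graph c G == G]|.

Local Open Scope ring_scope.
Definition qint (m : nat) : {poly rat} := \sum_(i < m) 'X^i.
Definition qfact (m : nat) : {poly rat} := \prod_(i < m) qint i.+1.
(* exact polynomial division: [m]!/([j]![m-j]!) is a polynomial *)
Definition qbinom (m j : nat) : {poly rat} :=
  if (j <= m)%N then qfact m %/ (qfact j * qfact (m - j)) else 0.

(* Main.v *)
(* A region of the disk cut by non-crossing chords is bounded by chords and by
   arcs of the circle; the chord graph is a forest iff every region has an arc.
   So, seen from the region of a distinguished arc, a forest is a plane tree
   of regions, each with at least one arc, and counts of forests on a segment
   with m edges and j exposed arcs are coefficients of z^j C^(j+1), where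
   C = 1/(1-T), T = t (z C^2 + z^2 C^3 + ...); these are explicit products.
   A forest invariant under the rotation of order e > 1 either contains a
   diameter (then e = 2 and it is determined by one half), or has a central
   region; cutting along an arc of the central region leaves one linear forest
   on n/e points, and double counting pairs (forest, central arc) gives the
   count.  These numbers are compared with the values of the polynomial, which
   follow from the q-Lucas theorem.
   With d = gcd(n,k) the polynomial is the product of
   [d]/[3n-2k] * bin(3n-2k, n-k) and bin(n, k-1)/[d]; both are polynomials by a
   Bezout identity for q-integers, and both have nonnegative coefficients
   because Gaussian coefficients are symmetric and unimodal (representation of
   sl_2 on an exterior power). *)
Require Import Defs.
From HB Require Import structures.
From mathcomp Require Import all_boot all_order all_algebra all_fingroup all_field.
From mathcomp Require Import all_solvable zify ring.
Set Implicit Arguments. Unset Strict Implicit. Unset Printing Implicit Defensive.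
Import Order.TTheory GRing.Theory Num.Theory.
Local Open Scope ring_scope.

(** The quotient [f] is never computed; it is handled through product identities. If [e > 1] divides
    [k], both sides of the defining identity vanish at a root of order [e], so a second identity,
    with [[3n-2k]] and [[k]], is evaluated after cancelling [[e]]. Nonnegativity does not pass to
    quotients in general; it does here because each factor has the form [P (1-q^b)/(1-q^a)] with
    [b <= a] and [P] symmetric and unimodal. The explicit products for the powers of [C] are those
    predicted by Lagrange inversion. They are only verified, against the recurrence
    [C^(s+1) = C^s + T C^(s+1)], so no formal power series are needed. In the three final sums the
    exponent of [C] plus the degree in [z] is constant, so one binomial leaves the sum and a
    hockey-stick sum remains. Acyclicity is defined by cycles, while the counting uses exposed arcs.
    The link is that a graph is acyclic as soon as every nonempty set of its edges has a vertex cut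
    crossed by exactly one of them. *)

Local Notation pX := ('X : {poly rat}).

(** * q-integers and Gaussian coefficients *)

(** The base is a parameter because the sum is used at ['X], at powers of ['X] and at roots of
    unity. *)
Definition qnum (R : pzRingType) (q : R) (m : nat) : R := \sum_(i < m) q ^+ i.

(** The q-Pascal rule keeps its meaning at roots of unity, where the q-factorials vanish. *)
Fixpoint qbin (R : pzRingType) (q : R) (m j : nat) : R :=
  match m, j with
  | _, 0 => 1
  | 0, _.+1 => 0
  | m'.+1, j'.+1 => qbin q m' j' + q ^+ j'.+1 * qbin q m' j'.+1
  end.

Section QNumbers.
Variables (R : comPzRingType) (q : R).
Implicit Types m j d : nat.

Lemma qnum0 : qnum q 0 = 0. Proof. by rewrite /qnum big_ord0. Qed.
Lemma qnum1 : qnum q 1 = 1. Proof. by rewrite /qnum big_ord1. Qed.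

Lemma qnumS m : qnum q m.+1 = qnum q m + q ^+ m.
Proof. by rewrite /qnum big_ord_recr. Qed.

Lemma qnumD m d : qnum q (m + d) = qnum q m + q ^+ m * qnum q d.
Proof.
elim: d => [|d IH]; first by rewrite addn0 qnum0 mulr0 addr0.
by rewrite addnS !qnumS IH exprD mulrDr addrA.
Qed.

Lemma qnumM m d : qnum q (m * d) = qnum q m * qnum (q ^+ m) d.
Proof.
elim: d => [|d IH]; first by rewrite muln0 /qnum !big_ord0 mulr0.
rewrite mulnS addnC qnumD IH exprM.
by rewrite /qnum [X in _ = _ * X]big_ord_recr /= mulrDr [_ ^+ _ * _]mulrC.
Qed.

Lemma qnum_geom m : qnum q m * (1 - q) = 1 - q ^+ m.
Proof.
elim: m => [|m IH]; first by rewrite qnum0 expr0; ring.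
by rewrite qnumS mulrDl IH exprS; ring.
Qed.

Lemma qbin0 m : qbin q m 0 = 1. Proof. by case: m. Qed.

Lemma qbinS m j :
  qbin q m.+1 j.+1 = qbin q m j + q ^+ j.+1 * qbin q m j.+1.
Proof. by []. Qed.

Lemma qbin_small m j : (m < j)%N -> qbin q m j = 0.
Proof.
elim: m j => [|m IH] [|j] //= lt_mj.
by rewrite !IH ?mulr0 ?addr0 //; lia.
Qed.

Lemma qbinn m : qbin q m m = 1.
Proof. by elim: m => [|m IH] //=; rewrite IH qbin_small // mulr0 addr0. Qed.

End QNumbers.

Lemma rmorph_qnum (R S : comPzRingType) (g : {rmorphism R -> S}) (q : R) m :
  g (qnum q m) = qnum (g q) m.
Proof. by rewrite rmorph_sum; apply: eq_bigr => i _; rewrite rmorphXn. Qed.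

Lemma rmorph_qbin (R S : comPzRingType) (g : {rmorphism R -> S}) (q : R) m j :
  g (qbin q m j) = qbin (g q) m j.
Proof.
elim: m j => [|m IH] [|j] /=; rewrite ?rmorph1 ?rmorph0 //.
by rewrite rmorphD rmorphM !rmorphXn !IH.
Qed.

Lemma qintE m : qint m = qnum pX m. Proof. by []. Qed.

Lemma qint_neq0 m : qint m.+1 != 0.
Proof.
apply/eqP => /(congr1 (fun p : {poly rat} => p.[1])).
rewrite horner0 /qint horner_sum (eq_bigr (fun=> 1)) => [|i _].
  by rewrite sumr_const card_ord => /eqP; rewrite pnatr_eq0.
by rewrite hornerXn expr1n.
Qed.

Lemma qfactS m : qfact m.+1 = qint m.+1 * qfact m.
Proof. by rewrite /qfact big_ord_recr mulrC. Qed.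

Lemma qfact0 : qfact 0 = 1. Proof. exact: big_ord0. Qed.

Lemma qfact_neq0 m : qfact m != 0.
Proof. by apply/prodf_neq0 => i _; apply: qint_neq0. Qed.

Lemma qbin_qfact a b : qbin pX (a + b) a * (qfact a * qfact b) = qfact (a + b).
Proof.
move Es: (a + b)%N => s; elim: s a b Es => [|s IH] [|a] [|b] // Es.
- by rewrite qfact0 /= !mul1r.
- by rewrite qbin0 qfact0 !mul1r -Es.
- by rewrite -Es addn0 qbinn qfact0 mulr1 mul1r.
rewrite qbinS mulrDl.
have E1 := IH a b.+1 ltac:(lia).
have E2 := IH a.+1 b ltac:(lia).
rewrite [qfact s.+1]qfactS.
have -> : qint s.+1 = qint a.+1 + 'X^(a.+1) * qint b.+1.
  by rewrite !qintE -qnumD; congr qnum; lia.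
rewrite mulrDl -{1}E1 -E2 !qfactS; ring.
Qed.

Lemma qbinom_qbin m j : qbinom m j = qbin pX m j.
Proof.
rewrite /qbinom; case: leqP => [le_jm|lt_mj]; last by rewrite qbin_small.
rewrite -{1}(subnKC le_jm) -qbin_qfact subnKC // mulpK //.
by rewrite mulf_neq0 ?qfact_neq0.
Qed.

Lemma qbin_sym a b : qbin pX (a + b) a = qbin pX (a + b) b.
Proof.
apply: (@mulIf _ (qfact a * qfact b)); first by rewrite mulf_neq0 ?qfact_neq0.
by rewrite qbin_qfact addnC [qfact a * _]mulrC qbin_qfact.
Qed.

Lemma qbin_absorb m j : qint j.+1 * qbin pX m.+1 j.+1 = qint m.+1 * qbin pX m j.
Proof.
case: (leqP j m) => [le_jm|lt_mj]; last by rewrite !qbin_small ?mulr0.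
have -> : m = (j + (m - j))%N by lia.
move: (m - j)%N => b {le_jm m}.
apply: (@mulIf _ (qfact j * qfact b)); first by rewrite mulf_neq0 ?qfact_neq0.
rewrite -[RHS]mulrA qbin_qfact -qfactS -addSn -qbin_qfact !qfactS; ring.
Qed.

Lemma qbin_absorb_compl m j : (j <= m)%N ->
  qint (m.+1 - j) * qbin pX m.+1 j = qint m.+1 * qbin pX m j.
Proof.
move=> le_jm; have [b Em] : exists b, m = (b + j)%N by exists (m - j)%N; lia.
rewrite Em -[qbin _ _ j in RHS]qbin_sym -qbin_absorb -addSn addnK.
by rewrite qbin_sym.
Qed.

Lemma qbin_step m j : (j <= m)%N ->
  qint (m.+1 - j) * qbin pX m.+1 j = qint j.+1 * qbin pX m.+1 j.+1.
Proof. by move=> le_jm; rewrite qbin_absorb qbin_absorb_compl. Qed.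

(** * Gaussian coefficients at roots of unity *)

Section QLucas.
Variables (w : algC) (e : nat).
Hypothesis prim_w : e.-primitive_root w.

Lemma eval_qint m : (map_poly ratr (qint m)).[w] = qnum w m.
Proof.
rewrite qintE (rmorph_qnum (map_poly ratr)) -/(horner_eval w _).
by rewrite (rmorph_qnum (horner_eval w)) /= /horner_eval map_polyX hornerX.
Qed.

Lemma eval_qbin m j : (map_poly ratr (qbin pX m j)).[w] = qbin w m j.
Proof.
rewrite (rmorph_qbin (map_poly ratr)) -/(horner_eval w _).
by rewrite (rmorph_qbin (horner_eval w)) /= /horner_eval map_polyX hornerX.
Qed.

Lemma qnum_prim_neq0 m : ~~ (e %| m)%N -> qnum w m != 0.
Proof.
apply: contraNneq => qm0; have := qnum_geom w m.
by rewrite qm0 mul0r (prim_order_dvd prim_w) => /esym/eqP; rewrite subr_eq0 eq_sym.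
Qed.

Lemma prim_neq1 : (1 < e)%N -> w != 1.
Proof.
move=> e1; apply/negP => /eqP Ew.
have := prim_order_dvd prim_w 1; rewrite Ew expr1n eqxx dvdn1 => /esym/eqP; lia.
Qed.

Lemma qnum_prim_eq m d : (1 < e)%N -> m = d %[mod e] -> qnum w m = qnum w d.
Proof.
move=> e1 /eqP; rewrite -(eq_prim_root_expr prim_w) => /eqP Ewm.
apply: (@mulIf _ (1 - w)); first by rewrite subr_eq0 eq_sym prim_neq1.
by rewrite !qnum_geom Ewm.
Qed.

(** Absorption gives [[s] bin(e, s) = [e] bin(e-1, s-1)]; at [w] the factor [[e]] is 0 and [[s]] is
    not. *)
Lemma qbin_prim_eq0 s : (0 < s < e)%N -> qbin w e s = 0.
Proof.
case: s => // s; case Ee: e => [|e'] // /andP[_ lt_se].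
have := congr1 (fun p => (map_poly ratr p).[w]) (qbin_absorb e' s).
rewrite !rmorphM !hornerM !eval_qint !eval_qbin.
have -> : qnum w e'.+1 = 0.
  by rewrite -Ee (@qnum_prim_eq e 0) ?qnum0 ?modnn ?mod0n //; lia.
move/eqP; rewrite mul0r mulf_eq0 => /orP[|/eqP //].
by rewrite (negPf (qnum_prim_neq0 _)) // Ee gtnNdvd.
Qed.

Lemma qLucas m j :
  qbin w m j = 'C(m %/ e, j %/ e)%:R * qbin w (m %% e) (j %% e).
Proof.
have e_gt0 := prim_order_gt0 prim_w.
have ltS a : (a %% e).+1 <> e -> ((a %% e).+1 < e)%N.
  by move=> ne; rewrite ltn_neqAle ltn_pmod // andbT; apply/eqP.
have divS a : (a.+1 %/ e)%N = if (a %% e).+1 == e then (a %/ e).+1 else (a %/ e)%N.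
  rewrite [in LHS](divn_eq a e) -addnS divnMDl //; case: eqP => [->|ne].
    by rewrite divnn e_gt0 addn1.
  by rewrite [(_.+1 %/ e)%N]divn_small ?addn0 //; apply: ltS.
have modS a : (a.+1 %% e)%N = if (a %% e).+1 == e then 0%N else (a %% e).+1.
  rewrite [in LHS](divn_eq a e) -addnS modnMDl; case: eqP => [->|ne].
    by rewrite modnn.
  by rewrite [LHS]modn_small //; apply: ltS.
elim: m j => [|m IH] [|j]; rewrite ?div0n ?mod0n ?qbin0 ?bin0 ?mulr1 //.
  rewrite /= bin0n.
  case: (posnP (j.+1 %/ e)) => [D0|D1]; last by rewrite mul0r.
  have := divn_eq j.+1 e; rewrite D0 mul0n add0n => <-.
  by rewrite mulr0.
rewrite qbinS !IH !divS !modS.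
have -> : w ^+ j.+1 = w ^+ (j %% e).+1.
  by apply/eqP; rewrite (eq_prim_root_expr prim_w) -[in X in _ == X]addn1 modnDml addn1.
have lm := ltn_pmod m e_gt0; have lj := ltn_pmod j e_gt0.
(* The cases are the carries in [m+1] and [j+1]. With both, the claim is Pascal's rule for the
   quotients; with a carry in [m+1] only, the residues form [bin(e, s) = 0] with [0 < s < e]; with
   one in [j+1] only, [bin(m mod e, e-1) = 0]; with none, it is the q-Pascal rule for the
   residues. *)
case: ((m %% e).+1 =P e) => [Em|Em]; case: ((j %% e).+1 =P e) => [Ej|Ej].
- rewrite !qbin0 -[(m %% e)%N]/(m %% e)%N.
  have -> : (m %% e)%N = (j %% e)%N by lia.
  by rewrite qbinn Ej (prim_expr_order prim_w) binS natrD; ring.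
- rewrite mulrCA -mulrDr -qbinS Em qbin_prim_eq0 ?mulr0; last by lia.
  by rewrite /= ?mulr0.
- rewrite !qbin0 Ej (prim_expr_order prim_w).
  by rewrite [qbin w _ (j %% e)]qbin_small ?mulr0; [ring|lia].
- by rewrite qbinS; ring.
Qed.

End QLucas.

(** * Dividing Gaussian coefficients by q-integers *)

Lemma qint_Bezout a b : exists U V, U * qint a + V * qint b = qint (gcdn a b).
Proof.
case: (posnP a) => [->|a_gt0]; first by exists 0, 1; rewrite gcd0n; ring.
case: (egcdnP b a_gt0) => u v E _.
(* From [u a = v b + g], with [g] the gcd, [[u a] = [g] + q^g [v b]]; and [[u a]], [[v b]] are
   multiples of [[a]], [[b]]. *)
exists (qnum ('X^a) u), (- ('X^(gcdn a b) * qnum ('X^b) v)).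
have -> : qnum 'X^a u * qint a = qint (gcdn a b) + 'X^(gcdn a b) * (qint b * qnum 'X^b v).
  by rewrite mulrC !qintE -!qnumM -qnumD; congr qnum; lia.
ring.
Qed.

(** Write [[gcd] = U [m] + V [j]]. Absorption turns [[j] bin(m, j)] into [[m] bin(m-1, j-1)], so
    [[m]] factors out. *)
Lemma qbin_gcd_quotient m j : (0 < m)%N ->
  exists A, A * qint m = qint (gcdn m j) * qbin pX m j.
Proof.
case: m => // m _; have [U [V <-]] := qint_Bezout m.+1 j.
case: j => [|j].
  by exists U; rewrite qbin0 mulr1 [qint 0]qnum0 mulr0 addr0.
exists (U * qbin pX m.+1 j.+1 + V * qbin pX m j).
rewrite !mulrDl -[V * qint _ * _]mulrA qbin_absorb; ring.
Qed.

(** Multiply [bin(n, j)] by [1 = U [d] + V [j]]: the second term becomes [V [n] bin(n-1, j-1)], and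
    [[n]] is a multiple of [[d]]. *)
Lemma qbin_coprime_quotient n j d : (d %| n)%N -> coprime d j ->
  exists B, B * qint d = qbin pX n j.
Proof.
case/dvdnP => t ->; rewrite mulnC => /eqP cop_dj.
have [U [V E]] := qint_Bezout d j; move: E; rewrite cop_dj [qint 1]qnum1 => E.
case: (posnP (d * t)) => [->|].
  case: j cop_dj E => [|j] cop_dj E.
    by move: cop_dj; rewrite gcdn0 => ->; exists 1; rewrite qbin0 [qint 1]qnum1 mulr1.
  by exists 0; rewrite /= mul0r.
case Edt: (d * t)%N => [|m] // _; case: j cop_dj E => [|j] _ E.
  by exists U; rewrite qbin0 -E [qint 0]qnum0; ring.
exists (U * qbin pX m.+1 j.+1 + V * qnum ('X^d) t * qbin pX m j).
rewrite -[RHS]mul1r -E [in RHS]mulrDl -[V * qint _ * _]mulrA qbin_absorb.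
rewrite [qint m.+1]qintE -Edt qnumM -qintE; ring.
Qed.

(* Comparing coefficients expresses Q_i from Q_{i-a} on the lower half and from
   Q_{i+a} on the upper half, in both cases with a nonnegative correction. *)
Lemma unimodal_quotient_nat (P Q : {poly rat}) D a b :
    (0 < a)%N -> (b <= a)%N -> (forall i, P`_i \is a Num.nat) ->
    (forall x y, (x <= y)%N -> (x + y <= D)%N -> P`_x <= P`_y) ->
    (forall x y, (x <= y)%N -> (D <= x + y)%N -> P`_y <= P`_x) ->
    Q * (1 - 'X^a) = P * (1 - 'X^b) ->
  forall i, Q`_i \is a Num.nat.
Proof.
move=> a_gt0 le_ba Pnat Pup Pdown E.
have coefE (S : {poly rat}) c i :
    (S * (1 - 'X^c))`_i = S`_i - (if (i < c)%N then 0 else S`_(i - c)).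
  by rewrite mulrBr mulr1 coefB coefMXn.
have rec i : Q`_i - (if (i < a)%N then 0 else Q`_(i - a))
           = P`_i - (if (i < b)%N then 0 else P`_(i - b)).
  by rewrite -!coefE E.
have Pint i : P`_i \is a Num.int by apply: intr_nat.
have natP (x : rat) : x \is a Num.int -> 0 <= x -> x \is a Num.nat.
  by move=> xi x0; rewrite natrEint xi.
(* The bound says [(i-b) + i <= D], the range where [P] does not decrease from [i-b] to [i]. Beyond
   it the recurrence is run backwards, from indices past the degree of [Q]. *)
have low i : (i.*2 <= D + b)%N -> Q`_i \is a Num.nat.
  elim/ltn_ind: i => i IH le_i.
  have -> : Q`_i = (if (i < a)%N then 0 else Q`_(i - a))
                 + (P`_i - (if (i < b)%N then 0 else P`_(i - b))).
    by rewrite -rec addrC subrK.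
  apply: rpredD; first by case: ifP => // ia; apply: IH; lia.
  apply: natP; first by rewrite rpredB //; case: ifP.
  rewrite subr_ge0; case: ifP => ib; first exact: natr_ge0.
  by apply: Pup; lia.
have high d : forall i, (i + d = size Q + a)%N -> (D + b < i.*2)%N -> Q`_i \is a Num.nat.
  elim/ltn_ind: d => d IH i Ei le_i.
  have [le_si|lt_is] := leqP (size Q) i; first by rewrite nth_default.
  have := rec (i + a)%N; rewrite ltnNge leq_addl /= addnK => R.
  have -> : Q`_i = Q`_(i + a) +
      ((if (i + a < b)%N then 0 else P`_(i + a - b)) - P`_(i + a)).
    by rewrite -[_ - P`_(_ + _)]opprB -R opprB addrC subrK.
  apply: rpredD; first by apply: (IH (d - a)%N); lia.
  apply: natP; first by rewrite rpredB //; case: ifP.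
  rewrite subr_ge0; case: ifP => ib; first by lia.
  by apply: Pdown; lia.
move=> i; case: (leqP i.*2 (D + b)) => [/low //|lt_i].
case: (leqP i (size Q)) => [le_i|lt_is].
  by apply: (high (size Q + a - i)%N); lia.
by rewrite nth_default // ltnW.
Qed.

(** * Unimodality of Gaussian coefficients *)

Definition weight m (S : {set 'I_m}) : nat := \sum_(i in S) i.

Lemma sum_set_recl m (V : nmodType) (F : {set 'I_m.+1} -> V) :
  \sum_S F S = \sum_(S : {set 'I_m}) F (lift ord0 @: S)
             + \sum_(S : {set 'I_m}) F (ord0 |: lift ord0 @: S).
Proof.
have n0 (S : {set 'I_m}) : ord0 \notin lift ord0 @: S.
  by apply/imsetP => -[x _ /eqP]; rewrite (negPf (neq_lift _ _)).
have mem_l (S : {set 'I_m}) x : (lift ord0 x \in lift ord0 @: S) = (x \in S).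
  by rewrite mem_imset //; apply: lift_inj.
rewrite (bigID (fun S : {set _} => ord0 \notin S)) /=; congr (_ + _).
  rewrite (reindex_onto (fun S : {set 'I_m} => lift ord0 @: S)
                        (fun S : {set 'I_m.+1} => [set x : 'I_m | lift ord0 x \in S])) /=.
    apply: eq_bigl => S; rewrite n0; apply/eqP/setP => x.
    by rewrite inE mem_l.
  move=> S S0; apply/setP => x; case: (unliftP ord0 x) => [y|] ->.
    by rewrite mem_l inE.
  by rewrite (negPf (n0 _)) (negPf S0).
rewrite (reindex_onto (fun S : {set 'I_m} => ord0 |: lift ord0 @: S)
                      (fun S : {set 'I_m.+1} => [set x : 'I_m | lift ord0 x \in S])) /=.
  apply: eq_bigl => S; rewrite setU11; apply/eqP/setP => x.
  by rewrite !inE mem_l eq_sym (negPf (neq_lift _ _)).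
move=> S; rewrite negbK => S0; apply/setP => x.
case: (unliftP ord0 x) => [y|] ->; last by rewrite setU11 S0.
by rewrite in_setU1 mem_l inE eq_sym (negPf (neq_lift _ _)).
Qed.

(** Split the subsets by whether they contain 0 and shift the other elements down by one; the weight
    drops by their number, which is the q-Pascal rule. The exponent ['C(j, 2)] is the weight of
    [{0, ..., j-1}]. *)
Lemma sum_weight_qbin m j :
  \sum_(S : {set 'I_m} | #|S| == j) 'X^(weight S)
    = 'X^('C(j, 2)) * qbin pX m j.
Proof.
have card_l m' (S : {set 'I_m'}) : #|lift ord0 @: S| = #|S|.
  by rewrite card_imset //; apply: lift_inj.
have wt_l m' (S : {set 'I_m'}) : weight (lift ord0 @: S) = (weight S + #|S|)%N.
  rewrite /weight big_imset /=; last by move=> ? ? _ _; apply: lift_inj.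
  by rewrite -sum1_card -big_split; apply: eq_bigr => i _; rewrite /bump addnC.
have n0 m' (S : {set 'I_m'}) : ord0 \notin lift ord0 @: S.
  by apply/imsetP => -[x _ /eqP]; rewrite (negPf (neq_lift _ _)).
elim: m j => [|m IH] j.
  rewrite (eq_bigl (fun S => (S == set0) && (j == 0)%N)) => [|S]; last first.
    by rewrite (_ : S = set0) ?cards0 1?eqxx 1?eq_sym //; apply/setP => -[].
  case: j => [|j] /=.
    by rewrite (big_pred1 set0) => [|S]; rewrite ?andbT // /weight big_set0 mulr1.
  by rewrite big1 ?mulr0 // => S; rewrite andbF.
rewrite big_mkcond sum_set_recl /=.
under eq_bigr do rewrite card_l wt_l.
under [X in _ + X]eq_bigr do rewrite cardsU1 n0 card_l /weight big_setU1 //= -/(weight _) wt_l.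
rewrite -!big_mkcond /=.
case: j => [|j].
  rewrite [X in _ + X]big1 // addr0; have := IH 0%N; rewrite qbin0 => <-.
  by apply: eq_bigr => S /eqP ->; rewrite addn0.
rewrite mulrDr [RHS]addrC; congr (_ + _).
  rewrite mulrCA -IH big_distrr /=; apply: eq_bigr => S /eqP ->.
  by rewrite exprD mulrC.
rewrite binS bin1 addnC exprD -mulrA -IH big_distrr /=.
apply: eq_big => [S|S]; first by rewrite add1n.
by rewrite add1n => /eqP[->]; rewrite add0n exprD mulrC.
Qed.

Lemma coef_qbin m j r : (qbin pX m j)`_r =
  #|[set S : {set 'I_m} | (#|S| == j) && (weight S == r + 'C(j, 2))%N]|%:R.
Proof.
have <- : ('X^('C(j, 2)) * qbin pX m j)`_(r + 'C(j, 2)) = (qbin pX m j)`_r.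
  by rewrite coefXnM ltnNge leq_addl /= addnK.
rewrite -sum_weight_qbin coef_sum -sum1_card natr_sum.
rewrite [RHS](eq_bigl (fun S : {set 'I_m} => (#|S| == j) && (weight S == r + 'C(j, 2))%N)).
  by rewrite [RHS]big_mkcondr; apply: eq_bigr => S _; rewrite coefXn eq_sym; case: eqP.
by move=> S; rewrite inE.
Qed.

(** The generating function has no monomial below ['X^('C(#|S|, 2))], and its terms cannot
    cancel. *)
Lemma weight_ge m (S : {set 'I_m}) : ('C(#|S|, 2) <= weight S)%N.
Proof.
rewrite leqNgt; apply/negP => lt_w.
have := congr1 (fun p : {poly rat} => p`_(weight S)) (sum_weight_qbin m #|S|).
rewrite coefXnM lt_w (bigD1 S) //= coefD coefXn eqxx coef_sum => /eqP.
rewrite gt_eqF // ltr_wpDr // sumr_ge0 // => T _.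
by rewrite coefXn ler0n.
Qed.

(** * The operators of sl_2 on functions of subsets *)

Section SL2.
Variable M : nat.
Implicit Types (S T : {set 'I_M.+1}) (phi : {set 'I_M.+1} -> rat) (i k : 'I_M).

Let lo i : 'I_M.+1 := widen_ord (leqnSn M) i.
Let hi i : 'I_M.+1 := lift ord0 i.
Let sw i T := tperm (lo i) (hi i) @: T.
(** These are the lowering coefficients of the irreducible representation of dimension [M+1], in the
    basis where raising has coefficients 1. On its exterior powers no sign appears, because moving
    an element to a free neighbouring place passes no other element. *)
Let cf i : rat := (i.+1 * (M - i))%N%:R.

Let raise phi T : rat :=
  \sum_i ((hi i \in T) && (lo i \notin T))%:R * phi (sw i T).
Let lower phi T : rat :=
  \sum_i cf i * ((lo i \in T) && (hi i \notin T))%:R * phi (sw i T).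

Lemma mem_sw i T x : (x \in sw i T) = (tperm (lo i) (hi i) x \in T).
Proof.
by rewrite -[in LHS](tpermK (lo i) (hi i) x) mem_imset //; apply: perm_inj.
Qed.

Lemma swK i : involutive (sw i).
Proof. by move=> T; apply/setP => x; rewrite !mem_sw tpermK. Qed.

Lemma sw_lo i T : (lo i \in sw i T) = (hi i \in T).
Proof. by rewrite mem_sw tpermL. Qed.

Lemma sw_hi i T : (hi i \in sw i T) = (lo i \in T).
Proof. by rewrite mem_sw tpermR. Qed.

Lemma sw_other i T x : x != lo i -> x != hi i -> (x \in sw i T) = (x \in T).
Proof. by move=> xl xh; rewrite mem_sw tpermD // eq_sym. Qed.

Lemma card_sw i T : #|sw i T| = #|T|.
Proof. by rewrite card_imset //; apply: perm_inj. Qed.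

Lemma weight_sw i T : hi i \in T -> lo i \notin T ->
  weight T = (weight (sw i T)).+1.
Proof.
move=> hT lT; rewrite /weight (bigD1 (hi i)) //= [in RHS](bigD1 (lo i)) ?sw_lo //=.
rewrite -addSn; congr (_ + _)%N; apply: eq_bigl => x.
have [->|xl] := eqVneq x (lo i); first by rewrite (negPf lT) andbF.
have [->|xh] := eqVneq x (hi i); first by rewrite sw_hi (negPf lT) andbF.
by rewrite sw_other.
Qed.

(** The relation [[e, f] = h] of sl_2: the place [x] has [h]-weight [2x - M], and the weights add up
    over [T]. *)
Lemma raise_lower phi T :
  raise (lower phi) T - lower (raise phi) T
    = ((weight T).*2%:R - (M * #|T|)%N%:R) * phi T.
Proof.
pose t1 i k := ((hi i \in T) && (lo i \notin T))%:R *
  (cf k * ((lo k \in sw i T) && (hi k \notin sw i T))%:R * phi (sw k (sw i T))).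
pose t2 i k := cf k * ((lo k \in T) && (hi k \notin T))%:R *
  (((hi i \in sw k T) && (lo i \notin sw k T))%:R * phi (sw i (sw k T))).
have -> : raise (lower phi) T = \sum_i \sum_k t1 i k.
  by apply: eq_bigr => i _; rewrite big_distrr.
have -> : lower (raise phi) T = \sum_i \sum_k t2 i k.
  rewrite exchange_big; apply: eq_bigr => k _.
  by rewrite big_distrr.
have t12 i k : k != i -> t1 i k = t2 i k.
  move=> ki; have ne x y : val x != val y -> x != y :> 'I_M.+1 by rewrite -val_eqE.
  (* If [i] and [k] are neighbours, the two indicators of each product contradict each other on the
     shared place, so [t1] and [t2] are both 0. Otherwise the transpositions commute. *)
  have [Ek|Nk] := eqVneq (k : nat) i.+1.
    have lk_hi : lo k = hi i by apply: val_inj.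
    have e1 : (hi i \in sw k T) = (hi k \in T) by rewrite -lk_hi sw_lo.
    rewrite /t1 /t2 e1 lk_hi sw_hi.
    by case: (lo i \in T); case: (hi k \in T); rewrite ?andbF /=; ring.
  have [Ei|Ni] := eqVneq (i : nat) k.+1.
    have hk_lo : hi k = lo i by apply: val_inj; rewrite /= /bump /=; lia.
    have e2 : (lo i \in sw k T) = (lo k \in T) by rewrite -hk_lo sw_hi.
    rewrite /t1 /t2 e2 hk_lo sw_lo.
    by case: (hi i \in T); case: (lo k \in T); rewrite ?andbF /=; ring.
  have h1 : lo k != lo i by apply: ne => /=; rewrite val_eqE.
  have h2 : lo k != hi i by apply: ne; rewrite /= /bump /=; lia.
  have h3 : hi k != lo i by apply: ne; rewrite /= /bump /=; lia.
  have h4 : hi k != hi i by rewrite (inj_eq (@lift_inj _ _)).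
  have swC : sw k (sw i T) = sw i (sw k T).
    apply/setP => x; rewrite !mem_sw -!permM.
    have -> // : commute (tperm (lo k) (hi k)) (tperm (lo i) (hi i)).
    by apply/commgP/conjg_fixP; rewrite tpermJ !tpermD // eq_sym.
  by rewrite /t1 /t2 swC !sw_other // 1?eq_sym // mulrCA.
(* For [k = i] the indicators collapse to a difference of memberships. In the sum a place [x] of [T]
   receives [x (M+1-x) - (x+1)(M-x) = 2x - M]. *)
rewrite -sumrB (eq_bigr (fun i => (cf i * (hi i \in T)%:R - cf i * (lo i \in T)%:R) * phi T)).
  rewrite -big_distrl /=; congr (_ * _); rewrite sumrB.
  have -> : \sum_i cf i * (hi i \in T)%:R = \sum_(x < M.+1) (x * (M.+1 - x))%N%:R * (x \in T)%:R.
    by rewrite [RHS]big_ord_recl /= mul0n mul0r add0r.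
  have -> : \sum_i cf i * (lo i \in T)%:R = \sum_(x < M.+1) (x.+1 * (M - x))%N%:R * (x \in T)%:R.
    by rewrite [RHS]big_ord_recr /= subnn muln0 mul0r addr0.
  rewrite -sumrB -mul2n natrM natr_sum natrM -sum1_card natr_sum !big_distrr /=.
  rewrite -sumrB [RHS]big_mkcond /=; apply: eq_bigr => x _.
  case: ifP => _; last by rewrite !mulr0 subrr.
  have le_xM : (x <= M)%N by rewrite -ltnS.
  rewrite !mulr1 natrM natrB 1?leqW // [_%:R * _]mulrC natrM natrB //; ring.
move=> i _; rewrite -sumrB (bigD1 i) //= big1 ?addr0 => [|k ki]; last first.
  by rewrite t12 // subrr.
rewrite /t1 /t2 !swK !sw_lo !sw_hi.
by case: (hi i \in T); case: (lo i \in T); rewrite /=; ring.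
Qed.

Lemma eq_lower phi psi : phi =1 psi -> lower phi =1 lower psi.
Proof. by move=> E T; apply: eq_bigr => i _; rewrite E. Qed.

Lemma eq_raise phi psi : phi =1 psi -> raise phi =1 raise psi.
Proof. by move=> E T; apply: eq_bigr => i _; rewrite E. Qed.

Lemma lowerZ a phi T : lower (fun S => a * phi S) T = a * lower phi T.
Proof. by rewrite /lower big_distrr; apply: eq_bigr => i _ /=; ring. Qed.

Lemma lower_supp j r phi :
    (forall T, ~~ ((#|T| == j) && (weight T == r)) -> phi T = 0) ->
  forall d T, ~~ ((#|T| == j) && (weight T + d == r)%N) -> iter d lower phi T = 0.
Proof.
move=> phi0; elim=> [|d IH] T nT; first by apply: phi0; rewrite addn0 in nT.
rewrite iterS /lower big1 // => i _.
case lT: (lo i \in T); case hT: (hi i \in T); rewrite /= ?mulr0 ?mul0r //.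
rewrite IH ?mulr0 // card_sw (@weight_sw i (sw i T)) ?sw_lo ?sw_hi ?lT ?hT // swK.
by rewrite addSnnS.
Qed.

(* A nonzero u of negative weight killed by the raising operator would generate,
   under the lowering operator, an infinite string of nonzero vectors. *)
Lemma raise_inj j r phi :
    (forall T, ~~ ((#|T| == j) && (weight T == r)) -> phi T = 0) ->
    (r.*2 < M * j)%N -> (forall T, raise phi T = 0) ->
  forall T, phi T = 0.
Proof.
move=> phi0 lt_r raise0.
have raise_iter d : exists2 lam : rat, 0 < lam &
    forall T, raise (iter d.+1 lower phi) T = - lam * iter d lower phi T.
  have step d' (T : {set 'I_M.+1}) :
      ((weight T).*2%:R - (M * #|T|)%N%:R) * iter d' lower phi T
    = (r.*2%:R - d'.*2%:R - (M * j)%N%:R) * iter d' lower phi T.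
    case: (boolP ((#|T| == j) && (weight T + d' == r)%N)) => [/andP[/eqP-> /eqP<-]|nT].
      by rewrite doubleD natrD addrK.
    by rewrite (lower_supp phi0 nT) !mulr0.
  elim: d => [|d [lam lam_gt0 IH]].
    exists ((M * j)%N%:R - r.*2%:R); first by rewrite subr_gt0 ltr_nat.
    move=> T; have := raise_lower phi T; rewrite (step 0%N T) /=.
    have -> : lower (raise phi) T = 0.
      by rewrite (eq_lower raise0) /lower big1 // => i _; rewrite mulr0.
    by rewrite subr0 => ->; rewrite double0 subr0 opprB.
  exists (lam + (M * j)%N%:R - r.*2%:R + d.+1.*2%:R).
    rewrite ltr_wpDr ?ler0n // subr_gt0 ltr_wpDl ?ltr_nat //; exact: ltW.
  move=> T; have := raise_lower (iter d.+1 lower phi) T; rewrite step.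
  rewrite (eq_lower IH) lowerZ -iterS => /eqP; rewrite subr_eq => /eqP.
  by rewrite -iterS => ->; ring.
have desc d : (forall T, iter d lower phi T = 0) -> forall T, phi T = 0.
  elim: d => [//|d IH] H; apply: IH => T.
  have [lam lam_gt0 E] := raise_iter d.
  have := E T; rewrite (eq_raise H) /raise big1 => [/esym/eqP|i _]; last by rewrite mulr0.
  by rewrite mulf_eq0 oppr_eq0 gt_eqF // => /eqP.
by apply: (desc r.+1) => T; apply: (lower_supp phi0); apply/negP => /andP[_]; lia.
Qed.

Lemma raise_sum (I : finType) (c : I -> rat) (F : I -> {set 'I_M.+1} -> rat) T :
  raise (fun S => \sum_a c a * F a S) T = \sum_a c a * raise (F a) T.
Proof.
rewrite /raise; under eq_bigr do rewrite big_distrr /=.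
rewrite exchange_big; apply: eq_bigr => a _ /=.
by rewrite big_distrr; apply: eq_bigr => i _ /=; ring.
Qed.

(** By [raise_inj] the matrix of the raising operator between the two weight spaces has independent
    rows, so it has at most as many rows as columns. *)
Lemma card_weight_mono j r : (r.*2 < M * j)%N ->
  (#|[set S : {set 'I_M.+1} | (#|S| == j) && (weight S == r)]|
    <= #|[set S : {set 'I_M.+1} | (#|S| == j) && (weight S == r.+1)]|)%N.
Proof.
move=> lt_r; set A := [set _ | _]; set B := [set _ | _].
pose del (a : 'I_#|A|) S : rat := (S == enum_val a)%:R.
pose Mx : 'M[rat]_(#|A|, #|B|) := \matrix_(a, b) raise (del a) (enum_val b).
suff : row_free Mx by rewrite -row_leq_rank => /leq_trans; apply; apply: rank_leq_col.
apply: inj_row_free => v vM0.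
pose phi S := \sum_a v 0 a * del a S.
have phi0 T : ~~ ((#|T| == j) && (weight T == r)) -> phi T = 0.
  move=> nT; rewrite /phi big1 // => a _; rewrite /del.
  case: eqP => [ET|_]; last by rewrite mulr0.
  by have := enum_valP a; rewrite -ET inE (negPf nT).
have phiR T : raise phi T = 0.
  have [TB|nTB] := boolP (T \in B).
    have := congr1 (fun w : 'rV_ _ => w 0 (enum_rank_in TB T)) vM0.
    rewrite !mxE raise_sum => E; rewrite -[RHS]E; apply: eq_bigr => a _.
    by rewrite !mxE enum_rankK_in.
  rewrite /raise big1 // => i _.
  case hT: (hi i \in T); case lT: (lo i \in T); rewrite ?mul0r //=.
  rewrite phi0 ?mulr0 // card_sw; move: nTB; rewrite inE.
  by rewrite (@weight_sw i T) ?hT ?lT // eqSS.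
have phiz := raise_inj phi0 lt_r phiR.
apply/rowP => a; rewrite mxE -[RHS](phiz (enum_val a)) /phi (bigD1 a) //= big1 => [|b ba].
  by rewrite /del eqxx mulr1 addr0.
by rewrite /del (inj_eq enum_val_inj) eq_sym (negPf ba) mulr0.
Qed.

End SL2.

Lemma weight_rev m (S : {set 'I_m}) :
  (weight (@rev_ord m @: S) + weight S = m.-1 * #|S|)%N.
Proof.
rewrite /weight big_imset /=; last by move=> ? ? _ _; apply: rev_ord_inj.
rewrite -big_split /= -sum1_card big_distrr; apply: eq_bigr => i _ /=.
by have := ltn_ord i; lia.
Qed.

Section Unimodal.
Variables m j : nat.
Hypothesis le_jm : (j <= m)%N.
Let D := (j * (m - j))%N.
Let a r : nat :=
  #|[set S : {set 'I_m} | (#|S| == j) && (weight S == r + 'C(j, 2))%N]|.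

Let bin2_double : ('C(j, 2).*2 = j * j.-1)%N.
Proof. by rewrite bin2 even_halfK // oddM; case: (j) => // i; rewrite /= andNb. Qed.

Let DE : (m.-1 * j = D + 'C(j, 2).*2)%N.
Proof.
rewrite bin2_double /D; case: (j) le_jm => [|i] le_im; first by rewrite muln0.
rewrite -[in LHS](subnKC le_im) addSn [LHS]mulnC mulnDr; exact: addnC.
Qed.

Let a_gt r : (D < r)%N -> a r = 0%N.
Proof.
move=> lt_r; apply/eqP; rewrite cards_eq0; apply/eqP/setP => S; rewrite !inE.
apply/negP => /andP[/eqP cS /eqP wS].
have := weight_rev S; have := weight_ge (@rev_ord m @: S).
rewrite card_imset; last exact: rev_ord_inj.
by rewrite cS DE wS; move: lt_r; generalize D; lia.
Qed.

Let a_sym r : (r <= D)%N -> a r = a (D - r).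
Proof.
move=> le_r; rewrite /a -(card_imset _ (imset_inj (@rev_ord_inj m))).
apply: eq_card => S; apply/imsetP/idP => [[T]|].
  rewrite !inE => /andP[/eqP cT /eqP wT] ->.
  have := weight_rev T; rewrite card_imset; last exact: rev_ord_inj.
  rewrite cT eqxx DE wT /= => E; apply/eqP.
  by apply: (@addIn (r + 'C(j, 2))); apply: etrans E _; move: le_r; generalize D; lia.
rewrite inE => /andP[/eqP cS /eqP wS]; exists (@rev_ord m @: S).
  have := weight_rev S; rewrite inE card_imset; last exact: rev_ord_inj.
  rewrite cS eqxx DE wS /= => E; apply/eqP.
  apply/eqP; rewrite -(eqn_add2r (D - r + 'C(j, 2))); apply/eqP.
  by apply: etrans E _; move: le_r; generalize D; lia.
by rewrite -imset_comp (eq_imset (g := id)) ?imset_id // => i /=; rewrite rev_ordK.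
Qed.

Let a_step r : (r.*2 < D)%N -> (a r <= a r.+1)%N.
Proof.
move=> lt_r; rewrite /a; move: lt_r DE; case: (m) => [|M] lt_r E; first by lia.
by rewrite addSn; apply: card_weight_mono; move: E => /=; lia.
Qed.

Let a_mono x y : (x <= y)%N -> (y.*2 <= D.+1)%N -> (a x <= a y)%N.
Proof.
elim: y => [|y IH]; first by rewrite leqn0 => /eqP->.
rewrite leq_eqVlt => /orP[/eqP-> //|le_xy] le_y.
by apply: leq_trans (a_step _); [apply: IH; lia|lia].
Qed.

(** The condition on [x + y] admits pairs on both sides of the middle; for these, symmetry replaces
    [y] by [D - y], which is still at least [x]. *)
Lemma qbin_up x y : (x <= y)%N -> (x + y <= j * (m - j))%N ->
  (qbin pX m j)`_x <= (qbin pX m j)`_y.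
Proof.
rewrite -/D !coef_qbin ler_nat -/(a x) -/(a y) => le_xy le_D.
have [le_y|lt_y] := leqP y.*2 D.+1; first exact: a_mono.
by rewrite (@a_sym y); [apply: a_mono|]; lia.
Qed.

Lemma qbin_down x y : (x <= y)%N -> (j * (m - j) <= x + y)%N ->
  (qbin pX m j)`_y <= (qbin pX m j)`_x.
Proof.
rewrite -/D => le_xy le_D; have [le_yD|lt_Dy] := leqP y D.
  have E z : (z <= D)%N -> (qbin pX m j)`_z = (qbin pX m j)`_(D - z).
    by move=> le_z; rewrite !coef_qbin -/(a z) a_sym.
  by rewrite (E x) ?(E y) //; [apply: qbin_up; rewrite -/D|]; lia.
by rewrite !coef_qbin -/(a y) a_gt // ler0n.
Qed.

Lemma qbin_nat i : (qbin pX m j)`_i \is a Num.nat.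
Proof. by rewrite coef_qbin natr_nat. Qed.

End Unimodal.

(** * The polynomial and its values at roots of unity *)

Lemma forest_poly n k : (1 <= n)%N -> (1 <= k)%N -> (k <= n)%N ->
  exists f : {poly rat},
    [/\ f * qint (2 * n - k) = qbin pX n (k - 1) * qbin pX (3 * n - 2 * k - 1) (n - k),
        f * qint (3 * n - 2 * k) = qbin pX n (k - 1) * qbin pX (3 * n - 2 * k) (n - k)
      & forall i : nat, f`_i \is a Num.nat].
Proof.
move=> hn hk hkn; set m := (3 * n - 2 * k)%N; set j := (n - k)%N.
have m_gt0 : (0 < m)%N by rewrite /m; lia.
have [A EA] := qbin_gcd_quotient j m_gt0; set d := gcdn m j in EA.
(* Since [3n-2k = 2(n-k) + n]. So [d] divides both [n] and [k], hence is prime to [k-1]; this makes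
   [bin(n, k-1)] divisible by [[d]]. *)
have dE : d = gcdn n k.
  have E1 : m = (2 * j + n)%N by rewrite /m /j; lia.
  have E2 : n = (j + k)%N by rewrite /j; lia.
  by rewrite /d E1 gcdnC gcdnMDl E2 gcdnDl [RHS]gcdnC gcdnDr gcdnC.
have d_gt0 : (0 < d)%N by rewrite dE gcdn_gt0 hn.
have [] := @qbin_coprime_quotient n (k - 1) d.
- by rewrite dE dvdn_gcdl.
- have dk : (d %| k)%N by rewrite dE dvdn_gcdr.
  rewrite /coprime -dvdn1; have := dvdn_gcdl d (k - 1); have := dvdn_gcdr d (k - 1).
  move=> g1 g2; rewrite -(dvdn_addr _ g1) subnK //; exact: dvdn_trans dk.
move=> B EB.
have Efm : A * B * qint m = qbin pX n (k - 1) * qbin pX m j.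
  by rewrite -EB mulrAC EA; ring.
exists (A * B); split=> //.
  apply: (@mulIf _ (qint m)); first by case: (m) m_gt0 => // ? _; apply: qint_neq0.
  rewrite mulrAC Efm -[RHS]mulrA [_ * qint m]mulrC.
  have -> : (m - 1)%N = m.-1 by rewrite subn1.
  have := @qbin_absorb_compl m.-1 j; rewrite prednK // => <-; last by rewrite /m /j; lia.
  by have -> : (m - j = 2 * n - k)%N; [rewrite /m /j; lia | ring].
have Anat i : A`_i \is a Num.nat.
  apply: (@unimodal_quotient_nat (qbin pX m j) A (j * (m - j)) m d) => //.
  - by rewrite dvdn_leq // dvdn_gcdl.
  - exact: qbin_nat.
  - by apply: qbin_up; rewrite /m /j; lia.
  - by apply: qbin_down; rewrite /m /j; lia.
  - by rewrite -!qnum_geom -!qintE !mulrA EA; ring.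
have Bnat i : B`_i \is a Num.nat.
  apply: (@unimodal_quotient_nat (qbin pX n (k - 1)) B ((k - 1) * (n - (k - 1))) d 1) => //.
  - exact: qbin_nat.
  - by apply: qbin_up; lia.
  - by apply: qbin_down; lia.
  - by rewrite -EB -qnum_geom -qintE expr1; ring.
by move=> i; rewrite coefM rpred_sum // => l _; rewrite rpredM.
Qed.

Section ForestPolyEval.
Variables (n k e : nat) (w : algC) (f : {poly rat}).
Hypotheses (hn : (1 <= n)%N) (hk : (1 <= k)%N) (hkn : (k <= n)%N).
Hypothesis f1 :
  f * qint (2 * n - k) = qbin pX n (k - 1) * qbin pX (3 * n - 2 * k - 1) (n - k).
Hypothesis f2 :
  f * qint (3 * n - 2 * k) = qbin pX n (k - 1) * qbin pX (3 * n - 2 * k) (n - k).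
Hypothesis prim_w : e.-primitive_root w.
Hypothesis dvd_en : (e %| n)%N.

Let fw := (map_poly ratr f).[w].

Let f1w : fw * qnum w (2 * n - k) =
  qbin w n (k - 1) * qbin w (3 * n - 2 * k - 1) (n - k).
Proof.
have := congr1 (fun p => (map_poly ratr p).[w]) f1.
by rewrite !rmorphM !hornerM eval_qint !eval_qbin.
Qed.

Let qbin_ndvd a b : (e %| a)%N -> ~~ (e %| b)%N -> qbin w a b = 0.
Proof.
move=> ea eb; rewrite (qLucas prim_w) qbin_small ?mulr0 //.
by rewrite (eqP ea) lt0n.
Qed.

Let qbin_dvd a b : (e %| a)%N -> (e %| b)%N -> qbin w a b = 'C(a %/ e, b %/ e)%:R.
Proof. by move=> /eqP ea /eqP eb; rewrite (qLucas prim_w) ea eb mulr1. Qed.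

Lemma forest_poly_eval1 : e = 1%N ->
  fw * (2 * n - k)%N%:R = 'C(n, k - 1)%:R * 'C(3 * n - 2 * k - 1, n - k)%:R.
Proof.
move=> e1; have w1 : w = 1.
  by have := prim_expr_order prim_w; rewrite e1 expr1.
have := f1w; rewrite (qLucas prim_w n) (qLucas prim_w (3 * n - _ - _)).
rewrite e1 !modn1 !divn1 !mulr1 => <-.
congr (_ * _); rewrite w1 /qnum (eq_bigr (fun=> 1)) => [|i _]; last by rewrite expr1n.
by rewrite sumr_const card_ord.
Qed.

(** Trading [bin(n, k-1)] for [bin(n, k)] brings in [[k]] on one side and [[n-k+1]], whose value at
    [w] is 1, on the other. Then [[e]] is a common factor of [[3n-2k]] and [[k]]. *)
Lemma forest_poly_eval_dvd : (1 < e)%N -> (e %| k)%N ->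
  fw * ((3 * n - 2 * k) %/ e)%N%:R
    = (k %/ e)%N%:R * 'C(n %/ e, k %/ e)%:R * 'C((3 * n - 2 * k) %/ e, (n - k) %/ e)%:R.
Proof.
move=> e1 ek; set m := (3 * n - 2 * k)%N.
have em : (e %| m)%N by rewrite dvdn_sub // dvdn_mull.
have ej : (e %| n - k)%N by rewrite dvdn_sub.
have f3 : f * qint m * qint (n - k + 1) = qint k * qbin pX n k * qbin pX m (n - k).
  rewrite f2 mulrAC; congr (_ * _); rewrite mulrC.
  case: (n) (k) hn hk hkn => [//|n'] [//|k'] _ _ lt_k.
  rewrite subn1 /= -qbin_step //; congr (qint _ * _); lia.
have e_neq0 : qint e != 0 by case: (e) e1 => // ? _; apply: qint_neq0.
have qE a : (e %| a)%N -> qint a = qint e * qnum 'X^e (a %/ e).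
  by move=> ea; rewrite !qintE -qnumM mulnC divnK.
move: f3; rewrite (qE m) // (qE k) // mulrCA -!mulrA => /(mulfI e_neq0).
move/(congr1 (fun p => (map_poly ratr p).[w])).
rewrite !rmorphM !hornerM eval_qint !eval_qbin.
have qe a : (map_poly ratr (qnum 'X^e a : {poly rat})).[w] = a%:R.
  rewrite (rmorph_qnum (map_poly ratr)) -/(horner_eval w _).
  rewrite (rmorph_qnum (horner_eval w)) /= /horner_eval map_polyXn hornerXn.
  rewrite (prim_expr_order prim_w) /qnum (eq_bigr (fun=> 1)) => [|i _]; last by rewrite expr1n.
  by rewrite sumr_const card_ord.
rewrite !qe !qbin_dvd // (@qnum_prim_eq w e prim_w _ 1) // ?qnum1 ?mulr1 ?mulrA //.
by rewrite -modnDml (eqP ej).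
Qed.

(** The second condition makes [bin(n, k-1)] vanish at [w], the first keeps [[2n-k]] nonzero. *)
Lemma forest_poly_eval_ndvd : ~~ (e %| k)%N -> ~~ (e %| k - 1)%N -> fw = 0.
Proof.
move=> ek ek1; have := f1w; rewrite (@qbin_ndvd n (k - 1)) // mul0r => /eqP.
rewrite mulf_eq0 => /orP[/eqP //|].
rewrite (negPf (qnum_prim_neq0 prim_w _)) //.
by rewrite dvdn_subr ?dvdn_mull //; lia.
Qed.

(** Modulo [e] the second Gaussian coefficient has top [-3] and bottom [-1]. As [e > 2], the residue
    [e-3] is below [e-1], and q-Lucas gives 0. *)
Lemma forest_poly_eval_pred : (2 < e)%N -> (e %| k - 1)%N -> fw = 0.
Proof.
move=> e2 ek1; have := f1w.
have -> : qbin w (3 * n - 2 * k - 1) (n - k) = 0.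
  case/dvdnP: dvd_en => N EN; case/dvdnP: ek1 => K EK.
  have lt_KN : (K < N)%N by rewrite -(@ltn_pmul2r e); lia.
  have [t Et] : exists t, N = (K + t.+1)%N by exists (N - K.+1)%N; lia.
  move: EN; rewrite Et mulnDl mulSn => EN.
  rewrite (qLucas prim_w) qbin_small ?mulr0 //.
  have -> : (n - k = t * e + (e - 1))%N by lia.
  have -> : (3 * n - 2 * k - 1 = (K + 3 * t + 2) * e + (e - 3))%N.
    by rewrite !mulnDl; lia.
  by rewrite !modnMDl !modn_small; lia.
rewrite mulr0 => /eqP; rewrite mulf_eq0 => /orP[/eqP //|].
rewrite (negPf (qnum_prim_neq0 prim_w _)) //.
rewrite dvdn_subr ?dvdn_mull //; last by lia.
have -> : k = (k - 1 + 1)%N by lia.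
by rewrite dvdn_addr // dvdn1; lia.
Qed.

Lemma forest_poly_eval2 : e = 2%N -> odd k ->
  fw = 'C(n %/ 2, (k - 1) %/ 2)%:R * 'C((3 * n - 2 * k - 2) %/ 2, (n - k - 1) %/ 2)%:R.
Proof.
move=> e2 ok; have := f1w; rewrite (@qnum_prim_eq w e prim_w _ 1) ?e2 //; last by lia.
rewrite qnum1 mulr1 => ->; rewrite qbin_dvd //; last by rewrite e2; lia.
rewrite (qLucas prim_w (3 * n - _ - _)) e2; congr (_ * _).
have n2 : (2 %| n)%N by rewrite -e2.
have -> : ((3 * n - 2 * k - 1) %% 2 = 1)%N by lia.
have -> : ((n - k) %% 2 = 1)%N by lia.
rewrite qbinn mulr1; congr ('C(_, _)%:R); lia.
Qed.

End ForestPolyEval.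

(** * Coefficients of the powers of C *)

(* The coefficient of t^m z^M in C^s, where C = 1/(1 - T) and
   T = t * sum_(i >= 1) z^i C^(i+1). *)
Definition hcoef (s m M : nat) : rat :=
  match m, M with
  | 0, 0 => 1
  | m'.+1, M'.+1 => s%:R / m'.+1%:R * 'C(M', m')%:R * 'C(M' + s + m'.*2 + 2, m')%:R
  | _, _ => 0
  end.

Lemma sum_bin_hockey M m : (\sum_(i < M) 'C(i, m) = 'C(M, m.+1))%N.
Proof. by elim: M => [|M IH]; rewrite ?big_ord0 // big_ord_recr /= IH binS addnC. Qed.

Lemma sum_bin_hockey_rev M m : (\sum_(i < M) 'C(M - i.+1, m) = 'C(M, m.+1))%N.
Proof.
rewrite -(sum_bin_hockey M m) (reindex_inj rev_ord_inj); apply: eq_bigr => i _ /=.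
by congr 'C(_, _); have := ltn_ord i; lia.
Qed.

Lemma sum_bin_weighted M m : (\sum_(i < M) i.+1 * 'C(M - i.+1, m) = 'C(M.+1, m.+2))%N.
Proof.
elim: M => [|M IH]; first by rewrite big_ord0 bin_small.
rewrite big_ord_recl /= mul1n subSS subn0.
under eq_bigr do rewrite /bump /= add1n subSS mulSn.
by rewrite big_split /= IH sum_bin_hockey_rev [RHS]binS [X in _ = (_ + X)%N]binS; lia.
Qed.

(** The coefficient form of [C^(s+1) = C^s + T C^(s+1)]; the summand [i] comes from the term
    [t z^(i+1) C^(s+3+i)] of [T C^(s+1)]. *)
Lemma hcoef_rec s m M :
  hcoef s.+1 m.+1 M = hcoef s m.+1 M + \sum_(i < M) hcoef (s + 3 + i) m (M - i.+1).
Proof.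
case: M => [|M]; first by rewrite big_ord0.
case: m => [|m].
  rewrite big_ord_recr /= big1 => [|i _]; last first.
    by have lt_i := ltn_ord i; rewrite subSS; case E: (M - i)%N => //; exfalso; lia.
  by rewrite subnn !bin0 -natr1 !mulr1n !divr1 add0r.
rewrite big_ord_recr /= subnn addr0.
set Q := (M + s + m.*2 + 4)%N.
(* The second binomial does not depend on [i]; writing [s+3+i] as [(s+2) + (i+1)] leaves a plain and
   a weighted hockey-stick sum. *)
rewrite (eq_bigr (fun i : 'I_M => (s.+2%:R * 'C(M - i.+1, m)%:R
    + (i.+1 * 'C(M - i.+1, m))%N%:R) * ('C(Q, m)%:R / m.+1%:R))); last first.
  move=> i _; have lt_i := ltn_ord i.
  have -> : (M.+1 - i.+1 = (M - i.+1).+1)%N by lia.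
  have -> : (M - i.+1 + (s + 3 + i) + m.*2 + 2 = Q)%N by rewrite /Q; lia.
  have -> : (s + 3 + i)%N%:R = (s.+2%:R + i.+1%:R) :> rat by rewrite -natrD; congr _%:R; lia.
  by rewrite natrM; ring.
rewrite -big_distrl big_split -big_distrr /= -!natr_sum sum_bin_hockey_rev sum_bin_weighted.
have -> : (M + s.+1 + m.+1.*2 + 2 = Q.+1)%N by rewrite /Q; lia.
have -> : (M + s + m.+1.*2 + 2 = Q)%N by rewrite /Q; lia.
have nz a : a.+1%:R != 0 :> rat by rewrite pnatr_eq0.
have E1 : 'C(M.+1, m.+2)%:R = 'C(M, m.+1)%:R * M.+1%:R / m.+2%:R :> rat.
  apply: (mulIf (nz m.+1)); rewrite divfK // -!natrM mulnC.
  by rewrite -mul_bin_diag mulnC.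
have le_mQ : (m <= Q)%N by rewrite /Q; lia.
have E2 : 'C(Q, m.+1)%:R = 'C(Q, m)%:R * (Q - m)%N%:R / m.+1%:R :> rat.
  apply: (mulIf (nz m)); rewrite divfK // -!natrM mulnC.
  by rewrite mul_bin_left mulnC.
have E3 : 'C(Q.+1, m.+1)%:R = 'C(Q, m)%:R * Q.+1%:R / m.+1%:R :> rat.
  apply: (mulIf (nz m)); rewrite divfK // -!natrM mulnC.
  by rewrite -mul_bin_diag mulnC.
rewrite E1 E2 E3 natrB // /Q !natrD -!mul2n !natrM -!natr1.
have := nz m; have := nz m.+1; rewrite -!natr1 => n1 n2.
by field; rewrite n2 addrAC n1.
Qed.

Lemma hcoef_gt s m M : (M < m)%N -> hcoef s m M = 0.
Proof.
by case: m M => [|m] [|M] //= lt_Mm; rewrite bin_small // mulr0 mul0r.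
Qed.

Definition Hpoly s M : {poly rat} := \poly_(m < M.+1) hcoef s m M.

Lemma coef_Hpoly s M m : (Hpoly s M)`_m = hcoef s m M.
Proof. by rewrite coef_poly; case: ltnP => // lt_Mm; rewrite hcoef_gt. Qed.

Lemma Hpoly0 M : Hpoly 0 M = (M == 0)%:R.
Proof.
apply/polyP => m; rewrite coef_Hpoly; case: M => [|M].
  by rewrite coef1; case: m.
by rewrite coef0; case: m => [|m] //=; rewrite !mul0r.
Qed.

Lemma Hpoly_rec s M :
  Hpoly s.+1 M = Hpoly s M + 'X * \sum_(i < M) Hpoly (s + 3 + i) (M - i.+1).
Proof.
apply/polyP => -[|m]; rewrite coefD coefXM /= !coef_Hpoly.
  by rewrite addr0; case: M.
rewrite hcoef_rec coef_sum; congr (_ + _).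
by apply: eq_bigr => i _; rewrite coef_Hpoly.
Qed.

Lemma sum_triangle (V : nmodType) M (G : nat -> nat -> V) :
  \sum_(a < M.+1) \sum_(i < a) G i (a - i.+1)%N
    = \sum_(i < M) \sum_(b < (M - i.+1).+1) G i b.
Proof.
elim: M => [|M IH]; first by rewrite big_ord1 !big_ord0.
rewrite big_ord_recr /= {}IH -[LHS]/(_ + _) [X in _ + X]big_ord_recr [RHS]big_ord_recr /=.
rewrite subnn big_ord1 addrA -big_split; congr (_ + _); apply: eq_bigr => i _ /=.
have -> : (M.+1 - i.+1 = (M - i.+1).+1)%N by have := ltn_ord i; lia.
by rewrite [RHS]big_ord_recr.
Qed.

(** This is [C^s1 C^s2 = C^(s1+s2)]. The recurrence either lowers [s1] at the same [M] or raises the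
    exponent at a smaller [M], hence the nested inductions. *)
Lemma Hpoly_conv s1 s2 M :
  \sum_(a < M.+1) Hpoly s1 a * Hpoly s2 (M - a) = Hpoly (s1 + s2) M.
Proof.
elim/ltn_ind: M s1 => M IHM; elim=> [|s1 IHs].
  rewrite big_ord_recl Hpoly0 mul1r subn0 big1 ?addr0 // => i _.
  by rewrite Hpoly0 mul0r.
under eq_bigr => a _ do rewrite Hpoly_rec mulrDl -mulrA big_distrl /=.
rewrite big_split /= IHs -big_distrr /= addSn Hpoly_rec; congr (_ + 'X * _).
pose G i b := Hpoly (s1 + 3 + i) b * Hpoly s2 (M - i.+1 - b).
rewrite (eq_bigr (fun a : 'I_M.+1 => \sum_(i < a) G i (a - i.+1)%N)); last first.
  move=> a _; apply: eq_bigr => i _; congr (_ * Hpoly _ _).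
  by have := ltn_ord i; lia.
rewrite sum_triangle; apply: eq_bigr => i _.
rewrite /G IHM; last by have := ltn_ord i; lia.
by congr Hpoly; lia.
Qed.

(** As [(n-j-1) + (j+1) = n], the last binomial of [hcoef] is constant, and its factor [j+1] gives
    the weighted hockey-stick sum. *)
Lemma sum_hcoef_total n m : (0 < m)%N ->
  m%:R * (\sum_(j < n) hcoef j.+1 m (n - j.+1))
    = 'C(n, m.+1)%:R * 'C(n + m.*2 - 1, m.-1)%:R.
Proof.
case: m n => // m [|n] _; first by rewrite big_ord0 bin_small // mulr0 mul0r.
have nz : m.+1%:R != 0 :> rat by rewrite pnatr_eq0.
rewrite big_ord_recr /= subnn addr0 -sum_bin_weighted natr_sum big_distrr big_distrl /=.
apply: eq_bigr => j _; have lt_j := ltn_ord j.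
have -> : (n.+1 - j.+1 = (n - j.+1).+1)%N by lia.
rewrite /hcoef.
have -> : (n - j.+1 + j.+1 + m.*2 + 2 = n.+1 + m.+1.*2 - 1)%N by lia.
by rewrite natrM; move: (m.+1%:R : rat) nz => u nz; field.
Qed.

(** The weight [N/(j+1)], which comes from double counting central arcs, cancels the factor [j+1] of
    [hcoef]; a plain hockey-stick sum remains. *)
Lemma sum_hcoef_cyclic N m : (0 < m)%N ->
  m%:R * (\sum_(j < N) N%:R / j.+1%:R * hcoef j.+1 m (N - j.+1))
    = N%:R * 'C(N.-1, m)%:R * 'C(N + m.*2 - 1, m.-1)%:R.
Proof.
case: m N => // m [|N] _; first by rewrite big_ord0 mulr0 !mul0r.
have nz a : a.+1%:R != 0 :> rat by rewrite pnatr_eq0.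
rewrite big_ord_recr /= subnn mulr0 addr0 -sum_bin_hockey_rev natr_sum.
rewrite !big_distrr big_distrl /=; apply: eq_bigr => j _; have lt_j := ltn_ord j.
have -> : (N.+1 - j.+1 = (N - j.+1).+1)%N by lia.
rewrite /hcoef.
have -> : (N - j.+1 + j.+1 + m.*2 + 2 = N.+1 + m.+1.*2 - 1)%N by lia.
move: (m.+1%:R : rat) (nz m) (j.+1%:R : rat) (nz j) => u nu v nv; field.
by rewrite nu nv.
Qed.

(** For positive [N] and [m] this is the sum of [sum_hcoef_total] on [N+1] points without its term
    [j = 0]. *)
Lemma sum_hcoef_diameter N m :
  N%:R * (\sum_(j < N) hcoef j.+2 m (N - j.+1)) = 'C(N, m.+1)%:R * 'C(N + m.*2, m)%:R.
Proof.
case: N => [|N]; first by rewrite big_ord0 mulr0 bin_small // mul0r.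
case: m => [|m].
  rewrite big_ord_recr /= big1 => [|i _]; last first.
    by have lt_i := ltn_ord i; rewrite subSS; case E: (N - i)%N => //; exfalso; lia.
  by rewrite subnn bin0 bin1 add0r.
have nz a : a.+1%:R != 0 :> rat by rewrite pnatr_eq0.
have := @sum_hcoef_total N.+2 m.+1 isT.
have -> : (N.+2 + m.+1.*2 - 1 = N.+1 + m.+1.*2)%N by lia.
set Q := (N.+1 + m.+1.*2)%N; rewrite big_ord_recl /=.
have -> : \sum_(i < N.+1) hcoef (bump 0 i).+1 m.+1 (N.+1 - bump 0 i)
  = \sum_(j < N.+1) hcoef j.+2 m.+1 (N.+1 - j.+1) by [].
set S := \sum_(j < N.+1) _; rewrite mulrDr.
have -> : (N + 1 + m.*2 + 2 = Q)%N by rewrite /Q; lia.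
have E2 : 'C(Q, m.+1)%:R = 'C(Q, m)%:R * (N + m.+3)%N%:R / m.+1%:R :> rat.
  apply: (mulIf (nz m)); rewrite divfK // -!natrM mulnC mul_bin_left mulnC.
  by congr (_ * _)%:R; rewrite /Q; lia.
rewrite E2 => E.
have -> : S = ('C(N.+2, m.+2)%:R - 'C(N, m)%:R) * 'C(Q, m)%:R / m.+1%:R.
  apply: (mulfI (nz m)); rewrite [RHS]mulrC divfK // mulrBl -E.
  by move: (m.+1%:R : rat) (nz m) => u nu; field.
have E3 : N.+1%:R * 'C(N, m)%:R = m.+1%:R * 'C(N.+1, m.+1)%:R :> rat.
  by rewrite -!natrM mul_bin_diag.
have E4 : m.+2%:R * 'C(N.+1, m.+2)%:R = (N.+1%:R - m.+1%:R) * 'C(N.+1, m.+1)%:R :> rat.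
  have [le|lt] := leqP m.+1 N.+1; first by rewrite -natrB // -!natrM mul_bin_left.
  by rewrite !bin_small ?mulr0 //; lia.
have E5 : 'C(N.+2, m.+2)%:R = 'C(N.+1, m.+2)%:R + 'C(N.+1, m.+1)%:R :> rat.
  by rewrite -natrD -binS.
have -> : (N + m.+3)%N%:R = N.+1%:R + m.+2%:R :> rat by rewrite -natrD; congr _%:R; lia.
move: E3 E4; rewrite E5 -[m.+2%:R]natr1.
move: (m.+1%:R : rat) (nz m) => u nu; move: (N.+1%:R : rat) ('C(N, m)%:R : rat) => v c.
move: ('C(N.+1, m.+1)%:R : rat) ('C(N.+1, m.+2)%:R : rat) ('C(Q, m)%:R : rat) => a b q E3 E4.
apply: (mulfI nu).
have -> : u * (v * ((b + a - c) * q / u)) = (v * b + v * a - v * c) * q by field.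
have -> : u * (b * (q * (v + (u + 1)) / u)) = (v * b + (u + 1) * b) * q by field.
by rewrite E3 E4; ring.
Qed.

(** * Counting linear forests *)

Lemma big_option (V : nmodType) (T : finType) (F : option T -> V) :
  \sum_o F o = F None + \sum_x F (Some x).
Proof.
rewrite (bigD1 None) //= (reindex_omap Some id) => [|[]] //=.
by congr (_ + _); apply: eq_bigl => x; rewrite eqxx.
Qed.

Section Linear.
Variable n : nat.
Implicit Types (E F : {set 'I_n * 'I_n}) (p q : 'I_n * 'I_n) (l r j b : nat).

(* Unlike with setP, the bound p is literally of type 'I_n * 'I_n. *)
Lemma eq_pairs E F : (forall p : 'I_n * 'I_n, (p \in E) = (p \in F)) -> E = F.
Proof. by move=> EF; apply/setP. Qed.

Definition covered E (i : nat) : bool := [exists p in E, p.1 <= i < p.2]%N.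

Definition pairs_in l r E : bool :=
  [forall p in E, [&& l <= p.1, p.1 < p.2 & p.2 <= r]%N].

Definition pairs_nc E : bool :=
  [forall p in E, forall q in E, ~~ [&& p.1 < q.1, q.1 < p.2 & p.2 < q.2]%N].

(* Arc i joins the points i and i+1. It borders the region just below the chord p
   iff no other chord inside p covers it. *)
Definition pairs_good E : bool :=
  [forall p in E, exists i : 'I_n, (p.1 <= i < p.2)%N &&
    [forall q in E, [&& q.1 <= i < q.2, p.1 <= q.1 & q.2 <= p.2]%N ==> (q == p)]].

Definition lin l r E : bool := [&& pairs_in l r E, pairs_nc E & pairs_good E].

Definition nfree l r E : nat := \sum_(l <= i < r) ~~ covered E i.

Definition linear_forest l r E : Prop :=
  [/\ forall p, p \in E -> [/\ l <= p.1, p.1 < p.2 & p.2 <= r]%N,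
      forall p q, p \in E -> q \in E -> (p.1 < q.1)%N -> (q.1 < p.2)%N ->
        (p.2 < q.2)%N -> False
    & forall p, p \in E -> exists i : nat, [/\ (p.1 <= i)%N, (i < p.2)%N &
        forall q, q \in E -> (q.1 <= i)%N -> (i < q.2)%N -> (p.1 <= q.1)%N ->
          (q.2 <= p.2)%N -> q = p]].

Lemma linP l r E : reflect (linear_forest l r E) (lin l r E).
Proof.
apply: (iffP and3P) => -[h1 h2 h3]; split.
- by move=> p pE; move/forall_inP: h1 => /(_ p pE) /and3P.
- move=> p q pE qE a1 a2 a3; move/forall_inP: h2 => /(_ p pE) /forall_inP /(_ q qE).
  by rewrite a1 a2 a3.
- move=> p pE; move/forall_inP: h3 => /(_ p pE) /existsP[i /andP[/andP[i1 i2] /forall_inP hi]].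
  exists i; split=> // q qE b1 b2 b3 b4; apply/eqP.
  by have := hi q qE; rewrite b1 b2 b3 b4.
- by apply/forall_inP => p pE; apply/and3P; apply: h1.
- apply/forall_inP => p pE; apply/forall_inP => q qE; apply/negP => /and3P[].
  exact: h2.
- apply/forall_inP => p pE; have [i [i1 i2 hi]] := h3 p pE.
  apply/existsP; exists (Ordinal (ltn_trans i2 (ltn_ord p.2))); rewrite /= i1 i2 /=.
  apply/forall_inP => q qE; apply/implyP => /and3P[/andP[b1 b2] b3 b4].
  by rewrite (hi q).
Qed.

Lemma coveredP E (i : nat) :
  reflect (exists2 p : 'I_n * 'I_n, p \in E & (p.1 <= i < p.2)%N) (covered E i).
Proof. by apply: (iffP exists_inP). Qed.

Lemma linear_forest_sub l r l' r' E F :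
    linear_forest l r E -> F \subset E ->
    (forall p, p \in F -> (l' <= p.1)%N /\ (p.2 <= r')%N) ->
  linear_forest l' r' F.
Proof.
move=> [h1 h2 h3] /subsetP FE inF; split.
- by move=> p pF; have [? ?] := inF p pF; have [_ ? _] := h1 p (FE p pF); split.
- by move=> p q /FE pE /FE qE; apply: h2.
- move=> p pF; have [i [i1 i2 hi]] := h3 p (FE p pF).
  by exists i; split=> // q /FE; apply: hi.
Qed.

Lemma nfree_cat l b r E : (l <= b)%N -> (b <= r)%N ->
  nfree l r E = (nfree l b E + nfree b r E)%N.
Proof. by move=> lb br; rewrite /nfree (big_cat_nat lb br). Qed.

Lemma nfree_le l r E : (nfree l r E <= r - l)%N.
Proof.
rewrite /nfree; apply: leq_trans (_ : \sum_(l <= i < r) 1 <= _)%N.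
  by apply: leq_sum => i _; case: covered.
by rewrite sum_nat_const_nat muln1.
Qed.

Lemma eq_nfree l r E F :
  (forall i, (l <= i < r)%N -> covered E i = covered F i) -> nfree l r E = nfree l r F.
Proof. by move=> h; apply: eq_big_nat => i /h ->. Qed.

Lemma nfree_gt0P l r E :
  reflect (exists2 i, (l <= i < r)%N & ~~ covered E i) (0 < nfree l r E)%N.
Proof.
apply: (iffP idP) => [|[i /andP[li ir] ni]].
  rewrite /nfree lt0n sum_nat_seq_neq0 => /hasP[i].
  by rewrite mem_index_iota => lir /=; rewrite eqb0 negbK => ni; exists i.
rewrite (@nfree_cat l i r) ?(ltnW ir) // (@nfree_cat i i.+1 r) //.
by rewrite [nfree i i.+1 _]/nfree big_nat1 ni addnCA.
Qed.

Definition linW j l r : {poly rat} :=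
  \sum_(E | lin l r E && (nfree l r E == j)) 'X^#|E|.

(** These are the forests that may sit below a chord from [l] to [r]: the region just below that
    chord must keep an arc. *)
Definition linV l r : {poly rat} :=
  \sum_(E | lin l r E && (0 < nfree l r E)%N) 'X^#|E|.

(** * Cutting a linear forest along the longest chord from its left end *)

Section Join.
Variables (l r : nat) (lo b : 'I_n).
Hypotheses (lo_l : lo = l :> nat) (lt_lb : (l < b)%N) (le_br : (b <= r)%N).

(** Cutting at this chord leaves a forest on [[l, b]] and one on [[b, r]], which share the point [b]
    but no arc. *)
Definition top_at E : bool :=
  ((lo, b) \in E) && [forall p in E, (p.1 == lo) ==> (p.2 <= b)%N].

Definition join2 (FF : {set 'I_n * 'I_n} * {set 'I_n * 'I_n}) :=
  (lo, b) |: (FF.1 :|: FF.2).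

Definition split2 E :=
  ([set p : 'I_n * 'I_n in E | (p != (lo, b)) && (p.2 <= b)%N],
   [set p : 'I_n * 'I_n in E | (b <= p.1)%N]).

Lemma join2K E : linear_forest l r E -> top_at E -> join2 (split2 E) = E.
Proof.
move=> [h1 h2 h3] /andP[lbE /forall_inP topE]; apply: eq_pairs => p; rewrite !inE.
have [->|np] /= := eqVneq p (lo, b); first by rewrite lbE.
case pE: (p \in E) => //=; have [a1 a2 a3] := h1 p pE.
case: (leqP p.2 b) => //= lt_b; rewrite leqNgt; apply/negP => lt_p.
have := topE p pE; case: eqP => [_|ne] /=; first by rewrite leqNgt lt_b.
move=> _; apply: (h2 (lo, b) p) => //=.
have : p.1 <> l :> nat by move=> E1; apply: ne; apply: val_inj; rewrite /= E1 lo_l.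
by rewrite lo_l; lia.
Qed.

Lemma split2_linear E : linear_forest l r E -> top_at E ->
  [/\ linear_forest l b (split2 E).1, (0 < nfree l b (split2 E).1)%N,
      linear_forest b r (split2 E).2 & nfree b r (split2 E).2 = nfree l r E].
Proof.
move=> lE /andP[lbE /forall_inP topE]; have [h1 h2 h3] := lE; split.
- apply: (linear_forest_sub lE) => [|p].
    by apply/subsetP => p; rewrite inE => /andP[].
  by rewrite inE => /and3P[/h1[? ? ?] _ ?].
- have [i [/= i1 i2 hi]] := h3 _ lbE; apply/nfree_gt0P; exists i; first by lia.
  apply/negP => /coveredP[p]; rewrite inE => /and3P[pE np pb] /andP[p1 p2].
  have [a1 _ _] := h1 p pE.
  by move: np; rewrite (hi p) ?eqxx //= lo_l.
- apply: (linear_forest_sub lE) => [|p].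
    by apply/subsetP => p; rewrite inE => /andP[].
  by rewrite inE => /andP[/h1[? ? ?] ?].
(* The chord from [l] to [b] covers every arc of [[l, b]], so the exposed arcs all lie in
   [[b, r]]. *)
- rewrite (@nfree_cat l b r) ?(ltnW lt_lb) //.
  have -> : nfree l b E = 0%N.
    rewrite /nfree big_nat big1 // => i /andP[li ib].
    by have /coveredP-> // : exists2 p, p \in E & (p.1 <= i < p.2)%N; exists (lo, b) => //=; lia.
  apply: eq_nfree => i /andP[bi ir]; apply/coveredP/coveredP => -[p].
    by rewrite inE => /andP[pE _] ?; exists p.
  move=> pE /andP[p1 p2]; exists p; last by rewrite p1.
  have : p \in join2 (split2 E) by rewrite join2K // /top_at lbE; apply/forall_inP.
  rewrite !inE pE /=; case/orP => [/eqP Ep|/orP[/andP[_ pb]|//]].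
    by move: p2; rewrite Ep /=; lia.
  by have := leq_trans p2 (leq_trans pb bi); rewrite ltnn.
Qed.

Lemma join2_linear F1 F2 :
    linear_forest l b F1 -> (0 < nfree l b F1)%N -> linear_forest b r F2 ->
  [/\ linear_forest l r (join2 (F1, F2)), top_at (join2 (F1, F2)),
      nfree l r (join2 (F1, F2)) = nfree b r F2,
      split2 (join2 (F1, F2)) = (F1, F2)
    & #|join2 (F1, F2)| = (#|F1| + #|F2|).+1].
Proof.
move=> [h1 h2 h3] /nfree_gt0P[u /andP[u1 u2] uN] [k1 k2 k3].
have in1 p : p \in F1 -> (p.1 <= u < p.2)%N = false.
  by move=> pF; apply/negP => pu; case/negP: uN; apply/coveredP; exists p.
have nlb : (lo, b) \notin F1.
  by apply/negP => /in1; rewrite /= lo_l u1 u2.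
have inJ p : p \in join2 (F1, F2) -> [\/ p = (lo, b), p \in F1 | p \in F2].
  rewrite !inE => /orP[/eqP->|/orP[]]; by [constructor 1|constructor 2|constructor 3].
have J0 : (lo, b) \in join2 (F1, F2) by rewrite !inE eqxx.
have J1 p : p \in F1 -> p \in join2 (F1, F2) by rewrite !inE => ->; rewrite orbT.
have J2 p : p \in F2 -> p \in join2 (F1, F2) by rewrite !inE => ->; rewrite !orbT.
have eqp p : (p.1 <= l)%N -> (b <= p.2)%N -> (l <= p.1)%N -> (p.2 <= b)%N -> p = (lo, b).
  by case: p => p1 p2 /= a1 a2 a3 a4; congr (_, _); apply: val_inj => /=; lia.
have lJ : linear_forest l r (join2 (F1, F2)).
  split.
  - move=> p /inJ[->|/h1[? ? ?]|/k1[? ? ?]] /=; split; lia.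
  - move=> p q /inJ[->|pF|pF] /inJ[->|qF|qF] /=; try (by apply: h2); try (by apply: k2);
      try (have [? ? ?] := h1 _ pF); try (have [? ? ?] := k1 _ pF);
      try (have [? ? ?] := h1 _ qF); try (have [? ? ?] := k1 _ qF); lia.
  - move=> p /inJ[->|pF|pF] /=.
    (* The exposed arc [u] of the left part becomes the arc directly below the new chord. *)
    + exists u; split=> [||q /inJ[->|qF|qF]] //=; first by lia.
      * by move=> q1 q2; have := in1 q qF; rewrite q1 q2.
      * by have [? ? ?] := k1 q qF; lia.
    + have [i [i1 i2 hi]] := h3 p pF; have [? ? ?] := h1 p pF.
      exists i; split=> // q /inJ[->|qF|qF] /=; last first.
      * by have [? ? ?] := k1 q qF; lia.
      * exact: hi.
      * by move=> ? ? ? ?; rewrite [p]eqp //; lia.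
    + have [i [i1 i2 hi]] := k3 p pF; have [? ? ?] := k1 p pF.
      exists i; split=> // q /inJ[->|qF|qF] /=; first by lia.
      * by have [? ? ?] := h1 q qF; lia.
      * exact: hi.
have tJ : top_at (join2 (F1, F2)).
  rewrite /top_at J0; apply/forall_inP => p /inJ[->|pF|pF] /=; first by rewrite leqnn implybT.
    by have [_ _ ->] := h1 p pF; rewrite implybT.
  by have [? _ _] := k1 p pF; apply/implyP => /eqP Ep; move: lt_lb; rewrite -lo_l -Ep; lia.
have sJ : split2 (join2 (F1, F2)) = (F1, F2).
  congr (_, _); apply: eq_pairs => p; rewrite inE; apply/idP/idP.
  - case/and3P => /inJ[->|//|pF] np pb; first by rewrite eqxx in np.
    by have [? ? ?] := k1 p pF; lia.
  - move=> pF; rewrite J1 //; have [_ _ ->] := h1 p pF; rewrite andbT.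
    by apply: contraNneq nlb => <-.
  - case/andP => /inJ[->|pF|//] /=; first by rewrite lo_l; lia.
    by have [? ? ?] := h1 p pF; lia.
  - by move=> pF; rewrite J2 //; have [-> _ _] := k1 p pF.
split=> //; first by have [_ _ _] := split2_linear lJ tJ; rewrite sJ.
have d0 : F1 :&: F2 = set0.
  apply: eq_pairs => p; rewrite !inE; apply/negP => /andP[/h1[? ? ?] /k1[? ? ?]]; lia.
rewrite /join2 cardsU1 cardsU d0 cards0 subn0 !inE (negPf nlb) /=.
have -> : (lo, b) \notin F2 by apply/negP => /k1[/= + _ _]; rewrite lo_l; lia.
by rewrite add1n.
Qed.

Lemma sum_top j :
  \sum_(E | [&& lin l r E, nfree l r E == j & top_at E]) 'X^#|E|
    = 'X * linV l b * linW j b r :> {poly rat}.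
Proof.
rewrite -mulrA /linV /linW big_distrlr /= big_distrr /=.
under [RHS]eq_bigr do rewrite big_distrr /=.
rewrite pair_big /= (reindex_onto join2 split2) /=; last first.
  by move=> E /and3P[/linP lE _ tE]; apply: join2K.
apply: eq_big => [[F1 F2]|[F1 F2]] /=.
  apply/idP/idP.
    case/andP => /and3P[/linP lE /eqP fE tE] /eqP sE.
    have [] := split2_linear lE tE; rewrite sE /= => a1 a2 a3 a4.
    by rewrite a2 a4 fE eqxx !andbT; apply/andP; split; apply/linP.
  case/andP => /andP[/linP a1 a2] /andP[/linP a3 /eqP a4].
  have [/linP-> -> -> -> _] := join2_linear a1 a2 a3.
  by rewrite a4 !eqxx.
case/andP => /and3P[/linP lE /eqP fE tE] /eqP sE.
have [] := split2_linear lE tE; rewrite sE /= => a1 a2 a3 a4.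
have [_ _ _ _ ->] := join2_linear a1 a2 a3.
by rewrite exprS exprD.
Qed.

End Join.

Lemma linV_sum l r : linV l r = \sum_(i < r - l) linW i.+1 l r.
Proof.
rewrite /linV /linW; under [RHS]eq_bigr do rewrite big_mkcondr.
rewrite exchange_big big_mkcondr /=; apply: eq_bigr => E _.
case: posnP => [->|f_gt0]; first by rewrite big1.
have lt_f : ((nfree l r E).-1 < r - l)%N by have := nfree_le l r E; lia.
rewrite (bigD1 (Ordinal lt_f)) //= prednK // eqxx big1 ?addr0 // => i ne.
by case: eqP => // Ef; case/eqP: ne; apply: val_inj; rewrite /= Ef.
Qed.

Lemma linW_eq0 j l r : (r - l < j)%N -> linW j l r = 0.
Proof.
move=> lt_j; rewrite /linW big_pred0 // => E; apply/negP => /andP[_ /eqP Ef].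
by have := nfree_le l r E; rewrite Ef leqNgt lt_j.
Qed.

Lemma linW_point j l : linW j l l = (j == 0)%:R.
Proof.
rewrite /linW (eq_bigl (fun E => (E == set0) && (j == 0)%N)) => [|E].
  case: j => [|j]; last by rewrite big_pred0 // => E; rewrite andbF.
  by rewrite (big_pred1 set0) => [|E]; rewrite ?andbT // cards0.
have [->|nE] /= := eqVneq E set0.
  rewrite /nfree big_geq // eq_sym andb_idl // => _; apply/linP; split=> p; by rewrite inE.
apply/negP => /andP[/linP[h1 _ _] _]; case/set0Pn: nE => p /h1[? ? ?]; lia.
Qed.

Lemma top_at_uniq (lo b b' : 'I_n) E : top_at lo b E -> top_at lo b' E -> b = b'.
Proof.
move=> /andP[bE /forall_inP tb] /andP[b'E /forall_inP tb']; apply: val_inj.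
have := tb _ b'E; have := tb' _ bE; rewrite /= eqxx /= => h1 h2.
by apply/eqP; rewrite eqn_leq h1 h2.
Qed.

Lemma top_at_exists (lo : 'I_n) E p : p \in E -> p.1 = lo -> exists b : 'I_n, top_at lo b E.
Proof.
move=> pE p1.
have Pp : (p \in E) && (p.1 == lo) by rewrite pE p1 eqxx.
case: (@arg_maxnP _ p (fun q => (q \in E) && (q.1 == lo)) (fun q => q.2 : nat) Pp).
move=> q /andP[qE /eqP q1] qmax; exists q.2; rewrite /top_at -q1 -surjective_pairing qE.
apply/forall_inP => t tE; apply/implyP => /eqP t1; apply: qmax.
by rewrite tE t1 q1 eqxx.
Qed.

Lemma linear_forest_behead (lo : 'I_n) l r E : lo = l :> nat ->
  linear_forest l r E /\ (forall b : 'I_n, ~~ top_at lo b E) <-> linear_forest l.+1 r E.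
Proof.
move=> lo_l; split=> [[lE ntop]|lE].
  have [h1 _ _] := lE; apply: (linear_forest_sub lE) => // p pE.
  have [a1 _ a3] := h1 p pE; split=> //; rewrite ltn_neqAle a1 andbT.
  apply/eqP => El; have [|b tb] := @top_at_exists lo E p pE.
    by apply: val_inj; rewrite /= lo_l.
  by have := ntop b; rewrite tb.
have [h1 _ _] := lE; split.
  by apply: (linear_forest_sub lE) => // p /h1[? ? ?]; split; lia.
by move=> b; apply/negP => /andP[/h1[/=]]; rewrite lo_l ltnn.
Qed.

Lemma nfree_behead l r E : (l < r)%N -> linear_forest l.+1 r E ->
  nfree l r E = (nfree l.+1 r E).+1.
Proof.
move=> lt_lr [h1 _ _]; rewrite (@nfree_cat l l.+1 r) // {1}/nfree big_nat1.
suff -> : covered E l = false by rewrite add1n.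
apply: negbTE; apply/negP => /coveredP[p pE /andP[p1 p2]].
by have [a1 _ _] := h1 p pE; have := leq_trans a1 p1; rewrite ltnn.
Qed.

Lemma linW_rec j l r : (l < r)%N -> (r < n)%N ->
  linW j l r = (if j is j'.+1 then linW j' l.+1 r else 0)
    + 'X * \sum_(b : 'I_n | (l < b <= r)%N) linV l b * linW j b r.
Proof.
move=> lt_lr lt_rn; pose lo := Ordinal (ltn_trans lt_lr lt_rn).
pose top E := [pick b : 'I_n | top_at lo b E].
have topP E (b : 'I_n) : (top E == Some b) = top_at lo b E.
  rewrite /top; case: pickP => [b' tb'|->] //.
  by apply/eqP/idP => [[<-]|/(top_at_uniq tb')->].
have topN E : (top E == None) = [forall b : 'I_n, ~~ top_at lo b E].
  rewrite /top; case: pickP => [b tb|tN]; last by apply/esym/forallP => b; rewrite tN.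
  by apply/esym/negP => /forallP/(_ b); rewrite tb.
rewrite {1}/linW (partition_big top predT) //= big_option /=; congr (_ + _).
  have E0 E : (lin l r E && (nfree l r E == j)) && (top E == None)
            = lin l.+1 r E && ((nfree l.+1 r E).+1 == j).
    rewrite topN; apply/idP/idP.
      case/andP => /andP[/linP lE /eqP <-] /forallP tE.
      have l1E : linear_forest l.+1 r E by apply/(@linear_forest_behead lo).
      by rewrite (nfree_behead lt_lr l1E) eqxx andbT; apply/linP.
    case/andP => /linP l1E /eqP <-; have /(@linear_forest_behead lo)[//|lE tE] := l1E.
    by rewrite (nfree_behead lt_lr l1E) eqxx andbT; apply/andP; split; [apply/linP|apply/forallP].
  rewrite (eq_bigl _ _ E0); case: (j) => [|j']; last by [].
  by rewrite big_pred0 // => E; rewrite andbF.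
rewrite big_distrr /= [RHS]big_mkcond /=; apply: eq_bigr => b _.
rewrite (eq_bigl (fun E => [&& lin l r E, nfree l r E == j & top_at lo b E])); last first.
  by move=> E; rewrite topP andbA.
case: ifP => [/andP[lt_lb le_br]|nb]; first by rewrite mulrA -(@sum_top l r lo b).
rewrite big_pred0 // => E; apply/negP => /and3P[/linP[h1 _ _] _ /andP[/h1[/= _ b1 b2] _]].
by rewrite b1 b2 in nb.
Qed.

Lemma sum_ord_interval (V : nmodType) (T : nat -> V) l M : (l + M < n)%N ->
  \sum_(b : 'I_n | (l < b <= l + M)%N) T (b - l)%N = \sum_(a < M) T a.+1.
Proof.
move=> lt_n; rewrite -(big_mkord (fun b => (l < b <= l + M)%N) (fun b => T (b - l)%N)).
rewrite (@big_cat_nat _ _ _ l.+1) //=; last by lia.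
rewrite big_nat_cond big_pred0 ?add0r => [|i]; last by lia.
rewrite (@big_cat_nat _ _ _ (l + M).+1) //=; last by lia.
rewrite [X in _ + X]big_nat_cond [X in _ + X]big_pred0 ?addr0 => [|i]; last by lia.
rewrite big_nat_cond (eq_bigl (fun i => (l.+1 <= i < (l + M).+1)%N && true)); last by move=> i; lia.
rewrite -big_nat_cond -{1}[l.+1]add0n big_addn big_mkord.
have -> : ((l + M).+1 - l.+1 = M)%N by lia.
by apply: eq_bigr => i _; congr T; lia.
Qed.

(* Linear forests on the whole of [l, r] also occur on the right of the recurrence,
   but only inside linV and only if j = 0; so the case j > 0 is settled first. *)
Lemma linWE_step j l r : (l < r)%N -> (r < n)%N -> (j <= r - l)%N ->
    (forall i (b : 'I_n), (l < b <= r - j)%N -> (i < b - l)%N ->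
      linW i.+1 l b = Hpoly i.+2 (b - l - i.+1)) ->
    (forall j' l', (l < l' <= r)%N -> (j' <= r - l')%N ->
      linW j' l' r = Hpoly j'.+1 (r - l' - j')) ->
  linW j l r = Hpoly j.+1 (r - l - j).
Proof.
move=> lt_lr lt_rn le_jd IHl IHr; rewrite linW_rec // Hpoly_rec; congr (_ + 'X * _).
  case: j le_jd {IHl} => [|j] le_jd; first by rewrite Hpoly0 subn0 subn_eq0 leqNgt lt_lr.
  by rewrite IHr; [congr Hpoly|..]; lia.
set M := (r - l - j)%N.
pose T d : {poly rat} := \sum_(i < d) Hpoly i.+2 (d - i.+1) * Hpoly j.+1 (M - d).
rewrite (bigID (fun b : 'I_n => (b <= l + M)%N)) /= [X in _ + X]big1 ?addr0; last first.
  move=> b /andP[/andP[lt_lb le_br]]; rewrite -ltnNge => lt_b.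
  by rewrite [linW _ b _]linW_eq0 ?mulr0 //; rewrite /M in lt_b; lia.
rewrite (eq_big (fun b : 'I_n => (l < b <= l + M)%N) (fun b : 'I_n => T (b - l)%N)); first last.
- move=> b /andP[/andP[lt_lb le_br] le_bM]; rewrite linV_sum /T big_distrl /=.
  apply: eq_bigr => i _; have lt_i := ltn_ord i.
  rewrite IHl //; last by rewrite /M in le_bM; lia.
  rewrite IHr; [congr (_ * Hpoly _ _)|..]; rewrite /M in le_bM *; lia.
- by move=> b; rewrite /M; lia.
rewrite sum_ord_interval; last by rewrite /M; lia.
transitivity (\sum_(d < M.+1) T d).
  by rewrite [RHS]big_ord_recl /T big_ord0 add0r.
pose G i b := Hpoly i.+2 b * Hpoly j.+1 (M - i.+1 - b).
rewrite (eq_bigr (fun d : 'I_M.+1 => \sum_(i < d) G i (d - i.+1)%N)); last first.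
  move=> d _; apply: eq_bigr => i _; rewrite /G; congr (_ * Hpoly _ _).
  by have := ltn_ord i; lia.
rewrite sum_triangle; apply: eq_bigr => i _.
by rewrite /G Hpoly_conv; congr Hpoly; lia.
Qed.

(** The [j] exposed arcs leave [j+1] gaps, each filled by a sequence of outer chords with what lies
    below them; this is [z^j C^(j+1)], read at degree [r-l] in [z]. *)
Lemma linWE j l r : (l <= r)%N -> (r < n)%N -> (j <= r - l)%N ->
  linW j l r = Hpoly j.+1 (r - l - j).
Proof.
move Ed: (r - l)%N => d; elim/ltn_ind: d l r j Ed => d IH l r j Ed le_lr lt_rn le_jd.
have [E0|d_gt0] := posnP d.
  have -> : r = l by lia.
  have -> : j = 0%N by lia.
  rewrite linW_point E0 subnn; apply/polyP => m; rewrite coef_Hpoly coef1.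
  by case: m.
have IHr j' l' : (l < l' <= r)%N -> (j' <= r - l')%N ->
    linW j' l' r = Hpoly j'.+1 (r - l' - j').
  by move=> lt_l' le_j'; apply: (IH (r - l')%N); lia.
have pos i : (i < d)%N -> linW i.+1 l r = Hpoly i.+2 (d - i.+1).
  move=> lt_i; rewrite -Ed; apply: linWE_step => //; try lia.
  by move=> i' b lt_b lt_i'; apply: (IH (b - l)%N); lia.
case: j le_jd => [|j] le_jd; last exact: pos.
rewrite -Ed; apply: linWE_step => //; try lia.
move=> i b; rewrite subn0 => /andP[lt_lb le_br] lt_i.
have [Eb|ne] := eqVneq (b : nat) r; first by rewrite Eb Ed pos //; lia.
by apply: (IH (b - l)%N); have := ltn_ord b; lia.
Qed.

Lemma card_lin j m l r : (l <= r)%N -> (r < n)%N -> (j <= r - l)%N ->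
  #|[set E | [&& lin l r E, nfree l r E == j & #|E| == m]]|%:R
    = hcoef j.+1 m (r - l - j).
Proof.
move=> le_lr lt_rn le_j; rewrite -coef_Hpoly -linWE // coef_sum -sum1_card natr_sum.
rewrite (eq_bigl (fun E => (lin l r E && (nfree l r E == j)) && (#|E| == m))); last first.
  by move=> E; rewrite inE andbA.
by rewrite big_mkcondr; apply: eq_bigr => E _; rewrite coefXn eq_sym; case: eqP.
Qed.

End Linear.

(** * Acyclic graphs *)

Local Open Scope nat_scope.

Lemma fpath_const (T : eqType) (f : T -> T) (P : pred T) (x : T) p :
  fpath f x p -> {in belast x p, forall z, P (f z) = P z} -> P (last x p) = P x.
Proof.
elim: p x => //= u p IH v /andP[/eqP Ey fp] Pf.
rewrite (IH u) // => [|z zp]; last by rewrite Pf // inE zp orbT.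
by rewrite -Ey Pf // inE eqxx.
Qed.

Section Graphs.
Variable n : nat.
Implicit Types (G H : graph n) (x y z : 'I_n) (X : {set 'I_n}) (s : seq 'I_n).

Lemma adj_sym G : symmetric (adj G).
Proof. by move=> x y; rewrite /adj setUC. Qed.

Lemma connect_adj_sym G : connect_sym (adj G).
Proof. exact/sym_connect_sym/adj_sym. Qed.

Lemma acyclicP G :
  reflect (forall s, uniq s -> 3 <= size s -> ~~ path.cycle (adj G) s) (acyclic G).
Proof.
apply: (iffP idP) => [/existsPn acG s us s3 | acG].
  have le_s : size s < n.+1.
    by rewrite ltnS -(card_uniqP us) -[X in _ <= X]card_ord max_card.
  have /existsPn/(_ [ffun i : 'I_(Ordinal le_s) => tnth (in_tuple s) i]) := acG (Ordinal le_s).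
  have -> : codom [ffun i : 'I_(size s) => tnth (in_tuple s) i] = s.
    by rewrite (eq_codom (ffunE _)) /codom /image_mem map_tnth_enum.
  by rewrite us s3.
apply/existsPn => m; apply/existsPn => f; apply/negP => /and3P[uf m3 cf].
by have := acG _ uf; rewrite size_codom card_ord cf => /(_ m3).
Qed.

(* If e is the only edge of a cycle crossing X, the rest of the cycle joins the
   two ends of e on one side of X. *)
Lemma acyclic_cuts G :
    (forall H : graph n, H \subset G -> H != set0 ->
      exists x y X, [/\ [set x; y] \in H, x \in X, y \notin X &
        forall z t, [set z; t] \in H -> z \in X -> t \notin X ->
          [set z; t] = [set x; y]]) ->
  acyclic G.
Proof.
move=> cuts; apply/acyclicP => s us s3; apply/negP => cs.
pose H : graph n := [set [set x; next s x] | x in s].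
have HG : H \subset G.
  by apply/subsetP => e /imsetP[x xs ->]; apply: next_cycle cs xs.
have H0 : H != set0.
  case: s us s3 cs @H HG => // x s _ _ _ H _.
  by apply/set0Pn; exists [set x; next (x :: s) x]; apply: imset_f; rewrite inE eqxx.
have [x [y [X [xyH xX yX uniqX]]]] := cuts H HG H0.
have [a as_ Exy] := imsetP xyH; set b := next s a in Exy.
have XabN : (b \in X) != (a \in X).
  have : x \in [set a; b] by rewrite -Exy set21.
  have : y \in [set a; b] by rewrite -Exy set22.
  have nxy : x != y by apply: contraNneq yX => <-.
  move: nxy xX yX; rewrite !inE.
  by move=> nxy + + /orP[] /eqP Ey /orP[] /eqP Ex;
     move: nxy; rewrite Ey Ex ?eqxx // => _ -> /negPf->.
have [i s' Es] := rot_to as_.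
have us' : uniq (a :: s') by rewrite -Es rot_uniq.
have : fcycle (next s) (a :: s') by rewrite -Es rot_cycle cycle_next.
have : size (a :: s') = size s by rewrite -Es size_rot.
case: s' us' Es => [|b' [|c s']] us' Es sz; rewrite -?sz // in s3.
rewrite /= -/b => /andP[/eqP Eb fp]; rewrite -{}Eb in fp us' Es.
have nextb : next s b = c by case/andP: (fp) => /eqP.
suff : (last b (rcons (c :: s') a) \in X) = (b \in X).
  by rewrite last_rcons => E; rewrite E eqxx in XabN.
apply: (@fpath_const _ (next s) (fun z => z \in X) b (c :: rcons s' a) fp) => z zp.
have zs' : z \in [:: b, c & s'] by move: zp; rewrite -rcons_cons belast_rcons.
have zs : z \in s by rewrite -(mem_rot i) Es inE zs' orbT.
have zH : [set z; next s z] \in H by apply: imset_f.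
have za : z != a by move: us'; rewrite cons_uniq => /andP[+ _]; apply: contraNneq => <-.
have ca : c != a.
  by move: us'; rewrite cons_uniq => /andP[+ _]; apply: contraNneq => <-; rewrite !inE eqxx orbT.
have ne : [set z; next s z] != [set x; y].
  rewrite Exy; apply/eqP => E.
  have /set2P[Ea|Ezb] : z \in [set a; b] by rewrite -E set21.
    by rewrite Ea eqxx in za.
  have /set2P[Ea|Ea] : a \in [set z; next s z] by rewrite E set21.
    by rewrite Ea eqxx in za.
  by rewrite Ea Ezb nextb eqxx in ca.
have hN u v : [set u; v] = [set z; next s z] -> u \in X -> v \notin X -> False.
  move=> E uX vX; have := uniqX u v; rewrite E => /(_ zH uX vX) E'.
  by rewrite E' eqxx in ne.
case zX: (z \in X); case nX: (next s z \in X) => //.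
  by case: (hN z (next s z)) => //; rewrite nX.
by case: (hN (next s z) z) => //; rewrite ?zX // setUC.
Qed.

(** A simple path in [e] from [x] to [y] closes up with the edge [xy] to a cycle; as [x != y] and
    [e x y] fails, it has at least three vertices. *)
Lemma acyclic_bridge G (e : rel 'I_n) x y :
    acyclic G -> subrel e (adj G) -> adj G x y -> ~~ e x y -> x != y ->
  ~~ connect e x y.
Proof.
move=> /acyclicP acG eG xyG nexy nxy; apply/negP => /connectP[p0 ep0 Ey].
case/shortenP: ep0 Ey => p ep up _ Ey.
have := acG _ up; rewrite /= rcons_path (sub_path eG ep) -Ey adj_sym xyG /=.
case: p ep {up} Ey => [|z [|t p]] //=; first by move=> _ E; rewrite E eqxx in nxy.
  by move=> /andP[exz _] E; rewrite E exz in nexy.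
by move=> _ _ /(_ isT).
Qed.

Lemma acyclicS G H : H \subset G -> acyclic G -> acyclic H.
Proof.
move=> /subsetP HG /acyclicP acG; apply/acyclicP => s us s3.
apply: contra (acG s us s3); apply: sub_cycle => x y; exact: HG.
Qed.

Lemma simple_edgesS G H : H \subset G -> simple_edges G -> simple_edges H.
Proof.
move=> /subsetP HG /forall_inP sG; apply/forall_inP => e eH; exact/sG/HG.
Qed.

(** A removed edge is a bridge, so exactly one component splits in two. This trades the number of
    components for the number of edges, which the generating polynomials record. *)
Lemma n_components_acyclic G :
  simple_edges G -> acyclic G -> n_components G + #|G| = n.
Proof.
pose C G x := [set y | connect (adj G) x y].
have CE G' x y : (y \in C G' x) = connect (adj G') x y by rewrite inE.
move Em: #|G| => m; elim: m G Em => [|m IH] G Em sG acG.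
  have {}Em : G = set0 by apply/eqP; rewrite -cards_eq0 Em.
  rewrite addn0 /n_components (eq_imset (g := set1)) ?card_imset ?cardsT ?card_ord //.
    by move=> x y /set1_inj.
  move=> x; apply/setP => y; rewrite !inE; apply/idP/eqP => [|-> //].
  case/connectP => -[|z p] //=; rewrite /adj Em inE //.
have /card_gt0P[e eG] : 0 < #|G| by rewrite Em.
have /cards2P[x [y [nxy Exy]]] : #|e| == 2 by move/forall_inP: sG; apply.
rewrite {}Exy in eG; pose G' := G :\ [set x; y].
have G'G : G' \subset G by apply: subD1set.
have cG' : #|G'| = m by move: (cardsD1 [set x; y] G); rewrite eG Em => -[].
have {}IH := IH G' cG' (simple_edgesS G'G sG) (acyclicS G'G acG).
have sub' : subrel (adj G') (adj G) by move=> u v; apply: (subsetP G'G).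
have nc : ~~ connect (adj G') x y.
  by apply: acyclic_bridge acG sub' eG _ nxy; rewrite /adj setD11.
pose U := C G' x :|: C G' y.
have cs := connect_adj_sym.
have inU u v : connect (adj G') u v -> u \in U -> v \in U.
  by move=> uv; rewrite !inE => /orP[] h; rewrite (connect_trans h uv) ?orbT.
have subc u v : connect (adj G') u v -> connect (adj G) u v.
  by apply: connect_sub => a b /sub' ab; apply: connect1.
have xU : x \in U by rewrite !inE connect0.
have yU : y \in U by rewrite !inE connect0 orbT.
have connE u v : connect (adj G) u v = connect (adj G') u v || (u \in U) && (v \in U).
  apply/idP/idP => [/connectP[p]|].
    elim/last_ind: p v => [|p t IHp] v /=; first by move=> _ ->; rewrite connect0.
    rewrite rcons_path last_rcons => /andP[ep zt] ->.
    move: (IHp _ ep erefl) zt; move: (last u p) => z {ep IHp} Rz zt.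
    have [G'zt|] := boolP (adj G' z t).
      have ct := connect1 G'zt; case/orP: Rz => [uz|/andP[uU zU]].
        by rewrite (connect_trans uz ct).
      by rewrite uU (inU _ _ ct zU) orbT.
    rewrite /adj in_setD1 [_ \in G]zt andbT negbK => /eqP E.
    have zU : z \in U by have : z \in [set z; t] by [rewrite set21]; rewrite E => /set2P[]->.
    have tU : t \in U by have : t \in [set z; t] by [rewrite set22]; rewrite E => /set2P[]->.
    rewrite tU andbT; case/orP: Rz => [uz|/andP[-> _]]; last by rewrite orbT.
    by rewrite (inU z) ?orbT // cs.
  case/orP => [/subc //|/andP[]].
  have toU u' : u' \in U -> connect (adj G) x u'.
    rewrite !inE => /orP[/subc //|/subc]; apply: connect_trans; exact: connect1.
  by move=> /toU xu /toU xv; apply: connect_trans xv; rewrite cs.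
have CGE u : C G u = if u \in U then U else C G' u.
  apply/setP => v; rewrite CE connE; case: ifP => uU /=; last by rewrite orbF CE.
  case vU: (v \in U); rewrite ?orbT // orbF; apply/negP => /inU/(_ uU).
  by rewrite vU.
pose P G1 : {set {set 'I_n}} := [set C G1 u | u : 'I_n].
have eqC u v : connect (adj G') u v -> C G' u = C G' v.
  by move=> uv; apply/setP => z; rewrite !CE; apply: same_connect.
have PE : P G = U |: (P G' :\ C G' x :\ C G' y).
  apply/setP => S; rewrite !inE; apply/imsetP/idP => [[u _ ->]|].
    rewrite CGE; case: ifP => [|uU]; first by rewrite eqxx.
    rewrite orbC imset_f // andbT.
    have nE z : z \in U -> C G' u != C G' z.
      move=> zU; apply/eqP => /setP/(_ u); rewrite !CE connect0 => /esym zu.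
      by rewrite (inU _ _ zu zU) in uU.
    by rewrite !nE.
  case/orP => [/eqP->|/and3P[nSy nSx /imsetP[u _ ES]]].
    by exists x => //; rewrite CGE xU.
  exists u => //; rewrite CGE ES; case: ifP => //; rewrite inE !CE => /orP[] /eqC E.
    by rewrite ES E eqxx in nSx.
  by rewrite ES E eqxx in nSy.
have nU : U \notin P G' :\ C G' x :\ C G' y.
  apply/negP; rewrite !inE => /and3P[_ _ /imsetP[u _ EU]].
  move: xU yU; rewrite EU !CE => ux uy.
  by case/negP: nc; apply: connect_trans uy; rewrite cs.
have := IH; rewrite /n_components -/(P G) -/(P G') PE cardsU1 nU.
rewrite (cardsD1 (C G' x) (P G')) imset_f // (cardsD1 (C G' y) (P G' :\ _)).
rewrite in_setD1 imset_f // andbT.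
have -> : C G' y != C G' x.
  by apply/eqP => /setP/(_ y); rewrite !CE connect0 => /esym xy; rewrite xy in nc.
by rewrite !add1n addSnnS.
Qed.

End Graphs.

(** * Non-crossing graphs as sets of ordered pairs *)

Lemma connect_ind (T : finType) (e : rel T) (x : T) (P : T -> Prop) :
    P x -> (forall y z, connect e x y -> P y -> e y z -> P z) ->
  forall y, connect e x y -> P y.
Proof.
move=> Px Pe y /connectP[p ep ->]; elim/last_ind: p ep => [|p z IH] //=.
rewrite rcons_path last_rcons => /andP[ep ez]; apply: Pe ez; last exact: IH.
by apply/connectP; exists p.
Qed.

Section GraphPairs.
Variable n : nat.
Implicit Types (G H : graph n) (E F : {set 'I_n * 'I_n}) (x y z : 'I_n).

Definition ups G : {set 'I_n * 'I_n} :=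
  [set p : 'I_n * 'I_n | (p.1 < p.2) && ([set p.1; p.2] \in G)].

Definition downs E : graph n := [set [set p.1; p.2] | p : 'I_n * 'I_n in E].

Definition ordered E := forall p : 'I_n * 'I_n, p \in E -> p.1 < p.2.

Lemma mem_ups G x y : ((x, y) \in ups G) = (x < y) && adj G x y.
Proof. by rewrite inE. Qed.

Lemma ups_ordered G : ordered (ups G).
Proof. by move=> p; rewrite inE => /andP[]. Qed.

Lemma set2_inj_lt (p q : 'I_n * 'I_n) :
  p.1 < p.2 -> q.1 < q.2 -> [set p.1; p.2] = [set q.1; q.2] -> p = q.
Proof.
case: p q => [a b] [c d] /= ab cd E.
have : a \in [set c; d] by rewrite -E set21.
have : b \in [set c; d] by rewrite -E set22.
have : c \in [set a; b] by rewrite E set21.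
rewrite !inE => /orP[] /eqP h1 /orP[] /eqP h2 /orP[] /eqP h3;
  subst; rewrite ?ltnn // in ab cd *; by have := ltn_trans ab cd; rewrite ltnn.
Qed.

Lemma adj_downs E x y : adj (downs E) x y = ((x, y) \in E) || ((y, x) \in E).
Proof.
apply/imsetP/orP => [[[a b] pE /= EE]|[pE|pE]].
- have : x \in [set a; b] by rewrite -EE set21.
  have : y \in [set a; b] by rewrite -EE set22.
  have : a \in [set x; y] by rewrite EE set21.
  have : b \in [set x; y] by rewrite EE set22.
  rewrite !inE => /orP[] /eqP h1 /orP[] /eqP h2 /orP[] /eqP h3 /orP[] /eqP h4;
   subst; rewrite ?pE; by [left|right].
- by exists (x, y).
- by exists (y, x) => //=; rewrite setUC.
Qed.

Lemma upsK E : ordered E -> ups (downs E) = E.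
Proof.
move=> oE; apply: eq_pairs => -[x y]; rewrite mem_ups adj_downs.
case xyE: ((x, y) \in E); first by rewrite andbT (oE _ xyE).
apply/negP => /andP[xy /orP[|/oE]] //=.
by move=> /(ltn_trans xy); rewrite ltnn.
Qed.

Lemma simple_downs E : ordered E -> simple_edges (downs E).
Proof.
move=> oE; apply/forall_inP => e /imsetP[p pE ->]; rewrite cards2.
by have := oE p pE; rewrite ltn_neqAle => /andP[->].
Qed.

Lemma graph_eq G H : simple_edges G -> simple_edges H -> adj G =2 adj H -> G = H.
Proof.
move=> sG sH GH; apply/setP => e; apply/idP/idP => eG.
  move/forall_inP: sG => /(_ e eG) /cards2P[x [y [_ Ee]]].
  by have := GH x y; rewrite /adj -Ee eG.
move/forall_inP: sH => /(_ e eG) /cards2P[x [y [_ Ee]]].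
by have := GH x y; rewrite /adj -Ee eG.
Qed.

Lemma simple_adj_neq G x y : simple_edges G -> adj G x y -> x != y.
Proof. by move=> /forall_inP sG /sG; rewrite cards2; case: (x != y). Qed.

Lemma downsK G : simple_edges G -> downs (ups G) = G.
Proof.
move=> sG; apply: graph_eq => //; first exact/simple_downs/ups_ordered.
move=> x y; rewrite adj_downs !mem_ups [adj G y x]adj_sym.
case a: (adj G x y); rewrite ?andbF // !andbT.
by rewrite -neq_ltn; apply: simple_adj_neq sG a.
Qed.

Lemma card_downs E : ordered E -> #|downs E| = #|E|.
Proof.
by move=> oE; rewrite card_in_imset // => p q /oE po /oE qo; apply: set2_inj_lt.
Qed.

Lemma card_ups G : simple_edges G -> #|ups G| = #|G|.
Proof. by move=> sG; rewrite -{2}(downsK sG) card_downs //; apply: ups_ordered. Qed.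

Lemma non_crossingP G :
  reflect (forall a b c d : 'I_n, adj G a b -> adj G c d -> a < c -> c < b -> b < d -> False)
          (non_crossing G).
Proof.
apply: (iffP forallP) => [nc a b c d ab cd h1 h2 h3|nc a].
  move/forallP: (nc a) => /(_ b)/forallP/(_ c)/forallP/(_ d).
  by rewrite [_ \in G]ab [_ \in G]cd /crossing h1 h2 h3.
apply/forallP => b; apply/forallP => c; apply/forallP => d.
apply/implyP => /andP[ab cd]; apply/negP => /andP[/andP[h1 h2] h3].
exact: nc ab cd h1 h2 h3.
Qed.

(** For a chord [ab], let [x] be the farthest point reachable from [a] inside [[a, b]] without using
    [ab]; acyclicity gives [x < b]. The arc at [x] is directly below [ab]: another chord [cd] inside
    [[a, b]] covering it would have both ends unreachable, and a path from [a] to [x] would have to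
    cross it. *)
Lemma linear_of_acyclic G :
  non_crossing G -> acyclic G -> linear_forest 0 n.-1 (ups G).
Proof.
move=> /non_crossingP nc ac; split.
- by case=> x y; rewrite mem_ups => /andP[/= xy _]; split=> //; have := ltn_ord y; lia.
- case=> a b [c d]; rewrite !mem_ups /= => /andP[_ ab] /andP[_ cd] h1 h2 h3.
  exact: nc ab cd h1 h2 h3.
case=> a b; rewrite mem_ups => /andP[/= lt_ab ab].
have neq_ab : a != b by rewrite neq_ltn lt_ab.
pose e x y := [&& adj G x y, a <= x <= b, a <= y <= b & [set x; y] != [set a; b]].
have : ~~ connect e a b.
  apply: acyclic_bridge ac _ ab _ neq_ab; first by move=> x y /and4P[].
  by rewrite /e eqxx !andbF.
have [x ax xmax] : exists2 x, connect e a x & forall y, connect e a y -> y <= x.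
  have [x] := @arg_maxnP _ a (connect e a) (fun x => x : nat) (connect0 e a).
  by exists x.
have xr : a <= x <= b.
  move: x ax {xmax}; apply: connect_ind => [|y z _ _ /and4P[]] //.
  by rewrite leqnn ltnW.
have [Ex|nxb] := eqVneq x b; first by rewrite -Ex ax.
have lt_xb : x < b by move: xr nxb; rewrite -val_eqE /=; lia.
move=> _; exists x; split=> //; first by case/andP: xr.
case=> c d; rewrite mem_ups => /andP[/= lt_cd cd] cx xd ac' db.
apply/eqP; apply: contraT => ncd; exfalso.
have ecd : e c d.
  rewrite /e cd ac' db (leq_trans cx (ltnW lt_xb)) (leq_trans ac' (ltnW lt_cd)) /=.
  by apply: contraNneq ncd => E; apply/eqP/set2_inj_lt.
have nd : ~~ connect e a d by apply/negP => /xmax; rewrite leqNgt xd.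
have nc' : ~~ connect e a c.
  by apply: contra nd => h; apply: connect_trans h (connect1 ecd).
have ncx : c != x by apply: contraNneq nc' => ->.
suff : ~ (c < x < d) by apply; rewrite xd andbT ltn_neqAle val_eqE ncx.
move: x ax {xmax xr nxb lt_xb cx xd ncx}; apply: connect_ind.
  by rewrite ltnNge ac'.
move=> y z ay yN /and4P[yz _ _ _] /andP[cz zd].
have [yc|yd] : y < c \/ d < y.
  have nyc : y != c by apply: contraNneq nc' => <-.
  have nyd : y != d by apply: contraNneq nd => <-.
  by move: nyc nyd yN; rewrite -!val_eqE /=; clear; lia.
  exact: nc yz cd yc cz zd.
by rewrite adj_sym in yz; apply: nc cd yz cz zd yd.
Qed.

(** Take the longest edge of [H] and an arc [i] directly below it. Another edge of [H] covering [i]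
    cannot cross that edge, cannot be nested in it by the choice of [i], and cannot enclose it by
    maximality. *)
Lemma linear_cut G l r H :
    simple_edges G -> linear_forest l r (ups G) -> H \subset G -> H != set0 ->
  exists x y (i : nat), [/\ [set x; y] \in H, x <= i, i < y &
    forall z t, [set z; t] \in H -> z <= i -> i < t -> z = x /\ t = y].
Proof.
move=> sG [h1 h2 h3] /subsetP HG /set0Pn[e eH].
have eG := HG e eH; move: (eG); rewrite -{1}(downsK sG) => /imsetP[p0 p0E Ee].
have Pp0 : (p0 \in ups G) && ([set p0.1; p0.2] \in H) by rewrite p0E -Ee eH.
case: (@arg_maxnP _ p0 (fun p : 'I_n * 'I_n => (p \in ups G) && ([set p.1; p.2] \in H))
  (fun p : 'I_n * 'I_n => p.2 - p.1) Pp0).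
move=> [a b] /andP[/= pE pH] pmax; have [i [/= i1 i2 hi]] := h3 _ pE.
have /= [_ lt_ab _] := h1 _ pE.
exists a, b, i; split=> // z t ztH zi it.
have zt : (z, t) \in ups G by rewrite mem_ups (leq_ltn_trans zi it) /adj HG.
have := pmax (z, t); rewrite zt /= ztH => /(_ isT) /= le_len.
have az : a <= z.
  rewrite leqNgt; apply/negP => za; have [tb|bt] := ltnP t b.
    exact: (h2 _ _ zt pE za (leq_ltn_trans i1 it) tb).
  by move: le_len za bt lt_ab; clear; lia.
have tb : t <= b.
  rewrite leqNgt; apply/negP => bt; have [a_lt|a_ge] := ltnP a z.
    exact: (h2 _ _ pE zt a_lt (leq_ltn_trans zi i2) bt).
  by move: le_len a_ge bt lt_ab; clear; lia.
by have [<- <-] : (z, t) = (a, b) by apply: hi.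
Qed.

Lemma acyclic_of_linear G l r :
  simple_edges G -> linear_forest l r (ups G) -> acyclic G.
Proof.
move=> sG lG; apply: acyclic_cuts => H HG H0.
have [x [y [i [xyH xi iy uniqi]]]] := linear_cut sG lG HG H0.
exists x, y, [set v : 'I_n | v <= i]; rewrite !inE xi -ltnNge iy; split=> // z t ztH.
by rewrite !inE -ltnNge => zi it; have [-> ->] := uniqi z t ztH zi it.
Qed.

Definition forest G := [&& simple_edges G, non_crossing G & acyclic G].

Lemma forestP G :
  reflect (simple_edges G /\ linear_forest 0 n.-1 (ups G)) (forest G).
Proof.
apply: (iffP and3P) => [[sG ncG acG]|[sG lG]].
  by split=> //; apply: linear_of_acyclic.
split=> //; last exact: acyclic_of_linear lG.
have [_ h2 _] := lG; apply/non_crossingP => a b c d ab cd ac cb bd.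
by apply: (h2 (a, b) (c, d)); rewrite ?mem_ups ?ab ?cd ?andbT //=; lia.
Qed.

Lemma NCF_forest k G : k <= n -> (G \in NCF n k) = forest G && (#|G| == n - k).
Proof.
move=> le_kn; rewrite inE -/(forest G) /forest -!andbA.
case sG: (simple_edges G) => //=; case: (non_crossing G) => //=.
case aG: (acyclic G) => //=; move: (n_components_acyclic sG aG).
by move: (n_components G) #|G| => c g; lia.
Qed.

(** The distinguished arc joins [n-1] to 0, so the forests are linear forests on [[0, n-1]]; [j] is
    the number of exposed arcs. *)
Lemma card_NCF k : 0 < n -> k <= n ->
  (#|NCF n k|%:R = \sum_(j < n) hcoef j.+1 (n - k) (n - j.+1) :> rat)%R.
Proof.
move=> n_gt0 le_kn.
pose S : {set {set 'I_n * 'I_n}} := [set E | lin 0 n.-1 E && (#|E| == n - k)].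
have -> : #|NCF n k| = #|S|.
  rewrite -(card_in_imset (f := downs) (D := S)); last first.
    move=> E F; rewrite !inE => /andP[/linP[h1 _ _] _] /andP[/linP[k1 _ _] _] EF.
    rewrite -(@upsK E) ?EF ?upsK // => p; by [case/h1|case/k1].
  apply: eq_card => G; rewrite NCF_forest //; apply/andP/imsetP.
    case=> /forestP[sG lG] /eqP cG; exists (ups G); last by rewrite downsK.
    by rewrite inE card_ups // cG eqxx andbT; apply/linP.
  case=> E; rewrite inE => /andP[/linP lE /eqP cE] ->.
  have oE : ordered E by move=> p; case: lE => h1 _ _ /h1[].
  by rewrite card_downs // cE; split=> //; apply/forestP; rewrite upsK //; split=> //; apply: simple_downs.
have lE E : nfree 0 n.-1 E < n by have := nfree_le 0 n.-1 E; lia.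
rewrite -sum1_card (partition_big (fun E => Ordinal (lE E)) predT) //= natr_sum.
apply: eq_bigr => j _; rewrite sum1_card.
have := @card_lin n j (n - k) 0 n.-1; rewrite subn0 => h.
have lt_j := ltn_ord j.
have -> : n - j.+1 = n.-1 - j by lia.
rewrite -h; [|lia..]; congr (_%:R)%R; apply: eq_card => E.
by rewrite unfold_in /S !inE -andbA -val_eqE /=; congr (_ && _); rewrite andbC.
Qed.

End GraphPairs.

(** * Rotations *)

Section Action.
Variable n : nat.
Implicit Types (G : graph n) (c d : {perm 'I_n}).

Lemma act_graph_inj c : injective (@act_graph n c).
Proof. exact/imset_inj/imset_inj/perm_inj. Qed.

Lemma mem_act c G (e : {set 'I_n}) : (c @: e \in act_graph c G) = (e \in G).
Proof. by rewrite mem_imset //; apply/imset_inj/perm_inj. Qed.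

Lemma adj_act c G x y : adj (act_graph c G) (c x) (c y) = adj G x y.
Proof. by rewrite /adj -imset_set1 -(imset_set1 c y) -imsetU mem_act. Qed.

Lemma act_graph1 G : act_graph 1 G = G.
Proof.
rewrite /act_graph -[RHS]imset_id; apply: eq_imset => e /=.
by rewrite -[RHS]imset_id; apply: eq_imset => x; rewrite perm1.
Qed.

Lemma act_graphM c d G : act_graph (c * d) G = act_graph d (act_graph c G).
Proof.
rewrite /act_graph -imset_comp; apply: eq_imset => e /=.
by rewrite -imset_comp; apply: eq_imset => x; rewrite permM.
Qed.

Lemma card_act c G : #|act_graph c G| = #|G|.
Proof. by rewrite card_imset //; apply/imset_inj/perm_inj. Qed.

Lemma simple_act c G : simple_edges G -> simple_edges (act_graph c G).
Proof.
move=> /forall_inP sG; apply/forall_inP => e /imsetP[e' e'G ->].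
by rewrite card_imset ?sG //; apply: perm_inj.
Qed.

Lemma acyclic_act c G : acyclic G -> acyclic (act_graph c G).
Proof.
move=> /acyclicP acG; apply/acyclicP => s us s3; apply/negP => cs.
have := acG (map (c^-1)%g s); rewrite map_inj_uniq; last exact: perm_inj.
rewrite size_map => /(_ us s3) /negP; apply.
rewrite cycle_map; apply: sub_cycle cs => x y /=.
by rewrite -{1}(permKV c x) -{1}(permKV c y) adj_act.
Qed.

End Action.

Section Rotation.
Variable n' : nat.
Local Notation n := n'.+1.
Implicit Types (G : graph n) (x y i : 'I_n).

Lemma rho_expE (d : nat) x : (rho n ^+ d)%g x = (x + inZp d)%R.
Proof.
elim: d => [|d IH]; first by rewrite expg0 perm1; apply: val_inj; rewrite /= mod0n addn0 modn_small.
rewrite expgSr permM IH permE; apply: val_inj => /=.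
by rewrite modnDmr -addn1 modnDml -addnA addn1 modnDmr.
Qed.

Lemma val_addZ x y : (x + y)%R = (if x + y < n then x + y else x + y - n) :> nat.
Proof.
rewrite /=; have := ltn_ord x; have := ltn_ord y => hy hx; case: ltnP => h.
  by rewrite modn_small.
by rewrite -[in LHS](subnK h) modnDr modn_small //; lia.
Qed.

Lemma val_subZ x y : (y - x)%R = (if x <= y then y - x else n + y - x) :> nat.
Proof.
rewrite /=; have := ltn_ord x; have := ltn_ord y => hy hx; rewrite modnDmr.
case: leqP => h; last by rewrite modn_small; lia.
have -> : y + (n - x) = (y - x) + n by lia.
by rewrite modnDr modn_small; lia.
Qed.

Definition rotate (d : nat) G := act_graph (rho n ^+ d)%g G.

Lemma adj_rotate d G x y :
  adj (rotate d G) x y = adj G (x - inZp d)%R (y - inZp d)%R.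
Proof.
by rewrite -[RHS](adj_act (rho n ^+ d)%g) !rho_expE !subrK.
Qed.

Lemma adj_rotateD d G x y :
  adj (rotate d G) (x + inZp d)%R (y + inZp d)%R = adj G x y.
Proof. by rewrite adj_rotate !addrK. Qed.

Lemma non_crossing_rho G : non_crossing G -> non_crossing (rotate 1 G).
Proof.
move=> /non_crossingP nc; apply/non_crossingP => a b c d.
rewrite !adj_rotate => ab cd h1 h2 h3.
have v x : (x - inZp 1)%R = (if 0 < x then x.-1 else n.-1) :> nat.
  rewrite val_subZ /=; case: (n') x => [|m] x.
    by rewrite modn1 subn0; case: x => -[].
  by rewrite modn_small //; case: (val x) (ltn_ord x) => [|x'] /=; lia.
have v0 x : x = 0 :> nat -> (x - inZp 1)%R = n.-1 :> nat by move=> Ex; rewrite v Ex.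
have v1 x : 0 < x -> (x - inZp 1)%R = x.-1 :> nat by move=> Ex; rewrite v Ex.
have hd := ltn_ord d.
(* Undoing the rotation sends only 0 around the circle, to [n-1]; if [a = 0], the same crossing
   appears with the roles of the two chords exchanged. *)
have [Ea|a_gt0] := posnP a.
  by rewrite adj_sym in ab; apply: (nc _ _ _ _ cd ab);
     rewrite ?(v0 a) // ?(v1 b) ?(v1 c) ?(v1 d) //; lia.
by apply: (nc _ _ _ _ ab cd); rewrite ?(v1 a) ?(v1 b) ?(v1 c) ?(v1 d) //; lia.
Qed.

Lemma rotate0 G : rotate 0 G = G.
Proof. by rewrite /rotate expg0 act_graph1. Qed.

Lemma rotateD d1 d2 G : rotate d2 (rotate d1 G) = rotate (d1 + d2) G.
Proof. by rewrite /rotate expgD act_graphM. Qed.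

Lemma rotate_n G : rotate n G = G.
Proof.
rewrite /rotate; suff -> : (rho n ^+ n = 1)%g by rewrite act_graph1.
apply/permP => x; rewrite rho_expE perm1; apply: val_inj.
by rewrite /= modnn addn0 modn_small.
Qed.

Lemma forest_rotate d G : forest G -> forest (rotate d G).
Proof.
case/and3P => sG ncG acG; apply/and3P; split; [exact: simple_act| |exact: acyclic_act].
elim: d => [|d IH]; first by rewrite rotate0.
by rewrite -[d.+1]addn1 -rotateD; apply: non_crossing_rho.
Qed.

Lemma rotate_inj d : injective (rotate d).
Proof. exact: act_graph_inj. Qed.

End Rotation.

(** * Central arcs of a symmetric forest *)

Lemma addDB (V : zmodType) (z x y : V) : (x + z - (y + z) = x - y)%R.
Proof. by rewrite [(y + z)%R]addrC addrKA. Qed.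

Section Symmetric.
Variables n' N e : nat.
Local Notation n := n'.+1.
Hypotheses (Hn : n = e * N) (He : 1 < e).
Implicit Types (G : graph n) (x y i : 'I_n) (E : {set 'I_n * 'I_n}).

Let N_gt0 : 0 < N. Proof. by case: N Hn => //; rewrite muln0. Qed.
Let N2_le : N + N <= n. Proof. by rewrite Hn addnn -mul2n leq_mul2r He orbT. Qed.

(** The pair is oriented: fewer than [N] arcs lie clockwise from [x] to [y], so this is the side
    away from the centre. *)
Definition short G x y := adj G x y && ((y - x)%R < N).

(* No short chord separates arc i from the centre; the subtractions are modulo n. *)
Definition central G i :=
  [forall x, forall y, short G x y ==> ((y - x)%R <= (i - x)%R)].

Definition all_short G :=
  [forall x, forall y, adj G x y ==> ((y - x)%R < N) || ((x - y)%R < N)].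

Lemma short_rotate d G x y :
  short (rotate d G) x y = short G (x - inZp d)%R (y - inZp d)%R.
Proof. by rewrite /short adj_rotate opprB addrA subrK. Qed.

Lemma centralP G i :
  reflect (forall x y, short G x y -> (y - x)%R <= (i - x)%R) (central G i).
Proof.
apply: (iffP forallP) => [c x y|c x]; first by move: (c x) => /forallP/(_ y)/implyP.
by apply/forallP => y; apply/implyP/c.
Qed.

Lemma all_shortP G :
  reflect (forall x y, adj G x y -> short G x y \/ short G y x) (all_short G).
Proof.
apply: (iffP forallP) => [c x y xy|c x].
  move: (c x) => /forallP/(_ y); rewrite xy /= => /orP[] h; [left|right].
    by rewrite /short xy.
  by rewrite /short adj_sym xy.
by apply/forallP => y; apply/implyP => /c[] /andP[_ ->]; rewrite ?orbT.
Qed.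

Lemma central_rotate d G i : central (rotate d G) (i + inZp d)%R = central G i.
Proof.
apply/centralP/centralP => c x y sxy.
  have := c (x + inZp d)%R (y + inZp d)%R; rewrite short_rotate !addrK => /(_ sxy).
  by rewrite !addDB.
have := c (x - inZp d)%R (y - inZp d)%R; rewrite -short_rotate => /(_ sxy).
by rewrite !opprB !addrA subrK.
Qed.

Lemma all_short_rotate d G : all_short G -> all_short (rotate d G).
Proof.
move=> /all_shortP sG; apply/all_shortP => x y; rewrite adj_rotate !short_rotate.
exact: sG.
Qed.

(** The chord from [x] to 0 is a longest short one, rotated so as to end at 0. Read as the ordered
    pair [(0, x)] it has its long side below, and the arc directly below it is central: a short
    chord hiding that arc would cross this chord, exceed its length, or lie below it over the
    arc. *)
Lemma central_exists_at0 G x :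
    forest G -> short G x 0%R -> (forall u v, short G u v -> (v - u)%R <= (0 - x)%R) ->
  exists i, central G i.
Proof.
move=> /forestP[sG [h1 h2 h3]] /andP[x0 xN] xmax.
have nx0 : x != 0%R := simple_adj_neq sG x0.
have x_gt0 : 0 < x by rewrite lt0n -val_eqE in nx0 *.
have Ex : (0 - x)%R = n - x :> nat by rewrite val_subZ leqNgt x_gt0 /= addn0.
rewrite Ex in xN xmax.
have lt_x := ltn_ord x.
have up0 : ((0%R : 'I_n), x) \in ups G by rewrite mem_ups x_gt0 adj_sym.
have [i [/= _ i2 hi]] := h3 _ up0.
have lx2 : n < x + x by move: N2_le xN lt_x; clear; lia.
have lt_in : i < n := ltn_trans i2 lt_x.
exists (Ordinal lt_in); apply/centralP => u v suv; rewrite leqNgt; apply/negP.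
have lu := ltn_ord u; have lv := ltn_ord v; have le_uv := xmax u v suv.
case/andP: (suv) => uv; rewrite !val_subZ /= => uvN.
move: le_uv uvN; rewrite val_subZ; case: (leqP u v) => luv le_uv uvN; last first.
  case: (leqP u i) => li lt_i; first by lia.
  have vu : (v, u) \in ups G by rewrite mem_ups luv adj_sym.
  have [g1 g2 g3] : [/\ 0 < v, v < x & x < u].
    by move: lt_i li le_uv lu lx2; clear; split; lia.
  exact: (h2 _ _ up0 vu g1 g2 g3).
case: (leqP u i) => li lt_i; last by lia.
have neq_uv := simple_adj_neq sG uv.
have lt_uv : u < v by rewrite ltn_neqAle luv andbT.
have uvE : (u, v) \in ups G by rewrite mem_ups lt_uv.
have [le_vx|lt_xv] := leqP v x; last first.
  have [u0|u_gt0] := posnP u; first by move: N2_le xN uvN lt_xv; rewrite u0; clear; lia.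
  exact: (h2 _ _ up0 uvE u_gt0 (leq_ltn_trans li i2) lt_xv).
have [Eu Ev] : (u, v) = (0%R, x).
  by apply: hi => //=; move: lt_i li; clear; lia.
by move: uvN lx2 N2_le xN; rewrite Eu Ev /=; clear; lia.
Qed.

Lemma central_exists G : forest G -> exists i, central G i.
Proof.
move=> fG; case: (boolP [exists i, central G i]) => [/existsP //|/existsPn nc].
have [[x0 y0] s0] : exists p : 'I_n * 'I_n, short G p.1 p.2.
  move: (nc 0%R); rewrite negb_forall => /existsP[x].
  by rewrite negb_forall => /existsP[y]; rewrite negb_imply => /andP[sxy _]; exists (x, y).
case: (@arg_maxnP _ (x0, y0) (fun p : 'I_n * 'I_n => short G p.1 p.2)
  (fun p : 'I_n * 'I_n => (p.2 - p.1)%R : nat) s0) => -[x y] sxy xymax0.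
have xymax u v : short G u v -> (v - u)%R <= (y - x)%R := xymax0 (u, v).
pose d := ((- y)%R : 'I_n) : nat.
have dz : inZp d = (- y)%R :> 'I_n by apply: valZpK.
have [i ci] : exists i, central (rotate d G) i.
  apply: (@central_exists_at0 _ (x - y)%R); first exact: forest_rotate.
    by rewrite short_rotate dz opprK subrK add0r.
  move=> u v; rewrite short_rotate dz !opprK => /xymax.
  by rewrite addDB sub0r opprB.
by exists (i - inZp d)%R; rewrite -(central_rotate d) subrK.
Qed.

Definition symmetric_graph G := rotate N G == G.

Lemma symmetric_adj G t x y : symmetric_graph G ->
  adj G (x + inZp (t * N))%R (y + inZp (t * N))%R = adj G x y.
Proof.
move=> /eqP sG; have {1}<- : rotate (t * N) G = G; last exact: adj_rotateD.
by elim: t => [|t IH]; rewrite ?rotate0 // mulSn -rotateD sG.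
Qed.

Lemma symmetric_rotate d G : symmetric_graph G -> symmetric_graph (rotate d G).
Proof. by rewrite /symmetric_graph rotateD addnC -rotateD => /eqP->. Qed.

Lemma val_block t : t < e -> (inZp (t * N) : 'I_n) = t * N :> nat.
Proof. by move=> te; rewrite /= modn_small // Hn ltn_pmul2r. Qed.

(** Unless it has exactly [N] arcs on one side, the chord crosses its rotation. If it does, its
    rotations form a closed polygon with [e] sides, and for [e > 2] the side from 0 to [(e-1) N] has
    no arc directly below it. *)
Lemma long_edge_at0 G x : forest G -> symmetric_graph G -> adj G 0%R x ->
  N <= x -> x + N <= n -> e = 2.
Proof.
move=> /forestP[sG [h1 h2 h3]] symG x0 Nx xN.
pose a t : 'I_n := inZp (t * N).
have aD s t : (a s + a t)%R = a (s + t) by apply: val_inj; rewrite /= mulnDl modnDm.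
have a0 : a 0 = 0%R by apply: val_inj; rewrite /= mod0n.
have ae : a e = 0%R by apply: val_inj; rewrite /= -Hn modnn.
have va t : t < e -> a t = t * N :> nat := @val_block t.
have sh t u v : adj G (u + a t)%R (v + a t)%R = adj G u v by apply: symmetric_adj.
clearbody a; have N_lt : N < n by lia.
have va1 : a 1 = N :> nat by rewrite va // mul1n.
have adj01 : adj G 0%R (a 1).
  have [Ex|nx] := eqVneq (x : nat) N.
    by have -> : a 1 = x by apply: ord_inj; rewrite va1.
  have [Ex|nx'] := eqVneq (x + N) n.
    have := sh 1 0%R x; rewrite x0 add0r adj_sym.
    suff -> : (x + a 1 = 0)%R by [].
    by apply: ord_inj; rewrite val_addZ va1 Ex ltnn subnn.
  exfalso; have up0 : ((0%R : 'I_n), x) \in ups G by rewrite mem_ups x0 andbT /=; lia.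
  have v1 : (x + a 1)%R = x + N :> nat.
    by rewrite val_addZ va1 ifT //; lia.
  have up1 : (a 1, (x + a 1)%R) \in ups G.
    by rewrite mem_ups v1 va1 -{1}[a 1]add0r sh x0 andbT; lia.
  by apply: (h2 _ _ up0 up1); rewrite ?v1 ?va1 //=; lia.
have step t : adj G (a t) (a t.+1) by rewrite -[t.+1]add1n -aD -{1}[a t]add0r sh.
have ve1 : a e.-1 = e.-1 * N :> nat by apply: va; lia.
have upe : ((0%R : 'I_n), a e.-1) \in ups G.
  rewrite mem_ups ve1 muln_gt0 N_gt0 andbT; apply/andP; split; first by lia.
  by have := step e.-1; rewrite prednK ?ae 1?adj_sym //; lia.
have [i [/= _ lt_i hi]] := h3 _ upe; rewrite ve1 in lt_i hi.
have lt_t : i %/ N < e.-1 by rewrite ltn_divLR.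
have vt : a (i %/ N) = i %/ N * N :> nat by apply: va; lia.
have vt1 : a (i %/ N).+1 = (i %/ N).+1 * N :> nat by apply: va; lia.
have upt : (a (i %/ N), a (i %/ N).+1) \in ups G.
  by rewrite mem_ups vt vt1 step andbT ltn_pmul2r.
have := hi _ upt; rewrite /= vt vt1 leq_trunc_div ltn_ceil // leq_pmul2r //.
move=> /(_ isT isT isT lt_t) [Et Et1].
have /eqP : i %/ N * N = 0 by rewrite -vt Et.
rewrite muln_eq0 (gtn_eqF N_gt0) orbF => /eqP q0.
have := congr1 (@nat_of_ord _) Et1; rewrite vt1 ve1 q0 => /eqP.
by rewrite eqn_pmul2r // => /eqP; move: He; clear; lia.
Qed.

Lemma symmetric_edge G x y : forest G -> symmetric_graph G -> adj G x y ->
  short G x y \/ short G y x \/ e = 2 /\ y = (x + inZp N)%R.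
Proof.
move=> fG symG xy; rewrite /short xy adj_sym xy /=.
case: ltnP => [h|h1]; first by left.
case: ltnP => [h|h2]; first by right; left.
right; right; have nxy : x != y by case/forestP: fG => sG _; apply: simple_adj_neq xy.
pose d := ((- x)%R : 'I_n) : nat.
have dz : inZp d = (- x)%R :> 'I_n by apply: valZpK.
have D : (y - x)%R + (x - y)%R = n :> nat.
  have := ltn_ord x; have := ltn_ord y; move: nxy; rewrite -val_eqE !val_subZ /=.
  by case: (leqP x y); case: (leqP y x); lia.
have e2 : e = 2.
  apply: (@long_edge_at0 (rotate d G) (y - x)%R); rewrite ?forest_rotate ?symmetric_rotate //.
    by rewrite adj_rotate dz opprK add0r subrK.
  by apply: (@leq_trans ((y - x)%R + (x - y)%R)); rewrite ?leq_add2l // D.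
split=> //; apply/eqP; rewrite addrC -subr_eq; apply/eqP/ord_inj.
have := val_block He; rewrite mul1n => ->; apply/eqP; rewrite eqn_leq h1 andbT -(leq_add2r N).
by rewrite (leq_trans (_ : _ <= (y - x)%R + (x - y)%R)) ?leq_add2l // D Hn e2 mul2n addnn.
Qed.

End Symmetric.

(** * Symmetric forests without a diameter *)

Lemma card_periodic n e N (P : pred nat) : n = e * N ->
  #|[set i : 'I_n | P (i %% N)]| = e * \sum_(0 <= r < N) P r.
Proof.
move=> Hn; transitivity (\sum_(0 <= i < n) P (i %% N)).
  rewrite -sum1_card big_mkord big_mkcond /=; apply: eq_bigr => i _.
  by rewrite inE; case: (P _).
rewrite Hn; elim: (e) => [|d IH]; first by rewrite mul0n big_geq.
have le_d : d * N <= d.+1 * N by rewrite leq_mul.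
rewrite (big_cat_nat (leq0n (d * N)) le_d) IH [in RHS]mulSn [in RHS]addnC.
congr (_ + _); rewrite -{1}[d * N]add0n big_addn mulSn addnK.
rewrite big_nat [RHS]big_nat; apply: eq_bigr => i /andP[_ iN].
by rewrite addnC modnMDl modn_small.
Qed.

Section Blocks.
Variables n' N e : nat.
Local Notation n := n'.+1.
Hypotheses (Hn : n = e * N) (He : 1 < e).
Implicit Types (G : graph n) (x y i : 'I_n) (E : {set 'I_n * 'I_n}).

Let N_gt0 : 0 < N. Proof. by case: N Hn => //; rewrite muln0. Qed.
Let N2_le : N + N <= n. Proof. by rewrite Hn addnn -mul2n leq_mul2r He orbT. Qed.

Definition pt (t r : nat) : 'I_n := inord (r + t * N).

(** Each block [[t N, t N + N - 1]] receives a copy of [E]; if [E] lives on [[0, N-1]], no chord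
    leaves its block, so the arcs between blocks are central. *)
Definition blow E : {set 'I_n * 'I_n} :=
  [set (pt tp.1 tp.2.1, pt tp.1 tp.2.2) | tp : 'I_e * ('I_n * 'I_n) in setX [set: 'I_e] E].

Lemma block_lt t t' r : t < t' -> r < N -> r + t * N < t' * N.
Proof. by move=> tt' rN; apply: (@leq_trans (t.+1 * N)); rewrite ?leq_mul2r ?tt' ?orbT // mulSn ltn_add2r. Qed.

Lemma val_pt t r : r < N -> t < e -> pt t r = r + t * N :> nat.
Proof. by move=> rN te; rewrite inordK // Hn; apply: block_lt. Qed.

Lemma blowP E x y : linear_forest 0 N.-1 E ->
  reflect (exists t (p : 'I_n * 'I_n), [/\ t < e, p \in E, x = p.1 + t * N :> nat
             & y = p.2 + t * N :> nat])
          ((x, y) \in blow E).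
Proof.
move=> [h1 _ _]; apply: (iffP imsetP) => [[[t p]]|[t [p [te pE Ex Ey]]]].
  rewrite !inE /= => pE [-> ->]; exists t, p; have [_ ? ?] := h1 p pE.
  by split=> //; rewrite val_pt //; lia.
exists (Ordinal te, p); first by rewrite !inE.
have [_ ? ?] := h1 p pE.
by congr (_, _); apply: ord_inj; rewrite val_pt //=; lia.
Qed.

(** * Symmetric forests from copies of a linear forest *)

Section Blow.
Variable E : {set 'I_n * 'I_n}.
Hypothesis lE : linear_forest 0 N.-1 E.

Let EN (p : 'I_n * 'I_n) : p \in E -> p.1 < p.2 /\ p.2 < N.
Proof. by case: lE => h1 _ _ /h1[_ ? ?]; split=> //; lia. Qed.

Lemma blow_linear : linear_forest 0 n.-1 (blow E).
Proof.
have [h1 h2 h3] := lE; split.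
- case=> x y /= /(blowP _ _ lE)[t [p [te pE Ex Ey]]]; have [p12 _] := EN pE.
  by split=> //; have := ltn_ord y; lia.
- case=> x y [z u] /= /(blowP _ _ lE)[t [p [te pE Ex Ey]]].
  case/(blowP _ _ lE) => t' [q [te' qE Ez Eu]] a1 a2 a3.
  have [p12 pN] := EN pE; have [q12 qN] := EN qE.
  have Et : t = t'.
    case: (ltngtP t t') => // tt.
      by have := block_lt tt pN; lia.
    by have := @block_lt _ _ q.1 tt; lia.
  by rewrite -Et in Ez Eu; apply: (h2 p q) => //; lia.
- case=> x y /= /(blowP _ _ lE)[t [p [te pE Ex Ey]]].
  have [i [i1 i2 hi]] := h3 p pE; have [p12 pN] := EN pE.
  exists (i + t * N); split; [lia|lia|].
  case=> z u /= /(blowP _ _ lE)[t' [q [te' qE Ez Eu]]] a1 a2 a3 a4.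
  have [q12 qN] := EN qE.
  have Et : t = t'.
    case: (ltngtP t t') => // tt.
      by have := @block_lt _ _ p.2 tt pN; lia.
    by have := @block_lt _ _ q.2 tt qN; lia.
  rewrite -Et in Ez Eu.
  have Eq : q = p by apply: hi => //; lia.
  by rewrite Eq in Ez Eu; congr (_, _); apply: ord_inj; lia.
Qed.

Lemma blow_ordered : ordered (blow E).
Proof. by move=> p; case: blow_linear => h1 _ _ /h1[]. Qed.

Lemma pt_inj (t t' : 'I_e) (p q : 'I_n * 'I_n) : p \in E -> q \in E ->
  (pt t p.1, pt t p.2) = (pt t' q.1, pt t' q.2) -> (t, p) = (t', q).
Proof.
move=> pE qE [E1 E2]; have [p12 pN] := EN pE; have [q12 qN] := EN qE.
have := congr1 (@nat_of_ord _) E1; have := congr1 (@nat_of_ord _) E2.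
rewrite !val_pt //; try lia; move=> {E1 E2} E2 E1.
have Et : t = t' :> nat.
  case: (ltngtP t t') => // tt.
    by have := @block_lt _ _ p.2 tt pN; lia.
  by have := @block_lt _ _ q.2 tt qN; lia.
rewrite Et in E1 E2; congr (_, _); first exact: ord_inj.
case: p q E1 E2 {pE qE p12 pN q12 qN} => [a b] [c d] /= E1 E2.
by congr (_, _); apply: ord_inj; lia.
Qed.

Lemma card_blow : #|blow E| = e * #|E|.
Proof.
rewrite card_in_imset ?cardsX ?cardsT ?card_ord // => -[t p] [t' q].
by rewrite !inE /= => pE qE; apply: pt_inj.
Qed.

Let G := downs (blow E).

Lemma ups_blow : ups G = blow E.
Proof. exact/upsK/blow_ordered. Qed.

Lemma forest_blow : forest G.
Proof.
apply/forestP; rewrite ups_blow; split; last exact: blow_linear.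
exact/simple_downs/blow_ordered.
Qed.

Lemma card_blow_graph : #|G| = e * #|E|.
Proof. by rewrite card_downs ?card_blow //; apply: blow_ordered. Qed.

Lemma symmetric_blow : symmetric_graph N G.
Proof.
rewrite /symmetric_graph eqEcard card_act leqnn andbT.
apply/subsetP => f /imsetP[f' /imsetP[[x y] xyE ->] ->] /=.
rewrite imsetU1 imset_set1 !rho_expE.
have [t [p [te pE Ex Ey]]] := blowP x y lE xyE; have [p12 pN] := EN pE.
have := ltn_ord y => ly.
have N_lt : N < n by lia.
have vN : (inZp N : 'I_n) = N :> nat by rewrite /= modn_small.
pose t' := if t.+1 < e then t.+1 else 0.
have te' : t' < e by rewrite /t'; case: ifP => //; lia.
have sh (z : 'I_n) r : r < N -> z = r + t * N :> nat -> (z + inZp N)%R = r + t' * N :> nat.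
  move=> rN Ez; rewrite val_addZ vN Ez /t'; case: (ltnP t.+1 e) => h.
    rewrite -addnA [t * N + N]addnC -mulSn.
    by rewrite ifT // Hn; apply: block_lt.
  have Ete : t.+1 = e by apply/eqP; rewrite eqn_leq h te.
  have -> : r + t * N + N = r + n by rewrite Hn -Ete mulSn; lia.
  by rewrite mul0n addn0 addnK; case: ifP => //; lia.
apply/imsetP; exists ((x + inZp N)%R, (y + inZp N)%R) => //=.
by apply/(blowP _ _ lE); exists t', p; split=> //; apply: sh => //; lia.
Qed.

Lemma short_blow x y : short N G x y = ((x, y) \in blow E).
Proof.
apply/idP/idP => [/andP[]|xyE]; last first.
  rewrite /short adj_downs xyE orTb andTb; have [t [p [te pE Ex Ey]]] := blowP x y lE xyE.
  by have [p12 pN] := EN pE; rewrite val_subZ; case: (leqP x y); lia.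
rewrite adj_downs => /orP[//|yxE]; have [t [p [te pE Ex Ey]]] := blowP y x lE yxE.
have [p12 pN] := EN pE; have := ltn_ord x; rewrite val_subZ; case: (leqP x y); lia.
Qed.

Lemma all_short_blow : all_short N G.
Proof. by apply/all_shortP => x y; rewrite !short_blow adj_downs => /orP. Qed.

Lemma central_blow i : central N G i = ~~ covered E (i %% N).
Proof.
have li := ltn_ord i.
apply/centralP/idP => [c|nc x y]; last first.
  rewrite short_blow => /(blowP _ _ lE)[t [p [te pE Ex Ey]]]; have [p12 pN] := EN pE.
  have ly := ltn_ord y.
  rewrite !val_subZ; case: (leqP x y) => h; last by lia.
  case: (leqP x i) => h'; last by lia.
  rewrite leqNgt; apply: contra nc => h''; apply/coveredP; exists p => //.
  have Ei : i = (i - t * N) + t * N :> nat by lia.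
  have Er : i %% N = i - t * N by rewrite {1}Ei addnC modnMDl modn_small; lia.
  have h3 : p.1 <= i - t * N < p.2 by lia.
  by rewrite Er h3.
apply/negP => /coveredP[p pE /andP[p1 p2]]; have [p12 pN] := EN pE.
pose t := i %/ N; have te : t < e by rewrite ltn_divLR // -Hn.
have Ei : i = i %% N + t * N :> nat by rewrite addnC -divn_eq.
have := c (pt t p.1) (pt t p.2); rewrite short_blow.
have -> : (pt t p.1, pt t p.2) \in blow E.
  by apply/(blowP _ _ lE); exists t, p; split=> //; apply: val_pt => //; lia.
move=> /(_ isT); have v1 := @val_pt t p.1; have v2 := @val_pt t p.2.
by rewrite !val_subZ v1 ?v2 //; try lia;
   case: (leqP _ (p.2 + _)); case: (leqP _ i); lia.
Qed.

Lemma central_blow_max : central N G ord_max.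
Proof.
rewrite central_blow; apply/negP => /coveredP[p /EN[p12 pN] /andP[_]].
have -> : (ord_max : 'I_n) = N.-1 + e.-1 * N :> nat.
  by rewrite /=; case: (e) Hn He => // d; rewrite mulSn; lia.
by rewrite addnC modnMDl modn_small; lia.
Qed.

(** The extra arc in each block leads from its last point to the next block. *)
Lemma card_central_blow : #|[set i | central N G i]| = e * (nfree 0 N.-1 E).+1.
Proof.
rewrite (eq_card (B := [set i : 'I_n | ~~ covered E (i %% N)])); last first.
  by move=> i; rewrite !inE central_blow.
rewrite (card_periodic (fun r => ~~ covered E r) Hn); congr (_ * _).
rewrite -[LHS]/(nfree 0 N E) (@nfree_cat _ 0 N.-1) ?leq_pred // -[RHS]addn1; congr (_ + _).
rewrite /nfree -{2}(prednK N_gt0) big_nat1.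
suff -> : covered E N.-1 = false by [].
by apply: negbTE; apply/negP => /coveredP[p /EN[p12 pN] /andP[_]]; lia.
Qed.

Lemma restrict_blow : [set p : 'I_n * 'I_n in blow E | p.2 < N] = E.
Proof.
apply: eq_pairs => -[x y]; rewrite inE /=; apply/andP/idP => [[]|xyE].
  case/(blowP _ _ lE) => t [p [te pE Ex Ey]] yN; have [p12 pN] := EN pE.
  case: t te Ex Ey => [|t] te Ex Ey; last by rewrite mulSn in Ey; lia.
  suff -> : (x, y) = p by [].
  case: p Ex Ey {pE p12 pN} => a b /= Ex Ey.
  by congr (_, _); apply: ord_inj; lia.
have [/= p12 pN] := EN xyE; split=> //; apply/(blowP _ _ lE).
by exists 0, (x, y); split; rewrite ?mul0n ?addn0 //; lia.
Qed.

End Blow.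

(** By symmetry the rotations of the central arc [ord_max] by multiples of [N] are central too. They
    separate the blocks, so no chord joins two blocks and the first block determines the others. *)
Lemma blow_of_central G : forest G -> symmetric_graph N G -> all_short N G ->
    central N G ord_max ->
  let E := [set p : 'I_n * 'I_n in ups G | p.2 < N] in
  linear_forest 0 N.-1 E /\ downs (blow E) = G.
Proof.
move=> /forestP[sG lG] symG /all_shortP asG cG E.
have lE : linear_forest 0 N.-1 E.
  apply: (linear_forest_sub lG) => [|p].
    by apply/subsetP => p; rewrite inE => /andP[].
  by rewrite inE => /andP[_ pN]; split=> //; lia.
split=> //; rewrite -[RHS](downsK sG); congr downs; apply: eq_pairs => -[x y].
have cB t : 0 < t < e -> exists2 i : 'I_n, i = (t * N).-1 :> nat & central N G i.
  move=> /andP[t_gt0 te]; have lt_t : t * N < n by rewrite Hn ltn_pmul2r.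
  have tN_gt0 : 0 < t * N by rewrite muln_gt0 t_gt0.
  exists (ord_max + inZp (t * N))%R.
    by rewrite val_addZ (val_block Hn) //= ifF; lia.
  have {1}<- : rotate (t * N) G = G; last by rewrite central_rotate.
  elim: (t) => [|u IH]; rewrite ?rotate0 // mulSn -rotateD.
  by rewrite (eqP symG).
apply/(blowP _ _ lE)/idP.
  case=> t [p [te]]; rewrite !inE => /andP[/andP[p12 pG] pN] Ex Ey.
  rewrite -[_ \in G]/(adj G x y).
  have -> : x = (p.1 + inZp (t * N))%R.
    by apply: ord_inj; rewrite val_addZ (val_block Hn) // -Ex ltn_ord.
  have -> : y = (p.2 + inZp (t * N))%R.
    by apply: ord_inj; rewrite val_addZ (val_block Hn) // -Ey ltn_ord.
  rewrite (symmetric_adj _ _ _ symG) [adj _ _ _]pG andbT /=.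
  have lx := ltn_ord x; have ly := ltn_ord y.
  by rewrite !modn_small; lia.
rewrite mem_ups => /andP[xy aG]; have lx := ltn_ord x; have ly := ltn_ord y.
have sxy : short N G x y.
  case: (asG x y aG) => // syx; exfalso; have := centralP _ _ _ cG _ _ syx.
  by rewrite !val_subZ -[nat_of_ord ord_max]/n'; case: (leqP y x); case: (leqP y n'); lia.
have Eq : x %/ N = y %/ N.
  apply/eqP; rewrite eqn_leq leq_div2r ?(ltnW xy) //= leqNgt; apply/negP => lt_q.
  have [|i Ei ci] := cB (y %/ N).
    by rewrite (leq_trans _ lt_q) // ltn_divLR // -Hn.
  have := centralP _ _ _ ci _ _ sxy.
  have h1 : x < y %/ N * N by rewrite -ltn_divLR.
  have h2 := leq_trunc_div y N.
  by rewrite !val_subZ Ei; case: (leqP x y); case: (leqP x (y %/ N * N).-1); lia.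
have Exd := divn_eq x N; have Eyd := divn_eq y N; rewrite Eq in Exd.
have rx := ltn_pmod x N_gt0; have ry := ltn_pmod y N_gt0.
have te : y %/ N < e by rewrite ltn_divLR // -Hn.
have v1 : (inord (x %% N) : 'I_n) = x %% N :> nat by rewrite inordK //; lia.
have v2 : (inord (y %% N) : 'I_n) = y %% N :> nat by rewrite inordK //; lia.
exists (y %/ N), (inord (x %% N), inord (y %% N)); split=> //=.
- rewrite inE mem_ups /= v1 v2 ry andbT; apply/andP; split; first by lia.
  rewrite -(symmetric_adj (y %/ N) _ _ symG).
  have -> : (inord (x %% N) + inZp (y %/ N * N))%R = x :> 'I_n.
    by apply: ord_inj; rewrite val_addZ (val_block Hn) // v1 ifT; lia.
  have -> : (inord (y %% N) + inZp (y %/ N * N))%R = y :> 'I_n.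
    by apply: ord_inj; rewrite val_addZ (val_block Hn) // v2 ifT; lia.
  by [].
- by rewrite v1; lia.
- by rewrite v2; lia.
Qed.

End Blocks.

Section SymmetricCount.
Variables n' N e : nat.
Local Notation n := n'.+1.
Hypotheses (Hn : n = e * N) (He : 1 < e).
Implicit Types (G : graph n) (x y i : 'I_n) (E : {set 'I_n * 'I_n}).

Let N_gt0 : 0 < N. Proof. by case: N Hn => //; rewrite muln0. Qed.

Definition sym_forest G := [&& forest G, symmetric_graph N G & all_short N G].

Definition ncentral G := #|[set i | central N G i]|.

Lemma ncentral_rotate d G : ncentral (rotate d G) = ncentral G.
Proof.
rewrite /ncentral -(card_imset (mem [set i | central N G i]) (addIr (inZp d : 'I_n))).
apply: eq_card => i; apply/idP/imsetP => [|[k]]; rewrite !inE.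
  by move=> ci; exists (i - inZp d)%R; rewrite ?inE ?subrK // -(central_rotate N d) subrK.
by move=> ck ->; rewrite central_rotate.
Qed.

Lemma sym_forest_rotate d G : sym_forest G -> sym_forest (rotate d G).
Proof.
case/and3P => fG sG aG; apply/and3P.
by split; [apply: forest_rotate|apply: symmetric_rotate|apply: all_short_rotate].
Qed.

Let S m j : {set graph n} :=
  [set G | [&& sym_forest G, #|G| == e * m & ncentral G == e * j.+1]].

Lemma card_central_le m j i k :
  #|[set G in S m j | central N G i]| <= #|[set G in S m j | central N G k]|.
Proof.
have [d dz] : exists d, inZp d = (k - i)%R :> 'I_n.
  by exists ((k - i)%R : 'I_n); apply: valZpK.
rewrite -(card_imset _ (@rotate_inj n' d)); apply: subset_leq_card.
apply/subsetP => G' /imsetP[G]; rewrite !inE => /andP[/and3P[sG cG nG] ciG] ->.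
rewrite sym_forest_rotate // card_act cG ncentral_rotate nG /=.
have -> : k = (i + inZp d)%R by rewrite dz addrC subrK.
by rewrite central_rotate.
Qed.

(** Double counting of pairs (forest, central arc): the rotations make all [n] arcs equivalent. *)
Lemma card_sym_forest_central m j :
  #|S m j| * (e * j.+1) = n * #|[set G in S m j | central N G ord_max]|.
Proof.
transitivity (\sum_(G in S m j) ncentral G).
  rewrite -sum_nat_const; apply: eq_bigr => G.
  by rewrite inE => /and3P[_ _ /eqP].
transitivity (\sum_i #|[set G in S m j | central N G i]|).
  rewrite (eq_bigr (fun G => \sum_(i | central N G i) 1)); last first.
    by move=> G _; rewrite /ncentral -sum1_card; apply: eq_bigl => i; rewrite inE.
  rewrite (exchange_big_dep predT) //=; apply: eq_bigr => i _.
  by rewrite -sum1_card; apply: eq_bigl => G; rewrite !inE.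
rewrite (eq_bigr (fun=> #|[set G in S m j | central N G ord_max]|)) => [|i _].
  by rewrite sum_nat_const card_ord.
by apply/eqP; rewrite eqn_leq !card_central_le.
Qed.

Lemma card_central_max m j :
  #|[set G in S m j | central N G ord_max]|
    = #|[set E : {set 'I_n * 'I_n} | [&& lin 0 N.-1 E, nfree 0 N.-1 E == j & #|E| == m]]|.
Proof.
have e_gt0 : 0 < e by lia.
pose T : {set {set 'I_n * 'I_n}} := [set E | [&& lin 0 N.-1 E, nfree 0 N.-1 E == j & #|E| == m]].
rewrite -(card_in_imset (f := fun E => downs (blow N e E)) (D := T)); last first.
  move=> E F; rewrite !inE => /andP[/linP lE _] /andP[/linP lF _] EF.
  by rewrite -(restrict_blow Hn He lE) -(ups_blow Hn He lE) EF (ups_blow Hn He lF) restrict_blow.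
apply: eq_card => G; apply/idP/imsetP; rewrite !inE.
  case/andP => /and3P[/and3P[fG sG aG] /eqP cG /eqP nG] mG.
  have [lE EG] := blow_of_central Hn He fG sG aG mG.
  set E := [set _ in _ | _] in lE EG; exists E => //.
  have : e * #|E| == e * m by rewrite -(card_blow_graph Hn He lE) EG cG.
  have : e * (nfree 0 N.-1 E).+1 == e * j.+1.
    by rewrite -(card_central_blow Hn He lE) EG -nG.
  rewrite !eqn_pmul2l // eqSS => nE cE.
  by rewrite inE nE cE !andbT; apply/linP.
case=> E; rewrite inE => /and3P[/linP lE /eqP nE /eqP cE] ->.
rewrite /sym_forest (forest_blow Hn He lE) (symmetric_blow Hn He lE) (all_short_blow Hn He lE).
rewrite (card_blow_graph Hn He lE) cE /ncentral (card_central_blow Hn He lE) nE !eqxx.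
by rewrite (central_blow_max Hn He lE).
Qed.

Lemma sym_forest_dvd G : sym_forest G ->
  exists m j, [/\ j < N, #|G| = e * m & ncentral G = e * j.+1].
Proof.
move=> sfG; have /and3P[fG _ _] := sfG.
have [i ci] := central_exists Hn He fG.
have [d dz] : exists d, inZp d = (ord_max - i)%R :> 'I_n.
  by exists ((ord_max - i)%R : 'I_n); apply: valZpK.
have cm : central N (rotate d G) ord_max.
  have -> : ord_max = (i + inZp d)%R by rewrite dz addrC subrK.
  by rewrite central_rotate.
have /and3P[fG' sG' aG'] := sym_forest_rotate d sfG.
have [lE EG] := blow_of_central Hn He fG' sG' aG' cm.
set E := [set _ in _ | _] in lE EG.
exists #|E|, (nfree 0 N.-1 E); split.
- by have := nfree_le 0 N.-1 E; lia.
- by rewrite -(card_act (rho n ^+ d)%g) -/(rotate d G) -EG (card_blow_graph Hn He lE).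
- by rewrite -(ncentral_rotate d) -EG /ncentral (card_central_blow Hn He lE).
Qed.

Lemma card_sym_forest (m : nat) :
  (#|[set G | sym_forest G && (#|G| == e * m)]|%:R
    = \sum_(j < N) N%:R / j.+1%:R * hcoef j.+1 m (N - j.+1) :> rat)%R.
Proof.
have -> : #|[set G | sym_forest G && (#|G| == e * m)]| = \sum_(j < N) #|S m j|.
  rewrite -sum1_card.
  under [RHS]eq_bigr do rewrite -sum1_card big_mkcond.
  rewrite exchange_big big_mkcond /=; apply: eq_bigr => G _; rewrite inE.
  under eq_bigr do rewrite inE andbA.
  case: ifP => [/andP[sfG _]|_] /=; last by rewrite big1.
  have [_ [j [jN _ nG]]] := sym_forest_dvd sfG.
  rewrite (bigD1 (Ordinal jN)) //= nG eqxx big1 ?addn0 // => k nk.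
  rewrite eqn_pmul2l; last by lia.
  by rewrite eqSS; case: eqP => // Ek; case/eqP: nk; apply: ord_inj.
rewrite natr_sum; apply: eq_bigr => j _; have jN := ltn_ord j.
have nz a : (a.+1%:R != 0 :> rat)%R by rewrite pnatr_eq0.
have E1 := card_sym_forest_central m j; rewrite card_central_max in E1.
have := @card_lin n j m 0 N.-1; rewrite subn0 => E2.
have N_le : N <= n by rewrite Hn leq_pmull; lia.
have {}E2 := E2 isT ltac:(lia) ltac:(lia).
have -> : N - j.+1 = N.-1 - j by lia.
rewrite -E2; have e_neq0 : (e%:R != 0 :> rat)%R by rewrite pnatr_eq0; lia.
have nE : (n%:R = e%:R * N%:R :> rat)%R by rewrite Hn natrM.
have := congr1 (fun x : nat => (x%:R : rat)%R) E1; rewrite !natrM nE.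
set a := (#|S m j|%:R)%R; set b := (#|_|%:R)%R => E3.
apply: (mulIf (nz j)); apply: (mulIf e_neq0); rewrite -[LHS]mulrA [(j.+1%:R * _)%R]mulrC E3.
by move: (j.+1%:R : rat)%R (nz j) => u nu; field.
Qed.

End SymmetricCount.

(** * Symmetric forests with a diameter *)

Section Diameter.
Variables n' N : nat.
Local Notation n := n'.+1.
Hypothesis Hn : n = 2 * N.
Implicit Types (G H : graph n) (x y z t i : 'I_n) (E : {set 'I_n * 'I_n}).

Let N_gt0 : 0 < N. Proof. by case: N Hn. Qed.
Let N_lt : N < n. Proof. by rewrite Hn mul2n -addnn -[X in X < _]add0n ltn_add2r. Qed.
Let nN : n = N + N. Proof. by rewrite Hn mul2n addnn. Qed.

Definition opp : 'I_n := inZp N.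

Lemma val_opp : opp = N :> nat. Proof. by rewrite /= modn_small. Qed.

Lemma opp2 : (opp + opp = 0)%R.
Proof. by apply: ord_inj; rewrite val_addZ val_opp -nN ltnn subnn. Qed.

Lemma oppN : (- opp = opp)%R.
Proof. by apply/eqP; rewrite eq_sym -addr_eq0 opp2. Qed.

Lemma val_addopp x : (x + opp)%R = (if x < N then x + N else x - N) :> nat.
Proof.
rewrite val_addZ val_opp; have := ltn_ord x.
by case: (ltnP x N) => h1 h2; [rewrite ifT|rewrite ifF]; lia.
Qed.

Lemma val_addopp_lt x : x < N -> (x + opp)%R = x + N :> nat.
Proof. by move=> h; rewrite val_addopp h. Qed.

Lemma val_addopp_ge x : N <= x -> (x + opp)%R = x - N :> nat.
Proof. by move=> h; rewrite val_addopp ltnNge h. Qed.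

Lemma adj_rotate_opp G x y : adj (rotate N G) x y = adj G (x + opp)%R (y + opp)%R.
Proof. by rewrite adj_rotate -/opp oppN. Qed.

Lemma rotateNN G : rotate N (rotate N G) = G.
Proof. by rewrite rotateD -nN rotate_n. Qed.

Definition diameter : {set 'I_n} := [set 0%R; opp].

(** Both halves contain the two ends of the diameter, hence have [N+1] points and [N] arcs; the
    blocks used without a diameter have only [N] points. *)
Definition double E : graph n := diameter |: (downs E :|: rotate N (downs E)).

Definition halve G : {set 'I_n * 'I_n} :=
  [set p : 'I_n * 'I_n in ups G | (p.2 <= N) && (p != (0%R, opp))].

Lemma diameter_eq x y : [set x; y] = diameter -> x < y -> x = 0%R /\ y = opp.
Proof.
move=> Exy xy; suff [-> ->] : (x, y) = ((0%R : 'I_n), opp) by [].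
by apply: set2_inj_lt; rewrite ?val_opp.
Qed.

Lemma diameter_mem x y : [set x; y] = diameter ->
  (x = 0 :> nat \/ x = N :> nat) /\ (y = 0 :> nat \/ y = N :> nat).
Proof.
move=> Exy; have : x \in diameter by rewrite -Exy set21.
have : y \in diameter by rewrite -Exy set22.
by rewrite !inE => /orP[] /eqP-> /orP[] /eqP->; rewrite ?val_opp; split; auto.
Qed.

(** * Gluing two copies of a half along the diameter *)

Section Double.
Variable E : {set 'I_n * 'I_n}.
Hypotheses (lE : linear_forest 0 N E) (fE : 0 < nfree 0 N E).

Let oE : ordered E. Proof. by move=> p; case: lE => h1 _ _ /h1[]. Qed.
Let sE : simple_edges (downs E). Proof. exact: simple_downs. Qed.

Let fdE : forest (downs E).
Proof.
apply/forestP; split=> //; rewrite upsK //.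
apply: (linear_forest_sub lE) => // p pE; split=> //.
by have := ltn_ord p.2; lia.
Qed.

Let low x y : adj (downs E) x y -> x <= N /\ y <= N.
Proof.
have [h1 _ _] := lE.
by rewrite adj_downs => /orP[] /h1 /= [_ ? ?]; split; lia.
Qed.

Let high x y : adj (rotate N (downs E)) x y ->
  (x = 0 :> nat \/ N <= x) /\ (y = 0 :> nat \/ N <= y).
Proof.
rewrite adj_rotate_opp => /low[]; rewrite !val_addopp.
by case: (ltnP x N) => hx; case: (ltnP y N) => hy; lia.
Qed.

Lemma mem_double x y : [set x; y] \in double E ->
  [\/ [set x; y] = diameter, adj (downs E) x y | adj (rotate N (downs E)) x y].
Proof.
by rewrite !inE => /orP[/eqP->|/orP[]]; [constructor 1|constructor 2|constructor 3].
Qed.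

Let free_arc : exists2 u : nat, u < N & forall x y, adj (downs E) x y -> x <= u -> u < y -> False.
Proof.
have /nfree_gt0P[u /andP[_ uN] nu] := fE; exists u => // x y.
rewrite adj_downs => /orP[xyE|yxE] xu uy.
  by case/negP: nu; apply/coveredP; exists (x, y); rewrite //= xu.
have /= := oE yxE; lia.
Qed.

Let nlb : ((0%R : 'I_n), opp) \notin E.
Proof.
have [u uN nu] := free_arc; apply/negP => h; apply: (nu 0%R opp) => //.
  by rewrite adj_downs h.
by rewrite val_opp.
Qed.

Let ndiam_low : diameter \notin downs E.
Proof.
rewrite -[_ \in _]/(adj (downs E) 0%R opp) adj_downs (negPf nlb) /=.
by apply/negP => /oE; rewrite /= modn_small.
Qed.

Let rot_diameter : (rho n ^+ N)%g @: diameter = diameter.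
Proof. by rewrite imsetU1 imset_set1 !rho_expE -/opp add0r opp2 setUC. Qed.

Let ndiam_high : diameter \notin rotate N (downs E).
Proof. by rewrite -rot_diameter mem_act ndiam_low. Qed.

Lemma simple_double : simple_edges (double E).
Proof.
apply/forall_inP => f; rewrite !inE => /orP[/eqP->|/orP[]].
- have nd : (0%R : 'I_n) != opp.
    by apply/eqP => /(congr1 (@nat_of_ord _)); rewrite val_opp /=; lia.
  by rewrite cards2 nd.
- by move/forall_inP: sE; apply.
- by have /forall_inP h := simple_act (rho n ^+ N)%g sE; apply: h.
Qed.

Lemma non_crossing_double : non_crossing (double E).
Proof.
have /and3P[_ /non_crossingP nc1 _] := fdE.
have /and3P[_ /non_crossingP nc2 _] := forest_rotate N fdE.
apply/non_crossingP => a b c d /mem_double ab /mem_double cd h1 h2 h3.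
have pos x y : [\/ [set x; y] = diameter, adj (downs E) x y | adj (rotate N (downs E)) x y] ->
  [\/ adj (downs E) x y, adj (rotate N (downs E)) x y |
    (x = 0 :> nat \/ x = N :> nat) /\ (y = 0 :> nat \/ y = N :> nat)].
  by case=> [/diameter_mem ?|?|?]; [constructor 3|constructor 1|constructor 2].
case: (pos _ _ ab) => hab; case: (pos _ _ cd) => hcd.
- exact: nc1 hab hcd h1 h2 h3.
- by have [? ?] := low hab; have [? ?] := high hcd; lia.
- by have [? ?] := low hab; lia.
- by have [? ?] := high hab; have [? ?] := low hcd; lia.
- exact: nc2 hab hcd h1 h2 h3.
- by have [? ?] := high hab; lia.
- by have [? ?] := low hcd; lia.
- by have [? ?] := high hcd; lia.
- by lia.
Qed.

(* Every cut is the union of two arcs: an arc directly below the chosen edge and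
   the antipode of an arc adjacent to the diameter. *)
Lemma acyclic_double : acyclic (double E).
Proof.
have [u uN nu] := free_arc.
have cross_high z t (i : nat) : i < N -> adj (rotate N (downs E)) z t ->
    i < z <= u + N -> ~~ (i < t <= u + N) -> False.
  move=> iN zt zX tX; have [hz ht] := high zt; rewrite adj_rotate_opp in zt.
  have lz := ltn_ord z; have lt := ltn_ord t.
  have Nz : N <= z by lia.
  apply: (nu _ _ zt); first by rewrite val_addopp_ge //; lia.
  case: ht => ht; first by rewrite val_addopp_lt; lia.
  by rewrite val_addopp_ge //; lia.
have sym z t : adj (downs E) z t -> adj (downs E) t z by rewrite adj_sym.
apply: acyclic_cuts => H /subsetP HD H0.
have [dH|ndH] := boolP (diameter \in H).
  exists opp, 0%R, [set v : 'I_n | u < v <= u + N].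
  rewrite !inE val_opp uN leq_addl /= setUC; split=> // z t ztH; rewrite !inE => zX tX.
  case: (mem_double (HD _ ztH)) => [-> //|zt|zt]; last by case: (cross_high z t u).
  have [_ tN] := low zt; case: (nu t z (sym _ _ zt)); last by case/andP: zX.
  by rewrite leqNgt; apply: contra tX => ->; rewrite (leq_trans tN (leq_addl _ _)).
have [H1|/set0Pn[f]] := eqVneq (H :&: downs E) set0.
  have HR : H \subset rotate N (downs E).
    apply/subsetP => f fH; have := HD f fH; rewrite !inE => /orP[/eqP Ef|/orP[fE'|//]].
      by rewrite -Ef fH in ndH.
    by have : f \in H :&: downs E by [rewrite inE fH]; rewrite H1 inE.
  have HR' : rotate N H \subset downs E.
    by rewrite -[downs E]rotateNN; apply: imsetS.
  have HR0 : rotate N H != set0.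
    by rewrite -card_gt0 card_act card_gt0.
  have lE' : linear_forest 0 N (ups (downs E)) by rewrite upsK.
  have [x [y [i [xyH xi iy uniqi]]]] := linear_cut sE lE' HR' HR0.
  exists (x + opp)%R, (y + opp)%R, [set v : 'I_n | (v + opp)%R <= i].
  rewrite !inE -!addrA opp2 !addr0 xi -ltnNge iy; split=> //.
    by rewrite -[_ \in H]/(adj H _ _) -adj_rotate_opp.
  move=> z t ztH; rewrite !inE -ltnNge => zi it.
  have [|<- <-] := uniqi (z + opp)%R (t + opp)%R _ zi it.
    by rewrite -[_ \in _]/(adj _ _ _) adj_rotate_opp -!addrA opp2 !addr0.
  by rewrite -!addrA opp2 !addr0.
rewrite inE => /andP[fH fE'].
have lE' : linear_forest 0 N (ups (downs E)) by rewrite upsK.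
have [||x [y [i [xyH xi iy uniqi]]]] := linear_cut (H := H :&: downs E) sE lE'.
- exact: subsetIr.
- by apply/set0Pn; exists f; rewrite inE fH.
have [xyH' xyE] : [set x; y] \in H /\ adj (downs E) x y by apply/andP; rewrite -in_setI.
have [xN yN] := low xyE.
exists y, x, [set v : 'I_n | i < v <= u + N].
split; [rewrite setUC; exact: xyH' | | |].
- by rewrite inE iy (leq_trans yN (leq_addl _ _)).
- by rewrite inE ltnNge xi.
move=> z t ztH; rewrite [_ \in finset _]inE => zX; rewrite inE => tX; rewrite [RHS]setUC.
case: (mem_double (HD _ ztH)) => [Ezt|zt|zt].
- by rewrite -Ezt ztH in ndH.
- have [zN tN] := low zt.
  have [-> ->] : t = x /\ z = y; last by rewrite setUC.
  have tzH : [set t; z] \in H :&: downs E by rewrite in_setI setUC ztH; exact: zt.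
  have ti : t <= i.
    by rewrite leqNgt; apply: contra tX => ->; rewrite (leq_trans tN (leq_addl _ _)).
  have iz : i < z by case/andP: zX.
  exact: (uniqi t z tzH ti iz).
- by case: (cross_high z t i (leq_trans iy yN) zt zX tX).
Qed.

Lemma forest_double : forest (double E).
Proof. by apply/and3P; split; [exact: simple_double|exact: non_crossing_double|exact: acyclic_double]. Qed.

Lemma symmetric_double : symmetric_graph N (double E).
Proof.
rewrite /symmetric_graph /rotate /act_graph /double imsetU1 rot_diameter imsetU.
by rewrite -!/(act_graph _ _) -!/(rotate _ _) rotateNN [X in _ |: X]setUC.
Qed.

Lemma card_double : #|double E| = (#|E|.*2).+1.
Proof.
have d0 : downs E :&: rotate N (downs E) = set0.
  apply/setP => f; rewrite !inE; apply/negP => /andP[f1 f2].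
  have /cards2P[x [y [nxy Ef]]] : #|f| == 2 by move/forall_inP: sE; apply.
  wlog xy : x y nxy Ef / x < y.
    move=> W; have [h|h] : x < y \/ y < x by move: nxy; rewrite -val_eqE /=; lia.
      exact: (W x y).
    by apply: (W y x); rewrite 1?eq_sym // setUC.
  rewrite Ef in f1 f2; have [? ?] := low f1; have [? ?] := high f2.
  case/negP: ndiam_low; suff -> : diameter = [set x; y] by [].
  by congr [set _; _]; apply: ord_inj; rewrite ?val_opp /=; lia.
rewrite /double cardsU1 cardsU d0 cards0 subn0 card_act card_downs // addnn.
by rewrite inE (negPf ndiam_low) (negPf ndiam_high).
Qed.

Lemma halve_double : halve (double E) = E.
Proof.
apply: eq_pairs => -[x y]; rewrite inE mem_ups /=; apply/idP/idP.
  case/andP => /andP[xy /mem_double xyD] /andP[yN nxy].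
  case: xyD => [/diameter_eq/(_ xy)[Ex Ey]|xyE|/high hxy].
  - by rewrite Ex Ey eqxx in nxy.
  - by move: xyE; rewrite adj_downs => /orP[//|/oE /=]; lia.
  - case/eqP: nxy; congr (_, _); apply: ord_inj; rewrite ?val_opp /=; lia.
move=> xyE; have [h1 _ _] := lE; have /= [_ -> ->] := h1 _ xyE.
have -> : adj (double E) x y.
  by rewrite /adj !inE -[_ \in downs E]/(adj _ _ _) adj_downs xyE !orbT.
by apply: contraNneq nlb => <-.
Qed.

End Double.

Lemma doubleK G : forest G -> symmetric_graph N G -> adj G 0%R opp ->
  [/\ linear_forest 0 N (halve G), 0 < nfree 0 N (halve G) & double (halve G) = G].
Proof.
move=> fG symG d0; have /forestP[sG lG] := fG; have [h1 h2 h3] := lG.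
have up0 : ((0%R : 'I_n), opp) \in ups G by rewrite mem_ups d0 val_opp andbT.
have lH : linear_forest 0 N (halve G).
  apply: (linear_forest_sub lG) => [|p].
    by apply/subsetP => p; rewrite inE => /andP[].
  by rewrite inE => /and3P[_ ? _].
have fH : 0 < nfree 0 N (halve G).
  have [i [_ i2 hi]] := h3 _ up0; rewrite val_opp in i2 hi.
  apply/nfree_gt0P; exists i => //; apply/negP => /coveredP[p].
  rewrite inE => /and3P[pG pN np] /andP[p1 p2].
  by case/eqP: np; apply: hi.
have oH : ordered (halve G) by move=> p; case: lH => k1 _ _ /k1[].
have sym x y : adj G (x + opp)%R (y + opp)%R = adj G x y.
  by have := symmetric_adj 1 x y symG; rewrite mul1n.
split=> //; apply: graph_eq => //; first exact: simple_double.
have subG x y : adj (downs (halve G)) x y -> adj G x y.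
  rewrite adj_downs => /orP[]; rewrite inE mem_ups => /andP[/andP[_ xy] _] //.
  by rewrite adj_sym.
have main x y : x < y -> adj G x y -> adj (double (halve G)) x y.
  move=> xy xyG; rewrite /adj !inE.
  have ly := ltn_ord y.
  have [yN|Ny] := leqP y N.
    have [Exy|nxy] := eqVneq (x, y) ((0%R : 'I_n), opp); first by case: Exy => -> ->; rewrite eqxx.
    rewrite -[_ \in downs _]/(adj _ _ _) adj_downs inE mem_ups xy xyG yN nxy.
    by rewrite !orbT.
  suff h : adj (rotate N (downs (halve G))) x y by rewrite [_ \in rotate _ _]h !orbT.
  rewrite adj_rotate_opp adj_downs; have vy := val_addopp_ge (ltnW Ny).
  have [Nx|xN] := leqP N x; apply/orP; [left|right].
    have vx := val_addopp_ge Nx; rewrite inE mem_ups sym xyG vx vy.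
    have -> : x - N < y - N by lia.
    have -> : y - N <= N by lia.
    apply/eqP => /(congr1 (fun p : 'I_n * 'I_n => nat_of_ord p.2)).
    by rewrite -[LHS]/(nat_of_ord (y + opp)%R) vy -[RHS]/(nat_of_ord opp) val_opp; lia.
  have x0 : x = 0%R.
    apply: ord_inj => /=; apply/eqP; rewrite -leqn0 leqNgt; apply/negP => x_gt0.
    have xyU : (x, y) \in ups G by rewrite mem_ups xy.
    by apply: (h2 _ _ up0 xyU); rewrite ?val_opp.
  have yo : adj G (y + opp)%R opp by rewrite adj_sym -{1}[opp]add0r sym -x0.
  rewrite x0 add0r inE mem_ups val_opp vy yo leqnn.
  have -> : y - N < N by lia.
  apply/eqP => /(congr1 (fun p : 'I_n * 'I_n => nat_of_ord p.1)).
  by rewrite -[LHS]/(nat_of_ord (y + opp)%R) vy /=; lia.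
move=> x y; apply/idP/idP.
  case/mem_double => [Exy||].
  - have : [set x; y] \in G by rewrite Exy.
    by [].
  - exact: subG.
  - by rewrite adj_rotate_opp => /subG; rewrite sym.
move=> xyG; have [h|h] : x < y \/ y < x.
  by have := simple_adj_neq sG xyG; rewrite -val_eqE /=; lia.
  exact: main.
by rewrite adj_sym; apply: main; rewrite // adj_sym.
Qed.

Definition diam_forest G := [&& forest G, symmetric_graph N G & ~~ all_short N G].

Let He : 1 < 2. Proof. by []. Qed.

Lemma diam_not_short G x : adj G x (x + opp)%R -> ~~ all_short N G.
Proof.
move=> xd; apply/negP => /all_shortP/(_ _ _ xd)[] /andP[_].
  by rewrite addrC addKr val_opp ltnn.
by rewrite opprD addrA subrr add0r oppN val_opp ltnn.
Qed.

Lemma diam_exists G : diam_forest G -> exists x, adj G x (x + opp)%R.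
Proof.
case/and3P => fG sG; case: (boolP [exists x, adj G x (x + opp)%R]) => [/existsP //|/existsPn nd].
case/negP; apply/all_shortP => x y xy.
have [h|[h|[_ Ey]]] := symmetric_edge Hn He fG sG xy; [by left|by right|].
by have := nd x; rewrite -Ey xy.
Qed.

(** Two diameters would cross, so there is only one, found from each of its ends. *)
Lemma diam_card G : diam_forest G -> #|[set x | adj G x (x + opp)%R]| = 2.
Proof.
move=> dG; have [x xd] := diam_exists dG; have /and3P[/forestP[sG [h1 h2 h3]] symG _] := dG.
have ad x' : adj G x' (x' + opp)%R -> adj G (x' + opp)%R (x' + opp + opp)%R.
  by rewrite -addrA opp2 addr0 adj_sym.
have low x' : adj G x' (x' + opp)%R -> exists a : 'I_n,
    [/\ a < N, adj G a (a + opp)%R & x' = a \/ x' = (a + opp)%R].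
  move=> d'; have [lt|ge] := ltnP x' N; first by exists x'; split=> //; left.
  exists (x' + opp)%R; split; [|exact: ad|by right; rewrite -addrA opp2 addr0].
  by rewrite val_addopp_ge //; have := ltn_ord x'; lia.
have [a [aN ad' _]] := low x xd.
have U (b : 'I_n) : b < N -> adj G b (b + opp)%R -> b = a.
  have W (b1 b2 : 'I_n) : b2 < N -> adj G b1 (b1 + opp)%R -> adj G b2 (b2 + opp)%R -> b1 < b2 -> False.
    move=> b2N d1 d2 lt; have b1N := ltn_trans lt b2N.
    have u1 : (b1, (b1 + opp)%R) \in ups G by rewrite mem_ups d1 val_addopp_lt // andbT -[X in X < _]addn0 ltn_add2l.
    have u2 : (b2, (b2 + opp)%R) \in ups G by rewrite mem_ups d2 val_addopp_lt // andbT -[X in X < _]addn0 ltn_add2l.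
    have g2 : b2 < (b1 + opp)%R by rewrite val_addopp_lt // (leq_trans b2N) // leq_addl.
    have g3 : (b1 + opp)%R < (b2 + opp)%R by rewrite !val_addopp_lt // ltn_add2r.
    exact: (h2 _ _ u1 u2 lt g2 g3).
  move=> bN db; apply: ord_inj; case: (ltngtP b a) => // h.
    by case: (W b a).
  by case: (W a b).
have -> : [set x | adj G x (x + opp)%R] = [set a; (a + opp)%R].
  apply/setP => b; rewrite !inE; apply/idP/orP => [db|[] /eqP->] //; last exact: ad.
  have [c [cN dc Eb]] := low b db; have Ec := U c cN dc.
  by case: Eb => ->; rewrite Ec; [left|right].
rewrite cards2; suff -> : a != (a + opp)%R by [].
by apply/eqP => /(congr1 (@nat_of_ord _)); rewrite val_addopp_lt //; lia.
Qed.

Let D M : {set graph n} := [set G | diam_forest G && (#|G| == M)].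

Lemma diam_forest_rotate d G : diam_forest G -> diam_forest (rotate d G).
Proof.
move=> dG; have [x xd] := diam_exists dG; case/and3P: dG => fG sG _.
apply/and3P; split; [exact: forest_rotate|exact: symmetric_rotate|].
by apply: (@diam_not_short _ (x + inZp d)%R); rewrite addrAC adj_rotateD.
Qed.

Lemma card_diam_le M x y :
  #|[set G in D M | adj G x (x + opp)%R]| <= #|[set G in D M | adj G y (y + opp)%R]|.
Proof.
have [d dz] : exists d, inZp d = (y - x)%R :> 'I_n.
  by exists ((y - x)%R : 'I_n); apply: valZpK.
rewrite -(card_imset _ (@rotate_inj n' d)); apply: subset_leq_card.
apply/subsetP => G' /imsetP[G]; rewrite !inE => /andP[/andP[dG cG] xd] ->.
rewrite diam_forest_rotate // card_act cG.
have -> : y = (x + inZp d)%R by rewrite dz addrC subrK.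
by rewrite addrAC adj_rotateD.
Qed.

(** Double counting of pairs (forest, end of its diameter): two ends per forest, and [n = 2 N]
    equivalent positions. *)
Lemma card_diam_double M : #|D M| = N * #|[set G in D M | adj G 0%R opp]|.
Proof.
apply/eqP; rewrite -(eqn_pmul2r (isT : 0 < 2)); apply/eqP.
transitivity (\sum_(G in D M) #|[set x | adj G x (x + opp)%R]|).
  rewrite -sum_nat_const; apply: eq_bigr => G.
  by rewrite inE => /andP[/diam_card-> _].
transitivity (\sum_x #|[set G in D M | adj G x (x + opp)%R]|).
  rewrite (eq_bigr (fun G => \sum_(x | adj G x (x + opp)%R) 1)); last first.
    by move=> G _; rewrite -sum1_card; apply: eq_bigl => i; rewrite inE.
  rewrite (exchange_big_dep predT) //=; apply: eq_bigr => i _.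
  by rewrite -sum1_card; apply: eq_bigl => G; rewrite !inE.
rewrite (eq_bigr (fun=> #|[set G in D M | adj G 0%R opp]|)) => [|i _].
  rewrite sum_nat_const card_ord; move: #|[set G in D M | _]| => c.
  by rewrite Hn -mulnA mulnC.
have -> : [set G in D M | adj G 0%R opp] = [set G in D M | adj G 0%R (0 + opp)%R].
  by rewrite add0r.
by apply/eqP; rewrite eqn_leq !card_diam_le.
Qed.

Lemma card_diam_at0 m :
  #|[set G in D m.*2.+1 | adj G 0%R opp]|
    = #|[set E : {set 'I_n * 'I_n} | [&& lin 0 N E, 0 < nfree 0 N E & #|E| == m]]|.
Proof.
pose T : {set {set 'I_n * 'I_n}} := [set E | [&& lin 0 N E, 0 < nfree 0 N E & #|E| == m]].
rewrite -(card_in_imset (f := double) (D := T)); last first.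
  move=> E F; rewrite !inE => /and3P[/linP lE fE _] /and3P[/linP lF fF _] EF.
  by rewrite -(halve_double lE fE) EF halve_double.
apply: eq_card => G; apply/idP/imsetP; rewrite !inE.
  case/andP => /andP[/and3P[fG sG _] /eqP cG] d0.
  have [lE fE EG] := doubleK fG sG d0; exists (halve G) => //.
  have := card_double lE fE; rewrite EG cG => -[] /double_inj cE.
  by rewrite inE fE -cE eqxx !andbT; apply/linP.
case=> E; rewrite inE => /and3P[/linP lE fE /eqP cE] ->.
have d0 : adj (double E) 0%R opp by rewrite /adj !inE eqxx.
rewrite /diam_forest forest_double // symmetric_double // card_double // cE eqxx d0.
by rewrite (@diam_not_short _ 0%R) // add0r.
Qed.

(** The chords other than the diameter come in antipodal pairs. *)
Lemma diam_forest_odd G : diam_forest G -> odd #|G|.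
Proof.
move=> dG; have [x xd] := diam_exists dG.
have [d dz] : exists d, inZp d = (0 - x)%R :> 'I_n.
  by exists ((0 - x)%R : 'I_n); apply: valZpK.
have d0 : adj (rotate d G) 0%R opp.
  by rewrite adj_rotate dz !sub0r !opprK addrC.
have /and3P[fG sG _] := diam_forest_rotate d dG.
have [lE fE EG] := doubleK fG sG d0.
by rewrite -(card_act (rho n ^+ d)%g) -/(rotate d G) -EG card_double //= odd_double.
Qed.

Lemma card_diam_forest (m : nat) :
  (#|[set G | diam_forest G && (#|G| == m.*2.+1)]|%:R
    = N%:R * \sum_(j < N) hcoef j.+2 m (N - j.+1) :> rat)%R.
Proof.
rewrite -/(D _) card_diam_double card_diam_at0 natrM; congr (_ * _)%R.
pose T j : {set {set 'I_n * 'I_n}} :=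
  [set E | [&& lin 0 N E, nfree 0 N E == j & #|E| == m]].
transitivity ((\sum_(j < N) #|T j.+1|)%:R : rat)%R.
  congr (_%:R)%R; rewrite -sum1_card.
  under [RHS]eq_bigr do rewrite -sum1_card big_mkcond.
  rewrite exchange_big big_mkcond /=; apply: eq_bigr => E _; rewrite inE.
  under eq_bigr do rewrite inE.
  case: (lin 0 N E); last by rewrite big1.
  case: (#|E| == m); last by rewrite andbF big1 // => j _; rewrite andbF.
  under eq_bigr do rewrite /= andbT.
  rewrite /= andbT; case: posnP => [->|f_gt0]; first by rewrite big1.
  have lt_f : (nfree 0 N E).-1 < N by have := nfree_le 0 N E; lia.
  rewrite (bigD1 (Ordinal lt_f)) //= prednK // eqxx big1 ?addn0 // => j nj.
  by case: eqP => // Ef; case/eqP: nj; apply: ord_inj; rewrite /= Ef.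
rewrite natr_sum; apply: eq_bigr => j _; have jN := ltn_ord j.
by rewrite (@card_lin n j.+1 m 0 N) ?subn0 //.
Qed.

End Diameter.

(** * Cyclic sieving *)

Lemma card_NCF_nat n k : 0 < n -> 0 < k -> k <= n ->
  #|NCF n k| * (2 * n - k) = 'C(n, k - 1) * 'C(3 * n - 2 * k - 1, n - k).
Proof.
move=> n_gt0 k_gt0 le_kn; apply/eqP; rewrite -(@eqr_nat rat) !natrM card_NCF //.
have [m Em] : exists m, n = k + m by exists (n - k); lia.
have -> : n - k = m by lia.
(* The case without edges, [k = n], is separate because the summed formula requires [m > 0]; only
   the last term of the sum survives. *)
case: m Em => [|m] Em.
  case: n n_gt0 le_kn Em => // n _ le_kn Em; rewrite big_ord_recr /= subnn big1 => [|i _].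
    have -> : k = n.+1 by lia.
    rewrite bin0 mulr1 add0r mul1r subn1 /= binSn; apply/eqP; congr (_%:R)%R; lia.
  by have lt_i := ltn_ord i; rewrite subSS; case E: (n - i) => //; exfalso; lia.
have nz : (m.+1%:R != 0 :> rat)%R by rewrite pnatr_eq0.
rewrite -(inj_eq (mulfI nz)) mulrA sum_hcoef_total //; apply/eqP.
have -> : 'C(n, k - 1) = 'C(n, m.+2) by rewrite -bin_sub; [congr 'C(_, _)|]; lia.
rewrite -!natrM; congr (_%:R)%R.
have -> : 3 * n - 2 * k - 1 = n + m.+1.*2 - 1 by lia.
rewrite mulnCA -mulnA mul_bin_left; congr (_ * _); rewrite mulnC /=; congr (_ * _); lia.
Qed.

Lemma card_sym_forest_nat n' N e K : n'.+1 = e * N -> 1 < e -> 0 < K -> K <= N ->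
  #|[set G : graph n'.+1 | sym_forest N G && (#|G| == n'.+1 - e * K)]| * (3 * N - 2 * K)
    = K * 'C(N, K) * 'C(3 * N - 2 * K, N - K).
Proof.
move=> Hn He K_gt0 le_KN.
have [m Em] : exists m, N = K + m by exists (N - K); lia.
have -> : n'.+1 - e * K = e * m by rewrite Hn -mulnBr Em addKn.
have -> : N - K = m by lia.
have -> : 3 * N - 2 * K = N + m.*2 by lia.
apply/eqP; rewrite -(@eqr_nat rat) !natrM (card_sym_forest Hn He).
case: m Em => [|m] Em.
  have -> : K = N by lia.
  have N_gt0 : 0 < N by lia.
  case: N {Hn le_KN Em} N_gt0 => // N _; rewrite big_ord_recr /= subnn big1 => [|i _].
    by rewrite binn bin0 add0r divff ?pnatr_eq0 // !mulr1 mul1r addn0.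
  by have lt_i := ltn_ord i; rewrite subSS; case E: (N - i) => [|?]; [exfalso; lia|rewrite mulr0].
have nz : (m.+1%:R != 0 :> rat)%R by rewrite pnatr_eq0.
rewrite -(inj_eq (mulfI nz)) mulrA sum_hcoef_cyclic // -!natrM; apply/eqP; congr (_%:R)%R.
have E1 : N * 'C(N.-1, m.+1) = K * 'C(N, K).
  have -> : 'C(N.-1, m.+1) = 'C(N.-1, K.-1) by rewrite -bin_sub; [congr 'C(_, _)|]; lia.
  by rewrite mul_bin_diag prednK.
have E2 : (N + m.+1.*2) * 'C(N + m.+1.*2 - 1, m) = m.+1 * 'C(N + m.+1.*2, m.+1).
  by rewrite subn1 mul_bin_diag.
by rewrite E1 -[LHS]mulnA [X in _ * X]mulnC E2 mulnCA.
Qed.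

Lemma card_diam_forest_nat n' N m : n'.+1 = 2 * N ->
  #|[set G : graph n'.+1 | diam_forest N G && (#|G| == m.*2.+1)]|
    = 'C(N, m.+1) * 'C(N + m.*2, m).
Proof.
move=> Hn; apply/eqP; rewrite -(@eqr_nat rat) natrM (card_diam_forest Hn).
by rewrite sum_hcoef_diameter.
Qed.

Section Rho.
Variable n' : nat.
Local Notation n := n'.+1.

Lemma order_rho : #[rho n]%g = n.
Proof.
have rot0 d : (rho n ^+ d = 1)%g -> n %| d.
  move=> /permP/(_ 0%R); rewrite rho_expE perm1 add0r => /(congr1 (@nat_of_ord _)) /= E.
  by rewrite /dvdn E.
apply/eqP; rewrite eqn_dvd rot0 ?expg_order // andbT order_dvdn.
apply/eqP/permP => x; rewrite rho_expE perm1; apply: val_inj.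
by rewrite /= modnn addn0 modn_small.
Qed.

Lemma fixed_cycle (c d : {perm 'I_n}) (G : graph n) :
  d \in <[c]>%g -> act_graph c G = G -> act_graph d G = G.
Proof.
case/cycleP => i ->; elim: i => [|i IH] cG; first by rewrite expg0 act_graph1.
by rewrite expgS act_graphM cG IH.
Qed.

(** In a cyclic group, [c] and the power of [rho] of the same order generate the same subgroup, so
    they fix the same graphs. *)
Lemma n_fixed_rho k (c : {perm 'I_n}) : c \in <[rho n]>%g ->
  n_fixed k c = #|[set G in NCF n k | rotate (n %/ #[c]%g) G == G]|.
Proof.
move=> cr; have dvd_e : #[c]%g %| n by have := order_dvdG cr; rewrite -orderE order_rho.
have dvd_N : n %/ #[c]%g %| #[rho n]%g.
  by rewrite order_rho dvdn_div.
have E : <[c]>%g = <[rho n ^+ (n %/ #[c]%g)]>%g.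
  apply/eqP; rewrite (eq_subG_cyclic (cycle_cyclic (rho n))) ?cycle_subG ?mem_cycle //.
  rewrite -!orderE orderXdiv // order_rho divnA // mulKn //.
apply: eq_card => G; rewrite !inE; congr (_ && _); apply/eqP/eqP.
  by apply: fixed_cycle; rewrite E cycle_id.
by apply: fixed_cycle; rewrite -E cycle_id.
Qed.

Lemma n_fixed_split e k N : n = e * N -> 1 < e -> k <= n ->
  #|[set G in NCF n k | rotate N G == G]|
    = #|[set G : graph n | sym_forest N G && (#|G| == n - k)]|
    + #|[set G : graph n | [&& forest G, symmetric_graph N G, ~~ all_short N G & #|G| == n - k]]|.
Proof.
move=> Hn He le_kn; rewrite -[LHS](cardsID [set G : graph n | all_short N G]).
have memA (G : graph n) : (G \in [set G in NCF n k | rotate N G == G])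
    = [&& forest G, #|G| == n - k & symmetric_graph N G].
  by rewrite andbA -NCF_forest // in_set.
congr (_ + _); apply: eq_card => G.
  rewrite in_setI memA !in_set /sym_forest.
  by case: (forest G); case: (symmetric_graph N G); case: (all_short N G); rewrite /= ?andbT ?andbF.
rewrite in_setD memA !in_set.
by case: (forest G); case: (symmetric_graph N G); case: (all_short N G); rewrite /= ?andbT ?andbF.
Qed.

End Rho.

Section FixedPoints.
Variables n' e k N : nat.
Local Notation n := n'.+1.
Hypotheses (Hn : n = e * N) (He : 1 < e) (k_gt0 : 0 < k) (le_kn : k <= n).

Let N_gt0 : 0 < N. Proof. by case: N Hn => //; rewrite muln0. Qed.

(** A chord that is not short is a diameter, which forces [e = 2] and an odd number of edges. *)
Lemma card_not_short_eq0 : (e = 2 -> ~~ odd (n - k)) ->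
  #|[set G : graph n | [&& forest G, symmetric_graph N G, ~~ all_short N G & #|G| == n - k]]| = 0.
Proof.
move=> e2; apply/eqP; rewrite cards_eq0; apply/eqP/setP => G; rewrite !inE.
apply/negP => /and4P[fG sG aG /eqP cG].
have [/eqP e2'|ne2] := boolP (e == 2).
  have Hn2 : n = 2 * N by rewrite Hn e2'.
  have := @diam_forest_odd n' N Hn2 G; rewrite /diam_forest fG sG aG cG => /(_ isT).
  by rewrite (negPf (e2 e2')).
case/negP: aG; apply/all_shortP => x y xy.
have [h|[h|[h _]]] := symmetric_edge Hn He fG sG xy; [by left|by right|].
by rewrite h in ne2.
Qed.

(** The edges of such a forest fall into [e] equal blocks, so [e] divides [n-k] as well as [n]. *)
Lemma card_short_eq0 : ~~ (e %| k) ->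
  #|[set G : graph n | sym_forest N G && (#|G| == n - k)]| = 0.
Proof.
move=> ek; apply/eqP; rewrite cards_eq0; apply/eqP/setP => G; rewrite !inE.
apply/negP => /andP[sfG /eqP cG].
have [m [j [_ Em _]]] := sym_forest_dvd Hn He sfG.
case/negP: ek; rewrite -(@dvdn_subr _ n) ?Hn ?dvdn_mulr // -?Hn //.
by rewrite -cG Em dvdn_mulr.
Qed.

Lemma card_fixed_dvd : e %| k ->
  #|[set G in NCF n k | rotate N G == G]| * ((3 * n - 2 * k) %/ e)
    = (k %/ e) * 'C(n %/ e, k %/ e) * 'C((3 * n - 2 * k) %/ e, (n - k) %/ e).
Proof.
case/dvdnP => K EK; have e_gt0 : 0 < e by lia.
have K_gt0 : 0 < K by case: (K) EK => //; lia.
have le_KN : K <= N by rewrite -(leq_pmul2r e_gt0) -EK mulnC -Hn.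
rewrite (n_fixed_split Hn He le_kn) card_not_short_eq0 ?addn0; last first.
  by move=> e2; rewrite EK; move: Hn; rewrite e2; lia.
have -> : (3 * n - 2 * k) %/ e = 3 * N - 2 * K.
  by rewrite Hn EK [e * N]mulnC !mulnA -mulnBl mulnK.
have -> : (n - k) %/ e = N - K by rewrite Hn EK [e * N]mulnC -mulnBl mulnK.
have -> : n %/ e = N by rewrite Hn mulKn.
have -> : k %/ e = K by rewrite EK mulnK.
by rewrite EK [K * e]mulnC; apply: card_sym_forest_nat.
Qed.

Lemma card_fixed_ndvd : 2 < e -> ~~ (e %| k) ->
  #|[set G in NCF n k | rotate N G == G]| = 0.
Proof.
move=> e2 ek; rewrite (n_fixed_split Hn He le_kn) card_short_eq0 // card_not_short_eq0 //.
by lia.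
Qed.

Lemma card_fixed_odd : e = 2 -> odd k ->
  #|[set G in NCF n k | rotate N G == G]|
    = 'C(n %/ 2, (k - 1) %/ 2) * 'C((3 * n - 2 * k - 2) %/ 2, (n - k - 1) %/ 2).
Proof.
move=> e2 ok; have Hn2 : n = 2 * N by rewrite Hn e2.
rewrite (n_fixed_split Hn He le_kn) card_short_eq0; last by rewrite e2; lia.
pose m := (n - k - 1) %/ 2.
have Em : n - k = m.*2.+1 by rewrite /m; lia.
rewrite add0n (eq_card (B := [set G : graph n | diam_forest N G && (#|G| == m.*2.+1)])); last first.
  by move=> G; rewrite !inE Em -!andbA.
rewrite card_diam_forest_nat // -/m; congr (_ * _).
  (* The count has [m+1] chosen among [N]; the complementary index is [N-m-1 = (k-1)/2]. *)
  rewrite Hn2 mulKn // -bin_sub; last by lia.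
  congr 'C(_, _); lia.
by congr 'C(_, _); lia.
Qed.

End FixedPoints.

Local Open Scope ring_scope.

Theorem theorem1p3 (n k : nat) (hn : (1 <= n)%N) (hk1 : (1 <= k)%N) (hkn : (k <= n)%N) :
  exists f : {poly rat},
    [/\ f * qint (2 * n - k) = qbinom n (k - 1) * qbinom (3 * n - 2 * k - 1) (n - k),
        (forall i : nat, f`_i \is a Num.nat)
      & forall c : {perm 'I_n}, c \in <[rho n]>%g ->
          forall w : algC, (#[c]%g).-primitive_root w ->
            (map_poly ratr f).[w] = (n_fixed k c)%:R].
Proof.
have [f [f1 f2 fnat]] := forest_poly hn hk1 hkn.
exists f; split; rewrite ?qbinom_qbin // => c cr w prim_w.
case: n hn hkn f1 f2 c cr prim_w => // n' hn hkn f1 f2 c cr prim_w.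
rewrite n_fixed_rho //.
have dvd_c : (#[c]%g %| n'.+1)%N by have := order_dvdG cr; rewrite -orderE order_rho.
move: #[c]%g (order_gt0 c) dvd_c prim_w => e e_gt0 dvd_e prim_w {c cr}.
have Hn : n'.+1 = (e * (n'.+1 %/ e))%N by rewrite mulnC divnK.
have N1 : e = 1%N -> (n'.+1 %/ e)%N = n'.+1 by move=> ->; rewrite divn1.
move: (n'.+1 %/ e)%N Hn N1 => N Hn N1.
have [e1|e_neq1] := eqVneq e 1%N.
  have := forest_poly_eval1 f1 prim_w e1; rewrite -natrM -card_NCF_nat // natrM.
  have -> : [set G in NCF n'.+1 k | rotate N G == G] = NCF n'.+1 k.
    apply/setP => G; rewrite in_set andb_idr // => _.
    by rewrite N1 // rotate_n.
  by apply: mulIf; rewrite pnatr_eq0; lia.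
have e_gt1 : (1 < e)%N by lia.
have [ek|nek] := boolP (e %| k)%N.
  have := forest_poly_eval_dvd hn hk1 hkn f2 prim_w dvd_e e_gt1 ek.
  rewrite -!natrM -(card_fixed_dvd Hn e_gt1 hk1 hkn ek) natrM.
  apply: mulIf; rewrite pnatr_eq0 -lt0n divn_gt0 // dvdn_leq //; first by lia.
  by rewrite dvdn_sub // dvdn_mull.
(* From here [e] does not divide [k], so a fixed forest must contain a diameter and [e] must be 2.
   If [e] does not divide [k-1] either, then [e] is not 2. *)
have [ek1|nek1] := boolP (e %| k - 1)%N; last first.
  rewrite (forest_poly_eval_ndvd hn hk1 hkn f1 prim_w dvd_e nek nek1).
  have ne2 : e != 2%N by apply: contraNneq nek1 => e2; move: nek; rewrite e2; lia.
  by rewrite (card_fixed_ndvd Hn) //; lia.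
have [e2|ne2] := eqVneq e 2%N.
  have ok : odd k by move: nek; rewrite e2; lia.
  rewrite (forest_poly_eval2 hn hk1 hkn f1 prim_w dvd_e e2 ok) -natrM.
  by rewrite (card_fixed_odd Hn).
have e_gt2 : (2 < e)%N by lia.
rewrite (forest_poly_eval_pred hn hk1 hkn f1 prim_w dvd_e e_gt2 ek1).
by rewrite (card_fixed_ndvd Hn).
Qed.
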